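(* Let $\beta\in\mathbb R\setminus[-\frac12,0]$ and $1<p<\infty$. Then: (i) $\mathscr H^{\frac{2\beta+1}{2p}}:[V^\infty,\dot{BV}]_{\frac1p,1}\to L^{p,\infty}(\lambda_\beta)$ is bounded. (ii) Let $u=Uf$ solve the problem $\frac{\partial u}{\partial t}=\Delta u$, $u|_{t=0}=f$, for $t>0$. Then $$f\in[V^\infty,\dot{BV}]_{\frac23,1}\implies\frac{\partial u}{\partial t}=\Delta_xu\in L^{\frac32,\infty}(\mathbb R^{d+1}_+,dx\,dt),$$ $$f\in[V^\infty,\dot{BV}]_{\frac13,1}\implies\nabla_xu\in L^{3,\infty}(\mathbb R^{d+1}_+,dx\,dt).$$
   Context: All function spaces are over $\mathbb R^d$, $d\ge1$; $\mathbb R^{d+1}_+=\{(x,t):x\in\mathbb R^d,t>0\}$. $V^\infty$ is the quotient of $L^\infty(\mathbb R^d)$ by constants, with norm $\inf_{c\in\mathbb C}\|f-c\|_\infty$. $\dot{BV}$ is the homogeneous space of functions of bounded variation: locally integrable functions, modulo constants, whose distributional gradient is a finite Radon measure, normed by the total variation of the gradient. $[X_0,X_1]_{\theta,r}$ is the real interpolation space (Peetre $K_{\theta,r}$ method), with norm $\big(\int_0^\infty(t^{-\theta}K(t,f))^r\frac{dt}{t}\big)^{1/r}$, $K(t,f)=\inf_{f=f_0+f_1}\|f_0\|_{X_0}+t\|f_1\|_{X_1}$. $Uf(x,t)=e^{t\Delta}f(x)$ is the heat extension of $f$ to $\mathbb R^{d+1}_+$ (convolution with the heat kernel). For $b\in\mathbb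 R$, $t>0$, $\mathscr H^b=(\mathscr H^b_1,\dots,\mathscr H^b_{d+1})$ with $\mathscr H^b_jf(x,t)=t^{\frac12-b}\frac{\partial}{\partial x_j}Uf(x,t)$ for $j=1,\dots,d$ and $\mathscr H^b_{d+1}f(x,t)=t^{1-b}\frac{\partial}{\partial t}Uf(x,t)$. These derivatives are unchanged when a constant is added to $f$. The measure $\lambda_\beta$ on $\mathbb R^{d+1}_+$ is $\lambda_\beta(E)=\iint_Edx\frac{dt}{t^{1-\beta}}$, and $L^{p,\infty}(\mu)$ is weak $L^p$: $[g]_{L^{p,\infty}(\mu)}=\sup_{\lambda>0}\lambda\,\mu(\{|g|>\lambda\})^{1/p}$. *)

(* Defs.v *)
From HB Require Import structures.
From mathcomp Require Import all_boot all_order all_algebra.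
From mathcomp Require Import all_classical all_reals all_analysis.
From mathcomp Require Import complex.

Set Implicit Arguments.
Unset Strict Implicit.
Unset Printing Implicit Defensive.

Import Order.TTheory GRing.Theory Num.Theory.
Import numFieldNormedType.Exports.

Local Open Scope classical_set_scope.
Local Open Scope ring_scope.

(* The library puts a topology and a norm on ['rV[R]_n], but no sigma-algebra.
   We use the one generated by the coordinates, i.e. the Borel sigma-algebra. *)
Fact rV_display : measure_display. Proof. exact: default_measure_display. Qed.

Section measurable_rV.
Context {R : realType} {n : nat}.

Let coor (i : 'I_n) (x : 'rV[R]_n) : R := x ord0 i.

Let rV_set0 : g_sigma_preimage coor set0.
Proof. exact: sigma_algebra0. Qed.

Let rV_setC A : g_sigma_preimage coor A -> g_sigma_preimage coor (~` A).
Proof. exact: sigma_algebraC. Qed.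

Let rV_bigcup (F : (set 'rV[R]_n)^nat) :
  (forall i, g_sigma_preimage coor (F i)) ->
  g_sigma_preimage coor (\bigcup_i F i).
Proof. exact: sigma_algebra_bigcup. Qed.

HB.instance Definition _ := @isMeasurable.Build rV_display
  'rV[R]_n (g_sigma_preimage coor) rV_set0 rV_setC rV_bigcup.

End measurable_rV.

Section measurable_rV_theory.
Context {R : realType}.

Lemma measurable_coord n (i : 'I_n) :
  measurable_fun [set: 'rV[R]_n] (fun x : 'rV[R]_n => x ord0 i : R).
Proof.
move=> _ Y mY; rewrite setTI; apply: sub_sigma_algebra => /=.
rewrite -bigcup_seq/=; exists i => /=; first by rewrite mem_index_enum.
by exists Y => //; rewrite setTI.
Qed.

Lemma measurable_fun_rV d (T : measurableType d) n (f : T -> 'rV[R]_n) :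
  (forall i, measurable_fun [set: T] (fun x => f x ord0 i : R)) ->
  measurable_fun [set: T] f.
Proof.
move=> mf _ A mA; rewrite setTI.
have : g_sigma_preimage (fun i x => f x ord0 i : R) (f @^-1` A).
  rewrite (_ : (fun i x => _) =
      (fun i => (fun v : 'rV[R]_n => v ord0 i : R) \o f)) //.
  by rewrite g_sigma_preimage_comp; exists A => //; rewrite setTI.
apply: smallest_sub; first exact: sigma_algebra_measurable.
rewrite -bigcup_seq; apply: bigcup_sub => i _ _ [B mB <-].
exact: mf.
Qed.

End measurable_rV_theory.

Lemma sigma_finite_product_measure d1 d2 (T1 : measurableType d1)
    (T2 : measurableType d2) (R : realType)
    (m1 : {sigma_finite_measure set T1 -> \bar R})
    (m2 : {sigma_finite_measure set T2 -> \bar R}) :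
  sigma_finite setT (m1 \x m2)%E.
Proof.
have /sigma_finiteP[F [TF ndF Foo]] := sigma_finiteT m1.
have /sigma_finiteP[G [TG ndG Goo]] := sigma_finiteT m2.
exists (fun n => F n `*` G n).
  rewrite -setXTT TF TG predeqE => -[x y]; split.
    move=> [/= [n _ Fnx] [k _ Gky]]; exists (maxn n k) => //; split.
    - by move: x Fnx; exact/subsetPset/ndF/leq_maxl.
    - by move: y Gky; exact/subsetPset/ndG/leq_maxr.
  by move=> [n _ []/= ? ?]; split; exists n.
move=> k; have [? ?] := Foo k; have [? ?] := Goo k.
split; first exact: measurableX.
by rewrite product_measure1E// lte_mul_pinfty// ge0_fin_numE.
Qed.

(* Lebesgue measure on ['rV[R]_n], by recursion on [n]: the image of the
   product of Lebesgue measure on R with Lebesgue measure on ['rV[R]_n] under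
   [(a, v) |-> (a, v_1, ..., v_n)]. *)
Section cons_measure.
Context {R : realType} {n : nat}.

Definition consrV (z : R * 'rV[R]_n) : 'rV[R]_n.+1 :=
  \row_i oapp (fun j => z.2 ord0 j) z.1 (unlift ord0 i).

Definition unconsrV (x : 'rV[R]_n.+1) : R * 'rV[R]_n :=
  (x ord0 ord0, \row_j x ord0 (lift ord0 j)).

Lemma consrVK : cancel consrV unconsrV.
Proof.
move=> [a v]; rewrite /unconsrV /consrV mxE unlift_none /=; congr pair.
by apply/rowP => j; rewrite !mxE liftK.
Qed.

Lemma measurable_consrV : measurable_fun setT consrV.
Proof.
apply: measurable_fun_rV => i.
have [j ->|->] := unliftP ord0 i.
  rewrite (_ : (fun _ => _) = (fun v : 'rV[R]_n => v ord0 j : R) \o snd).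
    by apply: measurableT_comp; [exact: measurable_coord|exact: measurable_snd].
  by apply/funext => z /=; rewrite mxE liftK.
rewrite (_ : (fun _ => _) = fst); first exact: measurable_fst.
by apply/funext => z /=; rewrite mxE unlift_none.
Qed.

Lemma measurable_unconsrV : measurable_fun setT unconsrV.
Proof.
apply: measurable_fun_pair; first exact: measurable_coord.
apply: measurable_fun_rV => i.
under eq_fun do rewrite mxE.
exact: measurable_coord.
Qed.

Variable m : {sigma_finite_measure set 'rV[R]_n -> \bar R}.

Definition cons_measure : set 'rV[R]_n.+1 -> \bar R :=
  pushforward (lebesgue_measure \x m)%E consrV.

Let cons_measure0 : cons_measure set0 = 0%E.
Proof. by rewrite /cons_measure /pushforward preimage_set0 measure0. Qed.

Let cons_measure_ge0 A : (0 <= cons_measure A)%E.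
Proof. by rewrite /cons_measure /pushforward; exact: measure_ge0. Qed.

Let cons_measure_sigma_additive : semi_sigma_additive cons_measure.
Proof.
move=> F mF tF mUF; rewrite /cons_measure /pushforward preimage_bigcup.
have mpre A : measurable A -> measurable (consrV @^-1` A).
  by move=> mA; rewrite -[X in measurable X]setTI; exact: measurable_consrV.
apply: measure_semi_sigma_additive => [k| |]; first exact: mpre.
  apply/trivIsetP => /= i j _ _ ij; rewrite -preimage_setI.
  by move/trivIsetP : tF => /(_ _ _ _ _ ij) ->//; rewrite preimage_set0.
by rewrite -preimage_bigcup; exact: mpre.
Qed.

HB.instance Definition _ := isMeasure.Build _ _ _ cons_measure
  cons_measure0 cons_measure_ge0 cons_measure_sigma_additive.

Let cons_measure_sigma_finite : sigma_finite setT cons_measure.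
Proof.
have [F FT Foo] := sigma_finite_product_measure (@lebesgue_measure R) m.
exists (fun k => unconsrV @^-1` F k); first by rewrite -preimage_bigcup -FT.
move=> k; have [mF Fk] := Foo k; split.
  by rewrite -[X in measurable X]setTI; exact: measurable_unconsrV.
rewrite /cons_measure /pushforward -comp_preimage.
by rewrite (_ : unconsrV \o consrV = id) //; apply/funext => z /=; rewrite consrVK.
Qed.

HB.instance Definition _ := Measure_isSigmaFinite.Build _ _ _ cons_measure
  cons_measure_sigma_finite.

End cons_measure.

Fixpoint lebesgue_rV (R : realType) (n : nat) :
    {sigma_finite_measure set 'rV[R]_n -> \bar R} :=
  match n with
  | 0 => (\d_ (0 : 'rV[R]_0) : {sigma_finite_measure set 'rV[R]_0 -> \bar R})
  | n'.+1 => cons_measure (lebesgue_rV R n')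
  end.

Lemma measurable_rV_box (R : realType) n (A : 'I_n -> set R) :
  (forall i, measurable (A i)) ->
  measurable [set x : 'rV[R]_n | forall i, A i (x ord0 i)].
Proof.
move=> mA.
rewrite (_ : [set _ | _] = \bigcap_(i in [set: 'I_n])
    ((fun x : 'rV[R]_n => x ord0 i : R) @^-1` A i)); last first.
  by apply/seteqP; split => x /= h i; [move=> _|]; exact: h.
apply: fin_bigcap_measurable => // i _.
by rewrite -[X in measurable X]setTI; exact: measurable_coord.
Qed.

Lemma lebesgue_rV_box (R : realType) n (A : 'I_n -> set R) :
  (forall i, measurable (A i)) ->
  lebesgue_rV R n [set x | forall i, A i (x ord0 i)] =
  (\prod_(i < n) lebesgue_measure (A i))%E.
Proof.
elim: n A => [A _|n IH A mA] /=.
  by rewrite big_ord0 diracE mem_set //= => -[].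
rewrite /cons_measure /pushforward big_ord_recl -IH//.
rewrite -product_measure1E; last first.
- exact: (measurable_rV_box (fun i => mA (lift ord0 i))).
- exact: mA.
congr (_ _); apply/seteqP; split => [[a v]|[a v]] /=.
  move=> h; split => [|i].
    by have := h ord0; rewrite mxE unlift_none.
  by have := h (lift ord0 i); rewrite mxE liftK.
move=> [h0 h] i; have [j ->|->] := unliftP ord0 i.
  by rewrite mxE liftK; exact: h.
by rewrite mxE unlift_none.
Qed.

Import Normc.

Section complex_valued.
Context {R : realType}.
Local Open Scope complex_scope.

(* Measure theory and differential calculus of complex-valued functions (of real
   arguments) are understood componentwise. *)
Definition cmeasurable d (T : measurableType d) (D : set T) (f : T -> R[i]) :=
  measurable_fun D (fun x => complex.Re (f x)) /\ measurable_fun D (fun x => complex.Im (f x)).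

Definition cintegral d (T : measurableType d) (mu : {measure set T -> \bar R})
    (f : T -> R[i]) : R[i] :=
  Rintegral mu setT (fun x => complex.Re (f x)) +i* Rintegral mu setT (fun x => complex.Im (f x)).

Definition cderivable (V : normedModType R) (f : V -> R[i]) (x v : V) :=
  derivable (fun y => complex.Re (f y)) x v /\ derivable (fun y => complex.Im (f y)) x v.

Definition cderive (V : normedModType R) (f : V -> R[i]) (x v : V) : R[i] :=
  'D_v (fun y => complex.Re (f y)) x +i* 'D_v (fun y => complex.Im (f y)) x.

Definition cvec_norm n (z : 'rV[R[i]]_n) : R :=
  Num.sqrt (\sum_(j < n) normc (z ord0 j) ^+ 2).

End complex_valued.

Section function_spaces.
Context {R : realType} {d : nat}.
Local Open Scope complex_scope.

Local Notation E := 'rV[R]_d.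
Local Notation mu := (lebesgue_rV R d).
Local Notation e_ j := (delta_mx ord0 j : 'rV[R]_d).

(* Elements of spaces "modulo constants" (and modulo null sets) are handled
   through their representatives; this is equality of the classes. *)
Definition eq_mod_const (f g : E -> R[i]) :=
  exists c : R[i], {ae mu, forall x, f x = g x + c}.

Definition loc_integrable (f : E -> R[i]) :=
  cmeasurable setT f /\
  forall K : set E, compact K -> (\int[mu]_(x in K) (normc (f x))%:E < +oo)%E.

Definition Linfty_norm (f : E -> R[i]) : \bar R :=
  ('N[mu]_+oo [(fun x => (normc (f x))%:E)])%E.

Definition Vinfty : set (E -> R[i]) :=
  [set f | cmeasurable setT f /\ (Linfty_norm f < +oo)%E].

Definition Vinfty_norm (f : E -> R[i]) : \bar R :=
  ereal_inf [set Linfty_norm (fun x => f x - c) | c in [set: R[i]]].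

Definition iter_partial (s : seq 'I_d) (phi : E -> R) : E -> R :=
  foldr (fun j psi x => 'D_(e_ j) psi x) phi s.

Definition smooth (phi : E -> R) := forall s : seq 'I_d,
  continuous (iter_partial s phi) /\
  forall j x, derivable (iter_partial s phi) x (e_ j).

Definition test_function (phi : E -> R) :=
  smooth phi /\ compact (closure [set x | phi x != 0]).

(* Integral against a signed measure; the Jordan decomposition does not depend
   on the Hahn decomposition that is chosen. *)
Definition charge_integral (nu : {charge set E -> \bar R}) (phi : E -> R) : R :=
  let: exist P hP := cid (Hahn_decomposition nu) in
  let: exist N nuPN := cid hP in
  Rintegral (jordan_pos nuPN) setT phi - Rintegral (jordan_neg nuPN) setT phi.

(* Finite complex Borel measures, as pairs (real part, imaginary part) of
   finite signed measures. On R^d all of them are Radon measures. *)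
Definition cmeasure : Type :=
  ({charge set E -> \bar R} * {charge set E -> \bar R})%type.

Definition cmeasure_val (nu : cmeasure) (A : set E) : R[i] :=
  fine (nu.1 A) +i* fine (nu.2 A).

Definition cmeasure_integral (nu : cmeasure) (phi : E -> R) : R[i] :=
  charge_integral nu.1 phi +i* charge_integral nu.2 phi.

(* Total variation of a C^d-valued measure, w.r.t. the Euclidean norm of C^d. *)
Definition vmeasure_variation (nu : 'I_d -> cmeasure) : \bar R :=
  ereal_sup [set (\sum_(k <oo) (cvec_norm (\row_j cmeasure_val (nu j) (A k)))%:E)%E
    | A in [set A : (set E)^nat | [/\ forall k, measurable (A k),
        trivIset setT A & \bigcup_k A k = setT]]].

Definition distr_gradient (f : E -> R[i]) (nu : 'I_d -> cmeasure) :=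
  forall phi, test_function phi -> forall j,
    cintegral mu (fun x => f x * ('D_(e_ j) phi x)%:C) =
    - cmeasure_integral (nu j) phi.

Definition BV : set (E -> R[i]) :=
  [set f | loc_integrable f /\ exists nu, distr_gradient f nu].

(* The gradient measure is unique, so this is an infimum over one value. *)
Definition BV_norm (f : E -> R[i]) : \bar R :=
  ereal_inf [set vmeasure_variation nu | nu in distr_gradient f].

End function_spaces.

Section interpolation.
Context {R : realType} {d : nat}.

Local Notation F := ('rV[R]_d -> R[i]).

(* Real interpolation of two spaces [X0], [X1] of locally integrable functions
   modulo constants, with (semi)norms [N0], [N1]. *)
Definition K_functional (X0 : set F) (N0 : F -> \bar R) (X1 : set F)
    (N1 : F -> \bar R) (t : R) (f : F) : \bar R :=
  ereal_inf [set k | exists f0 f1, [/\ X0 f0, X1 f1,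
    eq_mod_const f (fun x => f0 x + f1 x) & k = (N0 f0 + t%:E * N1 f1)%E]].

Definition interp_norm (X0 : set F) (N0 : F -> \bar R) (X1 : set F)
    (N1 : F -> \bar R) (theta r : R) (f : F) : \bar R :=
  ((\int[lebesgue_measure]_(t in `]0%R, +oo[)
     (((t `^ (- theta))%:E * K_functional X0 N0 X1 N1 t f) `^ r * (t^-1)%:E))
   `^ r^-1)%E.

Definition interp (X0 : set F) (N0 : F -> \bar R) (X1 : set F)
    (N1 : F -> \bar R) (theta r : R) : set F :=
  [set f | [/\ loc_integrable f,
    exists f0 f1, [/\ X0 f0, X1 f1 & eq_mod_const f (fun x => f0 x + f1 x)] &
    (interp_norm X0 N0 X1 N1 theta r f < +oo)%E]].

End interpolation.

Definition VBV {R : realType} {d : nat} (theta r : R) :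
    set ('rV[R]_d -> R[i]) :=
  interp Vinfty Vinfty_norm BV BV_norm theta r.

Definition VBV_norm {R : realType} {d : nat} (theta r : R) :
    ('rV[R]_d -> R[i]) -> \bar R :=
  interp_norm Vinfty Vinfty_norm BV BV_norm theta r.

Section heat_extension.
Context {R : realType} {d : nat}.
Local Open Scope complex_scope.

Local Notation E := 'rV[R]_d.

Definition heat_kernel (t : R) (x : E) : R :=
  (4 * pi * t) `^ (- (d%:R / 2)) *
  expR (- (\sum_(j < d) x ord0 j ^+ 2) / (4 * t)).

(* [heat_ext f x t] is the heat extension only for [t > 0]; everything below
   looks at it on the upper half-space only. *)
Definition heat_ext (f : E -> R[i]) (x : E) (t : R) : R[i] :=
  cintegral (lebesgue_rV R d) (fun y => (heat_kernel t (x - y))%:C * f y).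

Definition dx (j : 'I_d) (u : E -> R -> R[i]) (x : E) (t : R) : R[i] :=
  cderive (fun y => u y t) x (delta_mx ord0 j).

Definition dt (u : E -> R -> R[i]) (x : E) (t : R) : R[i] :=
  cderive (fun s : R => u x s) t 1.

Definition gradx (u : E -> R -> R[i]) (x : E) (t : R) : 'rV[R[i]]_d :=
  \row_j dx j u x t.

Definition laplacian (u : E -> R -> R[i]) (x : E) (t : R) : R[i] :=
  \sum_(j < d) dx j (dx j u) x t.

Definition heat_equation (u : E -> R -> R[i]) := forall x (t : R), 0 < t ->
  [/\ cderivable (fun s : R => u x s) t 1,
      forall j, cderivable (fun y => u y t) x (delta_mx ord0 j) /\
                cderivable (fun y => dx j u y t) x (delta_mx ord0 j) &
      dt u x t = laplacian u x t].

Definition heat_op (b : R) (f : E -> R[i]) (z : E * R) : 'rV[R[i]]_(d + 1) :=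
  row_mx (\row_j ((z.2 `^ (2^-1 - b))%:C * dx j (heat_ext f) z.1 z.2))
         (const_mx ((z.2 `^ (1 - b))%:C * dt (heat_ext f) z.1 z.2)).

End heat_extension.

Section weak_Lp.
Context {R : realType} {d : nat}.

Local Notation E := 'rV[R]_d.

Definition upper_half : set (E * R) := [set z | 0 < z.2].

(* Both measures live on the upper half-space: the part of [A] outside of it is
   ignored, so that [weak_norm] below only sees [g] on the half-space. *)
Definition dxdt (A : set (E * R)) : \bar R :=
  (lebesgue_rV R d \x @lebesgue_measure R)%E (A `&` upper_half).

Definition lambda (beta : R) (A : set (E * R)) : \bar R :=
  (\int[lebesgue_rV R d \x @lebesgue_measure R]_(z in A `&` upper_half)
    ((z.2 `^ (1 - beta))^-1)%:E)%E.

Definition weak_norm (mu : set (E * R) -> \bar R) (p : R) (n : nat)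
    (g : E * R -> 'rV[R[i]]_n) : \bar R :=
  ereal_sup [set (l%:E * mu [set z | (l < cvec_norm (g z))%R] `^ p^-1)%E
    | l in [set l : R | 0 < l]].

Definition weakL (mu : set (E * R) -> \bar R) (p : R) (n : nat) :
    set (E * R -> 'rV[R[i]]_n) :=
  [set g : E * R -> 'rV[R[i]]_n |
           (forall j, cmeasurable upper_half (fun z => g z ord0 j)) /\
           (weak_norm mu p g < +oo)%E].

Definition bounded_into_weakL (X : set (E -> R[i])) (N : (E -> R[i]) -> \bar R)
    (mu : set (E * R) -> \bar R) (p : R) (n : nat)
    (T : (E -> R[i]) -> E * R -> 'rV[R[i]]_n) :=
  exists C : R, forall f, X f ->
    weakL mu p (T f) /\ (weak_norm mu p (T f) <= C%:E * N f)%E.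

End weak_Lp.

(* Main.v *)
(** For each [t], let [G f (x, t)] be the sum over [j] of [t^(1/2) |d_j Uf|] and
    [t |d_j^2 Uf|]; then [|H^b f| <= t^(-b) G f]. The pointwise bounds of the
    derivatives of the heat kernel [h_t] by [t^(-1/2) h_(2t)] and [t^(-1) h_(2t)]
    give [sup_x G f <= C |f|_Vinf]. If [f] is in BV, testing its gradient against
    tensor products of bumps gives [|f(. + h e_j) - f|_1 <= h |f|_BV], and Fatou's
    lemma for difference quotients of [Uf] gives
    [|G f (., t)|_1 <= C t^(1/2) |f|_BV].

    Let [K] be the K-functional of [f], and [N] its norm. If [K(tau) < c l t^b],
    a decomposition [f = f0 + f1] that is almost optimal at [tau] has
    [t^(-b) G f0 <= l / 2], and Markov's inequality for [f1] bounds the measure of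
    [{x : t^(-b) G f > l}] by [C t^(1/2) / tau]. Letting [tau] grow until it leaves
    [{K < c l t^b}], this is at most [C t^(1/2)] times the integral of [tau^(-2)]
    over [{K >= c l t^b}]. Integrate against [t^(beta - 1) dt], where
    [beta + 1/2 = b p] and [b <> 0]; by Tonelli's theorem the level set has
    measure at most [C l^(-p)] times the integral of [K(tau)^p tau^(-2)], and
    [K(tau) <= C N tau^(1/p)] bounds that integral by [C N^p]. *)
From HB Require Import structures.
Require Import Defs.
From mathcomp Require Import all_boot all_order all_algebra.
From mathcomp Require Import all_classical all_reals all_analysis.
From mathcomp Require Import complex ring lra measurable_realfun gauss_integral.
From mathcomp Require Import ess_sup_inf.
Import Order.TTheory GRing.Theory Num.Theory.
Import numFieldNormedType.Exports.
Local Open Scope classical_set_scope.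
Local Open Scope ring_scope.
Set Implicit Arguments.
Unset Strict Implicit.
Unset Printing Implicit Defensive.

(** * Lebesgue measure on open boxes *)

(** The heat extension is an integral, and nothing makes it converge for a function that is merely
    locally integrable. Essentially bounded parts are harmless; for a part of bounded variation,
    integrability against Gaussians is extracted from the translation estimate itself, by averaging
    over base points in the unit box.

    In the translation estimate, bumps tending to indicators of boxes turn the defining identity of
    the gradient into an identity on boxes between the increment of [f] and the Jordan parts of a
    gradient component, swept along a segment of length [h]. As the increment is not yet known to be
    integrable, negative parts are moved across: two positive measures that agree on boxes agree on
    all Borel sets, and evaluating them where the increment has a given sign bounds its [L^1] norm.
    The masses of the Jordan parts are controlled because the two Hahn sets form a partition
    admissible for the variation.

    The sign of [b] decides whether [{t : t^b <= U}] is a half-line at 0 or at infinity; in both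
    cases [t^(b p - 1)] is integrable on it. *)

Section open_boxes.
Context {R : realType} {n : nat}.
Local Notation E := 'rV[R]_n.

(** Open intervals are chosen because smooth bumps supported in them converge pointwise to their
    indicators, endpoints included. *)
Definition obox (a b : 'I_n -> R) : set E :=
  [set x | forall i, x ord0 i \in `]a i, b i[].

Definition oboxes : set (set E) := [set A | exists a b, A = obox a b].

Lemma measurable_obox a b : measurable (obox a b).
Proof.
exact: (measurable_rV_box (fun i => measurable_itv `]a i, b i[)).
Qed.

Lemma lebesgue_obox a b :
  lebesgue_rV R n (obox a b) = (\prod_(i < n) lebesgue_measure `]a i, b i[%classic)%E.
Proof.
by rewrite -(lebesgue_rV_box (fun i => measurable_itv `]a i, b i[)).
Qed.

Lemma lebesgue_obox_lty a b : (lebesgue_rV R n (obox a b) < +oo)%E.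
Proof.
rewrite lebesgue_obox.
suff : ((\prod_(i < n) lebesgue_measure `]a i, b i[%classic)%E \is a fin_num).
  by move/fin_numPlt => /andP[].
apply: (big_ind (fun x : \bar R => x \is a fin_num)) => //; first by move=> x y; exact: fin_numM.
by move=> i _; rewrite lebesgue_measure_itv /=; case: ifP.
Qed.

Lemma oboxes_setI : setI_closed oboxes.
Proof.
move=> _ _ [a [b ->]] [a' [b' ->]].
exists (fun i => Num.max (a i) (a' i)), (fun i => Num.min (b i) (b' i)).
apply/seteqP; split => x /=.
  move=> [h h'] i; have := h i; have := h' i.
  by rewrite !in_itv/= lt_min gt_max => /andP[-> ->] /andP[-> ->].
move=> h; split => i; have := h i; rewrite !in_itv/= lt_min gt_max.
  by move=> /andP[/andP[-> _] /andP[-> _]].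
by move=> /andP[/andP[_ ->] /andP[_ ->]].
Qed.

Definition nbox (N : nat) : set E := obox (fun=> - N%:R) (fun=> N%:R).

Lemma nbox_oboxes N : oboxes (nbox N). Proof. by exists (fun=> - N%:R), (fun=> N%:R). Qed.

Lemma nboxP N x : nbox N x <-> forall i, `|x ord0 i| < N%:R.
Proof. by split => h i; have := h i; rewrite in_itv/= ltr_norml. Qed.

Lemma bigcup_nbox : \bigcup_k (nbox k) = setT.
Proof.
apply/seteqP; split => // x _.
have [N hN] : exists N : nat, \sum_i `|x ord0 i| < N%:R.
  by exists (Num.bound (\sum_i `|x ord0 i|)); rewrite -(ger0_norm (sumr_ge0 _ _)) ?archi_boundP.
exists N => //; apply/nboxP => i; apply: le_lt_trans hN.
by rewrite (bigD1 i)//= lerDl sumr_ge0.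
Qed.

Lemma measurable_nbox N : measurable (nbox N).
Proof. exact: measurable_obox. Qed.

(** A coordinate half-space [x_i > a] is a countable union of boxes with lower side [a] in direction
    [i] and sides [-k], [k] elsewhere, so the coordinates are measurable for the sigma-algebra of
    boxes. *)
Lemma measurable_oboxes : @measurable _ E = <<s oboxes >>.
Proof.
apply/seteqP; split; last first.
  apply: smallest_sub; first exact: sigma_algebra_measurable.
  by move=> _ [a [b ->]]; exact: measurable_obox.
apply: smallest_sub; first exact: smallest_sigma_algebra.
rewrite -bigcup_seq; apply: bigcup_sub => i _ A [B mB <-].
have : measurable_fun [set: g_sigma_algebraType oboxes] (fun v : E => v ord0 i : R).
  apply: (measurability _ (measurable_realfun.RGenOInfty.measurableE R)) => _ [_ [a ->] <-].
  have -> : [set: E] `&` (fun v : E => v ord0 i) @^-1` `]a, +oo[%classic =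
      \bigcup_k ((fun k => obox (fun j => if j == i then a else - k%:R) (fun=> k%:R)) k).
    rewrite setTI; apply/seteqP; split => x /=.
      rewrite in_itv/= andbT => ax.
      have : (\bigcup_k (nbox k)) x by rewrite bigcup_nbox.
      move=> [k _ /nboxP xk]; exists k => // j; have := xk j.
      rewrite in_itv/= ltr_norml => /andP[h1 h2]; rewrite h2 andbT.
      by case: eqP => [->|].
    move=> [k _ /(_ i)]; rewrite eqxx !in_itv/= andbT.
    by move=> /andP[].
  apply: bigcupT_measurable => k; apply: sub_sigma_algebra.
  by exists (fun j => if j == i then a else - k%:R), (fun=> k%:R).
move=> /(_ measurableT B mB) h.
exact: h.
Qed.

(** Boxes form a generating pi-system and the [nbox N] exhaust the space. This serves translation
    invariance here, and later the passage from boxes to Borel sets in the translation estimate. *)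
Lemma obox_measure_unique (m1 m2 : {measure set E -> \bar R}) :
  (forall a b, m1 (obox a b) = m2 (obox a b)) ->
  (forall N, (m1 (nbox N) < +oo)%E) ->
  forall A, measurable A -> m1 A = m2 A.
Proof.
move=> h1 h2 A mA; apply: (measure_unique oboxes nbox) => //.
- exact: measurable_oboxes.
- exact: oboxes_setI.
- exact: nbox_oboxes.
- exact: bigcup_nbox.
- by move=> _ [a [b ->]].
Qed.

Lemma measurable_addrV (v : E) : measurable_fun setT (fun x : E => x + v).
Proof.
apply: measurable_fun_rV => i.
under eq_fun do rewrite mxE.
by apply: measurable_funD => //; exact: measurable_coord.
Qed.

Lemma lebesgue_rVD (v : E) A : measurable A ->
  lebesgue_rV R n ((fun x => x + v) @^-1` A) = lebesgue_rV R n A.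
Proof.
move=> mA.
pose m1 := pushforward (lebesgue_rV R n) (mfun_Sub (mem_set (measurable_addrV v))).
have -> : lebesgue_rV R n ((fun x => x + v) @^-1` A) = m1 A by [].
apply: obox_measure_unique => //.
- move=> a b; rewrite /m1 /= /pushforward/=.
  have -> : (fun x : E => x + v) @^-1` obox a b =
      obox (fun i => a i - v ord0 i) (fun i => b i - v ord0 i).
    apply/seteqP; split => x /= h i; have := h i; rewrite mxE !in_itv/=;
      by rewrite ltrBlDr ltrBrDr.
  rewrite !lebesgue_obox; apply: eq_bigr => i _.
  by rewrite !lebesgue_measure_itv/= !lte_fin ltrD2r -!EFinB opprB addrA subrK.
- move=> N; rewrite /m1 /= /pushforward/=.
  have -> : (fun x : E => x + v) @^-1` nbox N =
      obox (fun i => - N%:R - v ord0 i) (fun i => N%:R - v ord0 i).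
    apply/seteqP; split => x /= h i; have := h i; rewrite mxE !in_itv/=;
      by rewrite ltrBlDr ltrBrDr.
  exact: lebesgue_obox_lty.
Qed.

Lemma ge0_integral_rVD (v : E) (f : E -> \bar R) :
  measurable_fun setT f -> (forall x, 0 <= f x)%E ->
  (\int[lebesgue_rV R n]_x f (x + v)%R = \int[lebesgue_rV R n]_x f x)%E.
Proof.
move=> mf f0.
have := @ge0_integral_pushforward _ _ _ _ R _ (measurable_addrV v) (lebesgue_rV R n)
  setT f measurableT mf (fun x _ => f0 x).
rewrite preimage_setT => <-.
by apply: eq_measure_integral => [|mv A mA _]; [exact: measurable_addrV|exact: lebesgue_rVD].
Qed.

End open_boxes.

(** * Tonelli on row vectors and integrals of coordinate products *)

Section tonelli.
Context {R : realType}.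

(** Lebesgue measure in dimension [n + 1] is a pushforward under [consrV], so a change of variables
    followed by Tonelli splits off the first coordinate. *)
Lemma ge0_integral_consrV n (f : 'rV[R]_n.+1 -> \bar R) :
  measurable_fun setT f -> (forall x, 0 <= f x)%E ->
  (\int[lebesgue_rV R n.+1]_x f x =
   \int[lebesgue_measure]_a \int[lebesgue_rV R n]_v f (consrV (a, v)))%E.
Proof.
move=> mf f0.
transitivity (\int[pushforward (lebesgue_measure \x lebesgue_rV R n) (@consrV R n)]_y f y)%E.
  by apply: eq_measure_integral => [|mv A mA _]; [exact: measurable_consrV|].
rewrite ge0_integral_pushforward//; [|exact: measurable_consrV].
rewrite preimage_setT fubini_tonelli1//.
  exact: (measurableT_comp mf (@measurable_consrV R n)).
by move=> z; exact: f0.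
Qed.

Lemma measurable_prod_coord n (g : 'I_n -> R -> R) :
  (forall i, measurable_fun setT (g i)) ->
  measurable_fun setT (fun x : 'rV[R]_n => \prod_i g i (x ord0 i)).
Proof.
move=> mg; apply: measurable_prod => i _.
by apply: measurableT_comp => //; exact: measurable_coord.
Qed.

Lemma integral_prod_coord n (g : 'I_n -> R -> R) (c : 'I_n -> R) :
  (forall i, measurable_fun setT (g i)) -> (forall i x, 0 <= g i x) ->
  (forall i, (\int[lebesgue_measure]_x (g i x)%:E = (c i)%:E)%E) ->
  (\int[lebesgue_rV R n]_x (\prod_i g i (x ord0 i))%:E = (\prod_i c i)%:E)%E.
Proof.
elim: n g c => [|n IH] g c mg g0 gc.
  under eq_integral do rewrite big_ord0.
  by rewrite integral_dirac//= diracT mul1e big_ord0.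
rewrite ge0_integral_consrV; last 2 first.
- by apply/measurable_EFinP; exact: measurable_prod_coord.
- by move=> x; rewrite lee_fin prodr_ge0.
rewrite big_ord_recl EFinM.
under eq_integral => a _.
  under eq_integral => v _.
    rewrite big_ord_recl /= mxE unlift_none /= EFinM.
    under eq_bigr do rewrite mxE liftK /=.
    over.
  rewrite ge0_integralZl_EFin//; last 2 first.
  - by move=> x _; rewrite lee_fin prodr_ge0.
  - by apply/measurable_EFinP; exact: (@measurable_prod_coord n (fun i => g (lift ord0 i))).
  rewrite (IH (fun i => g (lift ord0 i)) (fun i => c (lift ord0 i)))//.
  over.
rewrite ge0_integralZr//; last 3 first.
- by have /measurable_EFinP h := mg ord0; exact: h.
- by move=> x _; rewrite lee_fin.
- rewrite lee_fin; apply: prodr_ge0 => i _; rewrite -lee_fin -gc.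
  by apply: integral_ge0 => x _; rewrite lee_fin.
by rewrite gc.
Qed.

End tonelli.

(** * The heat kernel and its derivatives *)

Section heat_kernel_mass.
Context {R : realType} {d : nat}.
Local Notation E := 'rV[R]_d.
Local Notation mu := (lebesgue_rV R d).

(** The norm carried by row vectors is the sup norm; the kernel involves the Euclidean one. *)
Definition sqn (x : E) : R := \sum_(j < d) x ord0 j ^+ 2.

Lemma sqn_ge0 x : 0 <= sqn x.
Proof. by apply: sumr_ge0 => i _; exact: sqr_ge0. Qed.

Lemma sqn_coord (x : E) j : x ord0 j ^+ 2 <= sqn x.
Proof. by rewrite /sqn (bigD1 j)//= lerDl sumr_ge0// => i _; exact: sqr_ge0. Qed.

Lemma sqnN x : sqn (- x) = sqn x.
Proof. by apply: eq_bigr => i _; rewrite mxE sqrrN. Qed.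

(** This compares Gaussians with different centres, at the price of a factor 2 in the width. *)
Lemma sqnD_le (x y : E) : sqn (x + y) <= 2 * sqn x + 2 * sqn y.
Proof.
rewrite /sqn !mulr_sumr -big_split/=; apply: ler_sum => i _; rewrite mxE.
rewrite -subr_ge0.
have -> : 2 * x ord0 i ^+ 2 + 2 * y ord0 i ^+ 2 - (x ord0 i + y ord0 i) ^+ 2 =
  (x ord0 i - y ord0 i) ^+ 2 by ring.
exact: sqr_ge0.
Qed.

Lemma measurable_sqn : measurable_fun setT sqn.
Proof.
apply: measurable_sum => i; exact: (measurable_funX _ (measurable_coord i)).
Qed.

Lemma heat_kernelE t x :
  heat_kernel t x = (4 * pi * t) `^ (- (d%:R / 2)) * expR (- sqn x / (4 * t)).
Proof. by []. Qed.

Lemma heat_kernel_ge0 t (x : E) : 0 <= heat_kernel t x.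
Proof. by rewrite mulr_ge0 ?powR_ge0 ?expR_ge0. Qed.

Lemma heat_kernel_norm t (x : E) : `|heat_kernel t x| = heat_kernel t x.
Proof. by rewrite ger0_norm// heat_kernel_ge0. Qed.

Lemma heat_kernelN t (x : E) : heat_kernel t (- x) = heat_kernel t x.
Proof. by rewrite !heat_kernelE sqnN. Qed.

Lemma measurable_heat_kernel t : measurable_fun setT (heat_kernel t : E -> R).
Proof.
apply: measurable_funM => //; apply: measurableT_comp => //.
apply: measurable_funM => //; apply: measurableT_comp => //; exact: measurable_sqn.
Qed.

(** Each factor is the centred normal density of variance [2 t], so the unit mass of the kernel
    follows from that of the normal law. *)
Lemma heat_kernel_prod t (x : E) : 0 < t ->
  heat_kernel t x = \prod_j normal_pdf 0 (Num.sqrt (2 * t)) (x ord0 j).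
Proof.
move=> t0; have s0 : Num.sqrt (2 * t) != 0 by rewrite gt_eqF// sqrtr_gt0; lra.
have tt : 0 <= 2 * t by lra.
under eq_bigr do rewrite normal_pdfE//.
rewrite big_split/= prodr_const card_ord /normal_fun -expR_sum heat_kernelE.
have ptge0 : 0 < 4 * pi * t by rewrite !mulr_gt0// pi_gt0.
congr (_ * _).
  rewrite /normal_peak sqr_sqrtr// powRN -mulrnAr.
  rewrite [d%:R / 2]mulrC powRrM powR12_sqrt ?(ltW ptge0)// powR_mulrn ?sqrtr_ge0//.
  rewrite exprVn; congr (Num.sqrt _ ^+ _)^-1.
  rewrite -mulr_natr; ring.
congr expR; rewrite /sqn -sumrN mulr_suml; apply: eq_bigr => i _.
by rewrite subr0 sqr_sqrtr//; congr (_ / _); rewrite -mulr_natr; ring.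
Qed.

Lemma integral_heat_kernel t : 0 < t -> (\int[mu]_x (heat_kernel t x)%:E = 1)%E.
Proof.
move=> t0; have s0 : Num.sqrt (2 * t) != 0 by rewrite gt_eqF// sqrtr_gt0; lra.
under eq_integral do rewrite heat_kernel_prod//.
rewrite (@integral_prod_coord _ _ (fun=> normal_pdf 0 (Num.sqrt (2 * t))) (fun=> 1)).
- by rewrite big1.
- by move=> i; exact: measurable_normal_pdf.
- by move=> i x; exact: normal_pdf_ge0.
- by move=> i; rewrite integral_normal_pdf.
Qed.

End heat_kernel_mass.

Section directional.
Context {R : realType} {V : normedModType R}.

(** The two difference quotients are the same function of the increment, so directional derivatives
    reduce to one-variable calculus. *)
Lemma is_derive_line (g : V -> R) x v df :
  is_derive 0 (1 : R) (fun s : R => g (s *: v + x)) df -> is_derive x v g df.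
Proof.
have e : (fun h : R => h^-1 *: ((g \o shift x) (h *: v) - g x)) =
  (fun h : R => h^-1 *: (((fun s : R => g (s *: v + x)) \o shift 0) (h *: 1) -
    g (0 *: v + x))).
  by apply/funext => h /=; rewrite addr0 scale0r add0r [h *: 1]mulr1.
by move=> [h1 h2]; split; [rewrite /derivable e|rewrite /derive e].
Qed.

Lemma is_derive_along (g : V -> R) x v df (r : R) :
  is_derive (r *: v + x) v g df ->
  is_derive r (1 : R) (fun s : R => g (s *: v + x)) df.
Proof.
have e : (fun h : R => h^-1 *: ((g \o shift (r *: v + x)) (h *: v) - g (r *: v + x))) =
  (fun h : R => h^-1 *: (((fun s : R => g (s *: v + x)) \o shift r) (h *: 1) - g (r *: v + x))).
  by apply/funext => h /=; rewrite scalerDl [h *: 1]mulr1 addrA.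
by move=> [h1 h2]; split; [rewrite /derivable -e|rewrite /derive -e].
Qed.

End directional.

Section heat_kernel_derivatives.
Context {R : realType} {d : nat}.
Local Notation E := 'rV[R]_d.
Local Notation hk := (@heat_kernel R d).
Local Notation e_ j := (delta_mx ord0 j : E).

Definition hk_dx (j : 'I_d) (t : R) (x : E) : R := - (x ord0 j / (2 * t)) * hk t x.

Definition hk_dxx (j : 'I_d) (t : R) (x : E) : R :=
  (x ord0 j ^+ 2 / (4 * t ^+ 2) - (2 * t)^-1) * hk t x.

Lemma measurable_hk_dx j t : measurable_fun setT (hk_dx j t).
Proof.
apply: measurable_funM; last exact: measurable_heat_kernel.
apply: measurableT_comp => //; apply: measurable_funM => //; exact: measurable_coord.
Qed.

Lemma measurable_hk_dxx j t : measurable_fun setT (hk_dxx j t).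
Proof.
apply: measurable_funM; last exact: measurable_heat_kernel.
apply: measurable_funB => //; apply: measurable_funM => //.
by apply: measurable_funX; exact: measurable_coord.
Qed.

Lemma coord_line (r : R) (z : E) j i :
  (r *: e_ j + z) ord0 i = r * (i == j)%:R + z ord0 i.
Proof. by rewrite !mxE eqxx. Qed.

Lemma sqn_line (r : R) (z : E) j :
  sqn (r *: e_ j + z) = sqn z + 2 * r * z ord0 j + r ^+ 2.
Proof.
rewrite /sqn (bigD1 j)//= [in RHS](bigD1 j)//= coord_line eqxx.
rewrite (eq_bigr (fun i => z ord0 i ^+ 2)); first by rewrite mulr1; ring.
by move=> i /negbTE ij; rewrite coord_line ij mulr0 add0r.
Qed.

Lemma is_derive_hk j t z : 0 < t -> is_derive z (e_ j) (hk t) (hk_dx j t z).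
Proof.
move=> t0; apply: is_derive_line.
pose P (s : R) := - (sqn z + 2 * s * z ord0 j + s ^+ 2) / (4 * t).
rewrite (_ : (fun s : R => _) = (fun s => (4 * pi * t) `^ (- (d%:R / 2)) * expR (P s))); last first.
  by apply/funext => s; rewrite heat_kernelE sqn_line.
have hP : is_derive (0 : R) 1 P (- z ord0 j / (2 * t)).
  rewrite /P; apply: is_derive_eq; rewrite /= !scaler0 !scale0r ?add0r ?addr0 ?expr1.
  rewrite /GRing.scale/=; field; lra.
have hE : is_derive (0 : R) 1 (expR \o P) (expR (P 0) * (- z ord0 j / (2 * t))).
  exact: is_derive1_comp.
apply: is_derive_eq; rewrite /GRing.scale/= /hk_dx heat_kernelE /P; 
rewrite !(mulr0, mul0r, addr0, expr0n)/=; ring.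
Qed.

Lemma is_derive_hk_dx j t z : 0 < t -> is_derive z (e_ j) (hk_dx j t) (hk_dxx j t z).
Proof.
move=> t0; apply: is_derive_line.
pose Q (s : R) := - ((s + z ord0 j) / (2 * t)).
pose H (s : R) := hk t (s *: e_ j + z).
rewrite (_ : (fun s : R => _) = Q * H); last first.
  by apply/funext => s; rewrite /hk_dx /Q /H coord_line eqxx mulr1.
have hQ : is_derive (0 : R) 1 Q (- (2 * t)^-1).
  rewrite /Q; apply: is_derive_eq; rewrite /= !scaler0 ?add0r ?addr0.
  by rewrite /GRing.scale/= mulr1.
have hH : is_derive (0 : R) 1 H (hk_dx j t z).
  have := @is_derive_along R E (hk t) z (e_ j) (hk_dx j t z) 0.
  by rewrite scale0r add0r; apply; exact: is_derive_hk.
apply: is_derive_eq; rewrite /GRing.scale/= /H /Q scale0r !add0r /hk_dx /hk_dxx.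
field; lra.
Qed.

(** The heat equation for the kernel: the time derivative is produced directly as a Laplacian, so
    that only space derivatives need estimates. *)
Lemma is_derive_hk_time (t : R) (z : E) : 0 < t ->
  is_derive t (1 : R) (fun s => hk s z) (\sum_j hk_dxx j t z).
Proof.
move=> t0.
pose P (s : R) := - sqn z * (4 * s)^-1.
pose A (s : R) := (4 * pi * s) `^ (- (d%:R / 2)).
rewrite (_ : (fun s : R => _) = A * (expR \o P)); last by [].
have hP : is_derive t 1 P (sqn z / (4 * t ^+ 2)).
  have h4 : is_derive t (1 : R) (fun s : R => 4 * s) 4.
    by apply: is_derive_eq; rewrite /GRing.scale/=; ring.
  have t4 : 4 * t != 0 by apply: lt0r_neq0; lra.
  have h5 := is_deriveV t4 h4.
  rewrite /P; apply: is_derive_eq; rewrite /GRing.scale/=.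
  field; lra.
have hE : is_derive t 1 (expR \o P) (expR (P t) * (sqn z / (4 * t ^+ 2))).
  exact: is_derive1_comp.
have pi4 : 0 < 4 * pi * t by rewrite !mulr_gt0// pi_gt0.
have hA : is_derive t 1 A (- (d%:R / (2 * t)) * A t).
  rewrite /A; pose B (s : R) := 4 * pi * s : R.
  have hB : is_derive t (1 : R) B (4 * pi).
    by rewrite /B; apply: is_derive_eq; rewrite /GRing.scale/=; ring.
  have := @is_derive1_comp R (fun x => x `^ (- (d%:R / 2))) B t _ _ (is_derive1_powR _ pi4) hB.
  move=> h; apply: is_derive_eq; rewrite powRB; last by rewrite (gt_eqF pi4) implybT.
  rewrite powRr1; last exact: ltW.
  clear -t0; move: (pi_gt0 R); move: (@pi R) => q q0; field; lra.
apply: is_derive_eq; rewrite /GRing.scale/=.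
rewrite /hk_dxx -mulr_suml sumrB -mulr_suml -/(sqn z) sumr_const card_ord heat_kernelE /A /P.
rewrite -mulr_natr [LHS]addrC; field; lra.
Qed.
End heat_kernel_derivatives.

(** * Domination of the kernel and its derivatives by wider kernels *)

Section heat_kernel_bounds.
Context {R : realType} {d : nat}.
Local Notation E := 'rV[R]_d.
Local Notation hk := (@heat_kernel R d).
Local Notation e_ j := (delta_mx ord0 j : E).

(* The constant in [h_t <= heat_doubling * h_(2t)], where [h_t] is the heat kernel. *)
Definition heat_doubling : R := 2 `^ (d%:R / 2).

Lemma heat_doubling_gt0 : 0 < heat_doubling. Proof. exact: powR_gt0. Qed.

(** Half of the exponent goes into the kernel at time [2 t]; the other half stays as an explicit
    Gaussian factor that absorbs the polynomial factors of the derivatives. *)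
Lemma hk_double (t : R) (x : E) : 0 < t ->
  hk t x = heat_doubling * expR (- (sqn x / (8 * t))) * hk (2 * t) x.
Proof.
move=> t0; rewrite !heat_kernelE /heat_doubling.
have -> : 4 * pi * (2 * t) = 2 * (4 * pi * t) :> R by ring.
rewrite [X in _ = _ * (X * _)]powRM//; last by rewrite !mulr_ge0 ?pi_ge0// ltW.
rewrite [2 `^ (- _)]powRN.
have -> : - sqn x / (4 * t) = - (sqn x / (8 * t)) + - sqn x / (4 * (2 * t)).
  by field; lra.
rewrite expRD; field; exact: lt0r_neq0 (heat_doubling_gt0).
Qed.

Lemma sqn_expR (a : R) (x : E) : 0 < a -> sqn x * expR (- (sqn x / a)) <= a.
Proof.
move=> a0; rewrite expRN -ler_pdivlMr ?invr_gt0 ?expR_gt0// invrK.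
rewrite mulrC -ler_pdivrMr//; apply: le_trans (expR_ge1Dx _); lra.
Qed.

Lemma expR_sqn_le1 (a : R) (x : E) : 0 < a -> expR (- (sqn x / a)) <= 1.
Proof.
by move=> a0; rewrite -[leRHS]expR0 ler_expR oppr_le0 divr_ge0 ?sqn_ge0// ltW.
Qed.

(** By [1 + u <= exp u] it is enough that [y <= 2 s (1 + y^2 / (8 s^2))] with [s = sqrt t] and
    [y = |x_j|]; the difference of the two sides is [((y - 2 s)^2 + 4 s^2) / (4 s)]. *)
Lemma coord_expR (t : R) (x : E) j : 0 < t ->
  `|x ord0 j| * expR (- (sqn x / (8 * t))) <= 2 * Num.sqrt t.
Proof.
move=> t0; rewrite expRN -ler_pdivlMr ?invr_gt0 ?expR_gt0// invrK.
have s0 : 0 < Num.sqrt t by rewrite sqrtr_gt0.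
apply: (@le_trans _ _ (2 * Num.sqrt t * (1 + x ord0 j ^+ 2 / (8 * t)))); last first.
  apply: ler_wpM2l; first by rewrite mulr_ge0// ltW.
  apply: le_trans (expR_ge1Dx _); rewrite lerD2l.
  by rewrite ler_pM2r ?sqn_coord// invr_gt0; lra.
rewrite -real_normK ?num_real//.
have -> : t = Num.sqrt t ^+ 2 by rewrite sqr_sqrtr// ltW.
move: s0 (normr_ge0 (x ord0 j)); move: (Num.sqrt t) (`|x ord0 j|) => s y s0 y0.
rewrite -subr_ge0 sqrtr_sqr (gtr0_norm s0).
have -> : 2 * s * (1 + y ^+ 2 / (8 * s ^+ 2)) - y = ((y - 2 * s) ^+ 2 + 4 * s ^+ 2) / (4 * s).
  by field; lra.
by apply: divr_ge0; nra.
Qed.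

Lemma hk_le (t : R) (x : E) : 0 < t -> hk t x <= heat_doubling * hk (2 * t) x.
Proof.
move=> t0; rewrite hk_double// ler_wpM2r ?heat_kernel_ge0//.
by rewrite ler_piMr ?(ltW heat_doubling_gt0)// expR_sqn_le1//; lra.
Qed.

Lemma hk_dx_le j (t : R) (x : E) : 0 < t ->
  `|hk_dx j t x| <= heat_doubling / Num.sqrt t * hk (2 * t) x.
Proof.
move=> t0; rewrite /hk_dx normrM heat_kernel_norm hk_double// mulrA.
rewrite ler_wpM2r ?heat_kernel_ge0// normrN normrM normfV (gtr0_norm (_ : 0 < 2 * t)); last lra.
have := coord_expR x j t0; set e := expR _ => h.
have -> : `|x ord0 j| / (2 * t) * (heat_doubling * e) = heat_doubling * (`|x ord0 j| * e / (2 * t)) by ring.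
rewrite ler_pM2l ?heat_doubling_gt0// ler_pdivrMr; last lra.
have s0 : 0 < Num.sqrt t by rewrite sqrtr_gt0.
apply: le_trans h _; rewrite -[X in _ <= _ * (2 * X)](sqr_sqrtr (ltW t0)).
by rewrite [leRHS](_ : _ = 2 * Num.sqrt t)//; field; lra.
Qed.

(** Origin of the 3: with [e] the remaining Gaussian factor, [sqn x * e <= 8 t] and [2 t e <= 2 t],
    and [10 t <= 12 t = (3 / t) (4 t^2)]. *)
Lemma hk_dxx_le j (t : R) (x : E) : 0 < t ->
  `|hk_dxx j t x| <= 3 * heat_doubling / t * hk (2 * t) x.
Proof.
move=> t0; rewrite /hk_dxx normrM heat_kernel_norm hk_double// mulrA.
rewrite ler_wpM2r ?heat_kernel_ge0//.
have t8 : 0 < 8 * t by lra.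
have := sqn_expR x t8; have := expR_sqn_le1 x t8; have := expR_gt0 (- (sqn x / (8 * t))).
set e := expR _ => e0 e1 h.
rewrite mulrCA [leRHS](_ : _ = heat_doubling * (3 / t)); last by ring.
rewrite ler_pM2l ?heat_doubling_gt0//.
apply: (@le_trans _ _ ((sqn x / (4 * t ^+ 2) + (2 * t)^-1) * e)).
  rewrite ler_wpM2r ?(ltW e0)//; apply: le_trans (ler_normB _ _) _.
  apply: lerD; last by rewrite gtr0_norm// invr_gt0; lra.
  rewrite ger0_norm; last by rewrite divr_ge0 ?sqr_ge0// mulr_ge0 ?sqr_ge0.
  by rewrite ler_wpM2r ?sqn_coord// invr_ge0 mulr_ge0 ?sqr_ge0.
have -> : (sqn x / (4 * t ^+ 2) + (2 * t)^-1) * e =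
  (sqn x * e + 2 * t * e) / (4 * t ^+ 2) by field; lra.
rewrite ler_pdivrMr; last by rewrite mulr_gt0 ?exprn_gt0.
have -> : 3 / t * (4 * t ^+ 2) = 12 * t by field; lra.
nra.
Qed.

(** A bound uniform in the displacement [r], which is what differentiation under the integral in a
    space direction requires. It follows from [sqn z <= 2 sqn (z + r e_j) + 2 r^2]. *)
Lemma hk_shift_le (s r : R) (z : E) j : 0 < s -> `|r| <= 1 ->
  hk s (r *: e_ j + z) <= heat_doubling * expR (2^-1 / s) * hk (2 * s) z.
Proof.
move=> s0 r1; rewrite !heat_kernelE /heat_doubling.
have -> : 4 * pi * (2 * s) = 2 * (4 * pi * s) :> R by ring.
rewrite [X in _ <= _ * (X * _)]powRM//; last by rewrite !mulr_ge0 ?pi_ge0// ltW.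
rewrite [2 `^ (- _)]powRN.
set A := (4 * pi * s) `^ _; have A0 : 0 <= A by exact: powR_ge0.
set B := 2 `^ _; have B0 : 0 < B by exact: powR_gt0.
rewrite [leRHS](_ : _ = A * (expR (2^-1 / s) * expR (- sqn z / (4 * (2 * s))))); last first.
  by field; lra.
rewrite ler_wpM2l// -expRD ler_expR.
have h := sqnD_le (r *: e_ j + z) (- (r *: e_ j)).
rewrite addrAC subrr add0r in h.
have h2 : sqn (- (r *: e_ j)) <= 1.
  rewrite sqnN -[_ *: _]addr0 sqn_line mxE mulr0 addr0 /sqn big1; last first.
    by move=> i _; rewrite mxE expr0n.
  by rewrite add0r -real_normK ?num_real// expr_le1.
rewrite -subr_ge0.
have -> : 2^-1 / s + - sqn z / (4 * (2 * s)) - - sqn (r *: e_ j + z) / (4 * s) =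
  (2 * sqn (r *: e_ j + z) + 4 - sqn z) / (8 * s) by field; lra.
by rewrite divr_ge0//; lra.
Qed.

(** The counterpart in time: one kernel dominates all those at times between [t / 2] and [2 t]. The
    normalizing factors differ by at most [4^(d/2) = 2^d], since [2 t <= 4 s]. *)
Lemma hk_time_le (s t : R) (z : E) : 0 < t -> t / 2 < s < 2 * t ->
  hk s z <= 2 `^ (d%:R) * hk (2 * t) z.
Proof.
move=> t0 /andP[ts st]; rewrite !heat_kernelE mulrA.
have p0 : 0 < (pi : R) by exact: pi_gt0.
have s0 : 0 < s by lra.
apply: ler_pM; rewrite ?powR_ge0 ?expR_ge0//.
  have -> : 2 `^ d%:R = 4 `^ (d%:R / 2) :> R.
    have -> : (4 : R) = 2 `^ 2 by rewrite powR_mulrn//; ring.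
    by rewrite -powRrM; congr (_ `^ _); field.
  rewrite -[4 `^ _]invrK -powRN -lef_pV2 ?posrE; last 2 first.
  - by rewrite mulr_gt0 ?invr_gt0 ?powR_gt0// !mulr_gt0//; lra.
  - by rewrite powR_gt0 ?mulr_gt0.
  rewrite invfM invrK -!powRN opprK.
  rewrite powRN mulrC ler_pdivrMr ?powR_gt0//.
  rewrite -powRM//; last by rewrite !mulr_ge0 ?ltW.
  rewrite ge0_ler_powR ?divr_ge0 ?ler0n// ?nnegrE; [|nra..].
  rewrite !mulr_ge0 ?ltW//.
rewrite ler_expR !mulNr lerN2 ler_wpM2l ?sqn_ge0// lef_pV2 ?posrE; lra.
Qed.

End heat_kernel_bounds.

Lemma ge0_integralZl_real d (T : measurableType d) (R : realType)
    (m : {measure set T -> \bar R}) (c : R) (g : T -> R) :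
  0 <= c -> measurable_fun setT g -> (forall x, 0 <= g x) ->
  (\int[m]_x (c * g x)%:E = c%:E * \int[m]_x (g x)%:E)%E.
Proof.
move=> c0 mg g0; under eq_integral do rewrite EFinM.
rewrite ge0_integralZl//; first exact/measurable_EFinP.
by move=> x _; rewrite lee_fin.
Qed.

(** * Convolution with the heat kernel *)

Section gaussian_integrable.
Context {R : realType} {d : nat}.
Local Notation E := 'rV[R]_d.
Local Notation mu := (lebesgue_rV R d).
Local Notation hk := (@heat_kernel R d).
Local Notation e_ j := (delta_mx ord0 j : E).

(** The class of functions whose convolutions with the heat kernel and its derivatives converge
    absolutely at all times. All widths [a] are required because recentring a Gaussian changes its
    width. *)
Definition gauss_integrable (f : E -> R) := measurable_fun setT f /\
  forall a, 0 < a -> (\int[mu]_x (`|f x| * expR (- a * sqn x))%:E < +oo)%E.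

Definition conv (k f : E -> R) (x : E) : R :=
  Rintegral mu setT (fun y : E => k (x - y) * f y).

Lemma measurable_gauss (a : R) : measurable_fun setT (fun x : E => expR (- a * sqn x)).
Proof.
by apply: measurableT_comp => //; apply: measurable_funM => //; exact: measurable_sqn.
Qed.

Lemma measurable_subV (x : E) : measurable_fun setT (fun y : E => x - y).
Proof.
apply: measurable_fun_rV => i; under eq_fun do rewrite !mxE.
by apply: measurable_funB => //; exact: measurable_coord.
Qed.

Lemma integral_gauss_lty (a : R) : 0 < a ->
  (\int[mu]_x (expR (- a * sqn x))%:E < +oo)%E.
Proof.
move=> a0; have s0 : 0 < (4 * a)^-1 by rewrite invr_gt0; lra.
have A0 : 0 < (4 * pi * (4 * a)^-1) `^ (- (d%:R / 2)).
  by rewrite powR_gt0// !mulr_gt0// pi_gt0.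
have : (\int[mu]_x ((4 * pi * (4 * a)^-1) `^ (- (d%:R / 2)) * expR (- a * sqn x))%:E < +oo)%E.
  rewrite (eq_integral (fun x => (hk (4 * a)^-1 x)%:E)); last first.
    move=> x _; rewrite heat_kernelE; congr (_ * expR _)%:E.
    by field; lra.
  by rewrite integral_heat_kernel// ltry.
rewrite ge0_integralZl_real ?(ltW A0)//; last exact: measurable_gauss.
have : (0 <= \int[mu]_x (expR (- a * sqn x))%:E)%E.
  by apply: integral_ge0 => x _; rewrite lee_fin expR_ge0.
case: (integral _ _ _) => [r||] //; rewrite ?ltry//.
by move=> _; rewrite gt0_muley ?lte_fin.
Qed.

Lemma gauss_integrable_cst (c : R) : gauss_integrable (cst c).
Proof.
split => // a a0.
rewrite (@ge0_integralZl_real _ _ _ mu `|c| (fun x => expR (- a * sqn x)))//; last first.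
  exact: measurable_gauss.
by rewrite lte_mul_pinfty// integral_gauss_lty.
Qed.

Lemma gauss_integrable_le (f g : E -> R) (C : R) : measurable_fun setT f -> gauss_integrable g ->
  {ae mu, forall x, `|f x| <= C + `|g x|} -> gauss_integrable f.
Proof.
move=> mf [mg hg] fg; split => // a a0.
have [mc hc] := gauss_integrable_cst C.
have mG := @measurable_gauss a.
have mn (h : E -> R) : measurable_fun setT h ->
    measurable_fun setT (fun x => (`|h x| * expR (- a * sqn x))%:E).
  move=> mh; apply/measurable_EFinP/measurable_funM => //.
  exact: measurableT_comp.
apply: (@le_lt_trans _ _ (\int[mu]_x ((`|C| * expR (- a * sqn x))%:E + (`|g x| * expR (- a * sqn x))%:E))%E).
  apply: ae_ge0_le_integral => //.
  - exact: mn.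
  - by move=> x _; rewrite -EFinD lee_fin -mulrDl mulr_ge0 ?expR_ge0// addr_ge0.
  - by apply: emeasurable_funD; [exact: (mn (cst C))|exact: mn].
  - apply: filterS fg => x h _; rewrite -EFinD lee_fin -mulrDl ler_wpM2r ?expR_ge0//.
    by apply: le_trans h _; rewrite lerD2r ler_norm.
rewrite ge0_integralD//.
- by rewrite lte_add_pinfty// ?hg ?hc.
- exact: (mn (cst C)).
- exact: mn.
Qed.

Lemma gauss_integrable_near_cst (f : E -> R) (c M : R) : measurable_fun setT f ->
  {ae mu, forall x, `|f x - c| <= M} -> gauss_integrable f.
Proof.
move=> mf h; apply: (@gauss_integrable_le _ (cst c) M) => //; first exact: gauss_integrable_cst.
apply: filterS h => x h; rewrite /cst -[f x](subrK c).
by apply: le_trans (ler_normD _ _) _; rewrite lerD2r.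
Qed.

Lemma gauss_integrableD (f g : E -> R) : gauss_integrable f -> gauss_integrable g -> gauss_integrable (fun x => f x + g x).
Proof.
move=> [mf hf] [mg hg]; split => [|a a0]; first exact: measurable_funD.
have mG := @measurable_gauss a.
have mn (h : E -> R) : measurable_fun setT h ->
    measurable_fun setT (fun x => (`|h x| * expR (- a * sqn x))%:E).
  move=> mh; apply/measurable_EFinP/measurable_funM => //.
  exact: measurableT_comp.
apply: (@le_lt_trans _ _ (\int[mu]_x ((`|f x| * expR (- a * sqn x))%:E + (`|g x| * expR (- a * sqn x))%:E))%E).
  apply: ge0_le_integral => //.
  - by apply: (mn (fun x => f x + g x)); exact: measurable_funD.
  - by apply: emeasurable_funD; exact: mn.
  - by move=> x _; rewrite -EFinD lee_fin -mulrDl ler_wpM2r ?expR_ge0// ler_normD.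
rewrite ge0_integralD//; try exact: mn.
by rewrite lte_add_pinfty// ?hg ?hf.
Qed.

Lemma gauss_integrable_ae (f g : E -> R) : measurable_fun setT f -> gauss_integrable g ->
  {ae mu, forall x, f x = g x} -> gauss_integrable f.
Proof.
move=> mf hg h; apply: (@gauss_integrable_le f g 0) => //.
by apply: filterS h => x ->; rewrite add0r.
Qed.

Lemma gauss_integrableN (f : E -> R) : gauss_integrable f -> gauss_integrable (fun x => - f x).
Proof.
move=> hf; apply: (@gauss_integrable_le _ f 0) => //.
  by apply: measurableT_comp => //; case: hf.
by apply: aeW => x; rewrite normrN add0r.
Qed.

Lemma gauss_integrable_shift (f : E -> R) v : gauss_integrable f -> gauss_integrable (fun x => f (x + v)).
Proof.
move=> [mf hf]; split => [|a a0].
  by apply: (measurableT_comp mf); exact: measurable_addrV.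
have a2 : 0 < a / 2 by lra.
have mn : measurable_fun setT (fun x => (`|f x| * expR (- (a / 2) * sqn x))%:E).
  apply/measurable_EFinP/measurable_funM; first exact: measurableT_comp.
  exact: measurable_gauss.
apply: (@le_lt_trans _ _ (\int[mu]_x ((expR (a * sqn v))%:E * (`|f (x + v)%R| * expR (- (a / 2) * sqn (x + v)%R))%:E))%E).
  apply: ge0_le_integral => //.
  - apply/measurable_EFinP/measurable_funM; last exact: measurable_gauss.
    by apply: measurableT_comp => //; apply: (measurableT_comp mf); exact: measurable_addrV.
  - apply: emeasurable_funM => //.
    exact: (measurableT_comp mn (measurable_addrV v)).
  - move=> x _; rewrite -EFinM lee_fin mulrCA ler_wpM2l// -expRD ler_expR.
    have := sqnD_le x v; nra.
rewrite ge0_integralZl//.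
- rewrite (ge0_integral_rVD v mn); last by move=> x; rewrite lee_fin mulr_ge0// expR_ge0.
  by rewrite lte_mul_pinfty ?hf// lee_fin expR_ge0.
- exact: (measurableT_comp mn (measurable_addrV v)).
Qed.

(** From [sqn y <= 2 sqn x + 2 sqn (x - y)], a Gaussian centred at [x] is at most a constant
    depending on [x] times a Gaussian of half the rate centred at the origin. *)
Lemma conv_integrable (k f : E -> R) (C s : R) x : measurable_fun setT k ->
  (forall z, `|k z| <= C * hk s z) -> 0 < s -> gauss_integrable f ->
  mu.-integrable setT (fun y : E => (k (x - y) * f y)%:E).
Proof.
move=> mk hk0 s0 [mf hf].
have C0 : 0 <= C.
  have := le_trans (normr_ge0 _) (hk0 0); rewrite pmulr_lge0//.
  by rewrite mulr_gt0 ?expR_gt0 ?powR_gt0// !mulr_gt0// pi_gt0.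
have mkx : measurable_fun setT (fun y : E => k (x - y)).
  exact: (measurableT_comp mk (measurable_subV x)).
apply/integrableP; split.
  exact/measurable_EFinP/measurable_funM.
pose A := C * ((4 * pi * s) `^ (- (d%:R / 2)) * expR (sqn x / (4 * s))).
have A0 : 0 <= A by rewrite mulr_ge0// mulr_ge0 ?powR_ge0 ?expR_ge0.
have s8 : 0 < (8 * s)^-1 by rewrite invr_gt0; lra.
have mn : measurable_fun setT (fun x => (`|f x| * expR (- (8 * s)^-1 * sqn x))%:E).
  apply/measurable_EFinP/measurable_funM; first exact: measurableT_comp.
  exact: measurable_gauss.
apply: (@le_lt_trans _ _ (\int[mu]_y (A%:E * (`|f y| * expR (- (8 * s)^-1 * sqn y))%:E))%E).
  apply: ge0_le_integral => //.
  - apply: measurableT_comp => //.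
    exact/measurable_EFinP/measurable_funM.
  - exact: measurable_funeM.
  - move=> y _; rewrite /= lee_fin normrM [`|k _| * _]mulrC [leRHS]mulrCA. apply: ler_wpM2l => //.
    apply: le_trans (hk0 _) _; rewrite /A -[leRHS]mulrA ler_wpM2l// heat_kernelE -[leRHS]mulrA.
    rewrite ler_wpM2l ?powR_ge0// -expRD ler_expR.
    have := sqnD_le x (- (x - y)); rewrite sqnN opprB addrC subrK => h.
    rewrite -subr_ge0.
    have -> : sqn x / (4 * s) + - (8 * s)^-1 * sqn y - - sqn (x - y) / (4 * s) =
      (2 * sqn x + 2 * sqn (x - y) - sqn y) / (8 * s) by field; lra.
    by apply: divr_ge0; lra.
rewrite ge0_integralZl//.
by rewrite lte_mul_pinfty ?hf.
Qed.

(** Differentiation under the integral sign, with [C * hk s (x - y) * |f y|] dominating for every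
    parameter in []u, v[]. Both space and time derivatives are instances of it. *)
Lemma conv_is_derive (K K' : R -> E -> R) (a u v s C : R) (f : E -> R) x :
  u < a < v -> 0 < s -> gauss_integrable f ->
  (forall r, u < r < v -> measurable_fun setT (K r)) ->
  (forall r z, u < r < v -> `|K r z| <= C * hk s z) ->
  (forall r z, u < r < v -> `|K' r z| <= C * hk s z) ->
  (forall r z, u < r < v -> is_derive r (1 : R) (K ^~ z) (K' r z)) ->
  is_derive a (1 : R) (fun r => conv (K r) f x) (conv (K' a) f x).
Proof.
move=> uav s0 gf mK hK hK' dK.
pose F (r : R) (y : E) := K r (x - y) * f y.
have dF r y : u < r < v -> is_derive r (1 : R) (F ^~ y) (K' r (x - y) * f y).
  move=> hr; have := dK r (x - y) hr => h.
  have -> : F ^~ y = f y *: (K ^~ (x - y)).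
    by apply/funext => r'; rewrite /F mulrC.
  by apply: is_derive_eq; rewrite /GRing.scale/= mulrC.
have Ia : `]u, v[%classic a by rewrite /= in_itv.
have d1 r y : u < r < v -> partial1of2 F r y = K' r (x - y) * f y.
  by move=> hr; rewrite partial1of2E; case: (dF r y hr).
have intF r : `]u, v[%classic r -> mu.-integrable setT (EFin \o F r).
  rewrite /= in_itv/= => hr; apply: (conv_integrable (C := C) (s := s)) => //.
  - exact: mK.
  - by move=> z; exact: hK.
have derF r y : `]u, v[%classic r -> setT y -> derivable (F ^~ y) r 1.
  by rewrite /= in_itv/= => hr _; case: (dF r y hr).
have C0 : 0 <= C.
  have := le_trans (normr_ge0 _) (hK a 0 uav); rewrite pmulr_lge0//.
  by rewrite mulr_gt0 ?expR_gt0 ?powR_gt0// !mulr_gt0// pi_gt0.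
pose G y := C * hk s (x - y) * `|f y|.
have G0 y : 0 <= G y.
  by apply: mulr_ge0 => //; apply: mulr_ge0 => //; exact: heat_kernel_ge0.
have intG : mu.-integrable setT (EFin \o G).
  apply: (@conv_integrable (fun z => C * hk s z) (fun y => `|f y|) C s) => //.
  - by apply: measurable_funM => //; exact: measurable_heat_kernel.
  - by move=> z; rewrite normrM heat_kernel_norm ger0_norm.
  - apply: (@gauss_integrable_le _ f 0) => //; last by apply: aeW => y; rewrite normr_id add0r.
    by apply: measurableT_comp => //; case: gf.
have Gub r y : `]u, v[%classic r -> setT y -> `|partial1of2 F r y| <= G y.
  rewrite /= in_itv/= => hr _; rewrite d1// normrM ler_wpM2r//; exact: hK'.
split.
  exact: (derivable_under_integral measurableT Ia intF derF G0 intG Gub).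
rewrite -derive1E.
have /= -> := differentiation_under_integral measurableT Ia intF derF G0 intG Gub.
by apply: eq_Rintegral => y _; rewrite d1.
Qed.

End gaussian_integrable.

Section conv_theory.
Context {R : realType} {d : nat}.
Local Notation E := 'rV[R]_d.
Local Notation mu := (lebesgue_rV R d).
Local Notation hk := (@heat_kernel R d).
Local Notation e_ j := (delta_mx ord0 j : E).

(** Tonelli applies to the positive and the negative part separately, and the real-valued integral
    is a measurable function of their difference. *)
Lemma measurable_param_Rintegral d1 (T : measurableType d1) (g : T * E -> R) :
  measurable_fun setT g ->
  measurable_fun setT (fun x => Rintegral mu setT (fun y => g (x, y))).
Proof.
move=> mg; apply: measurableT_comp => //=.
under eq_fun do rewrite integralE.
have mG : measurable_fun setT (EFin \o g) by exact/measurable_EFinP.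
have hp := @measurable_fun_fubini_tonelli_F _ _ T E R mu ((EFin \o g)^\+)%E
  (measurable_funepos mG) (funepos_ge0 _).
have hn := @measurable_fun_fubini_tonelli_F _ _ T E R mu ((EFin \o g)^\-)%E
  (measurable_funeneg mG) (funeneg_ge0 _).
have := emeasurable_funB hp hn; congr (measurable_fun _ _); apply/funext => x /=.
by congr (_ - _)%E; apply: eq_integral => y _; rewrite ?funeposE ?funenegE.
Qed.

Lemma measurable_conv (k f : E -> R) :
  measurable_fun setT k -> measurable_fun setT f -> measurable_fun setT (conv k f).
Proof.
move=> mk mf.
apply: (measurable_param_Rintegral (g := fun z : E * E => k (z.1 - z.2) * f z.2)).
apply: measurable_funM; last exact: (measurableT_comp mf measurable_snd).
apply: (measurableT_comp mk); apply: measurable_fun_rV => i.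
under eq_fun do rewrite !mxE.
apply: measurable_funB.
  exact: (measurableT_comp (measurable_coord i) measurable_fst).
exact: (measurableT_comp (measurable_coord i) measurable_snd).
Qed.

Lemma measurable_conv_time (K : R -> E -> R) (f : E -> R) :
  measurable_fun setT (fun z : E * R => K z.2 z.1) -> measurable_fun setT f ->
  measurable_fun setT (fun z : E * R => conv (K z.2) f z.1).
Proof.
move=> mK mf.
apply: (measurable_param_Rintegral
  (g := fun z : (E * R) * E => K z.1.2 (z.1.1 - z.2) * f z.2)).
apply: measurable_funM; last exact: (measurableT_comp mf measurable_snd).
suff : measurable_fun setT (fun z : (E * R) * E => (z.1.1 - z.2, z.1.2)).
  by move=> h; have := measurableT_comp mK h.
apply: measurable_fun_pair; last first.
  exact: (measurableT_comp measurable_snd measurable_fst).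
apply: measurable_fun_rV => i.
under eq_fun do rewrite !mxE.
apply: measurable_funB.
  apply: (measurableT_comp (measurable_coord i)).
  exact: (measurableT_comp measurable_fst measurable_fst).
exact: (measurableT_comp (measurable_coord i) measurable_snd).
Qed.

Lemma measurable_powRl (b : R) d1 (T : measurableType d1) (g : T -> R) :
  measurable_fun setT g -> measurable_fun setT (fun x => g x `^ b).
Proof. by move=> mg; apply: (measurableT_comp (measurable_powR b)). Qed.

(** The inverse is a sign times the power of exponent -1 of the absolute value; at 0 both
    conventions give 0. *)
Lemma measurable_invR d1 (T : measurableType d1) (g : T -> R) :
  measurable_fun setT g -> measurable_fun setT (fun x => (g x)^-1).
Proof.
move=> mg; rewrite (_ : (fun x => _) = (fun x => (if g x < 0 then -1 else 1) * `|g x| `^ (-1))).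
  apply: measurable_funM; last by apply: measurable_powRl; exact: measurableT_comp.
  apply: measurable_fun_ifT => //; exact: measurable_fun_ltr.
apply/funext => x; rewrite powR_inv1// -normfV.
case: ltP => h; first by rewrite ltr0_norm ?invr_lt0// mulN1r opprK.
by rewrite mul1r ger0_norm ?invr_ge0.
Qed.

Lemma measurable_hk_time : measurable_fun setT (fun z : E * R => hk z.2 z.1).
Proof.
have ms : measurable_fun setT (fun z : E * R => sqn z.1).
  exact: (measurableT_comp measurable_sqn measurable_fst).
apply: measurable_funM.
  by apply: measurable_powRl; apply: measurable_funM => //; exact: measurable_snd.
apply: measurableT_comp => //; apply: measurable_funM; first exact: measurableT_comp.
by apply: measurable_invR; apply: measurable_funM => //; exact: measurable_snd.
Qed.

Lemma measurable_hk_dx_time j : measurable_fun setT (fun z : E * R => hk_dx j z.2 z.1).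
Proof.
apply: measurable_funM; last exact: measurable_hk_time.
apply: measurableT_comp => //; apply: measurable_funM.
  exact: (measurableT_comp (measurable_coord j) measurable_fst).
by apply: measurable_invR; apply: measurable_funM => //; exact: measurable_snd.
Qed.

Lemma measurable_hk_dxx_time j : measurable_fun setT (fun z : E * R => hk_dxx j z.2 z.1).
Proof.
apply: measurable_funM; last exact: measurable_hk_time.
apply: measurable_funB.
  apply: measurable_funM.
    apply: measurable_funX.
    exact: (measurableT_comp (measurable_coord j) measurable_fst).
  apply: measurable_invR; apply: measurable_funM => //.
  by apply: measurable_funX; exact: measurable_snd.
by apply: measurable_invR; apply: measurable_funM => //; exact: measurable_snd.
Qed.

Lemma conv_line (k f : E -> R) (v x : E) :
  conv k f (v + x) = conv (fun z => k (v + z)) f x.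
Proof. by apply: eq_Rintegral => y _; rewrite addrA. Qed.

Lemma measurable_addlV (v : E) : measurable_fun setT (fun x : E => v + x).
Proof.
rewrite (_ : (fun x => _) = (fun x => x + v)); first exact: measurable_addrV.
by apply/funext => x; rewrite addrC.
Qed.

Lemma hk_bound_ge0 (k : E -> R) C s : 0 < s -> (forall z, `|k z| <= C * hk s z) -> 0 <= C.
Proof.
move=> s0 hk0; have := le_trans (normr_ge0 _) (hk0 0); rewrite pmulr_lge0//.
by rewrite mulr_gt0 ?expR_gt0 ?powR_gt0// !mulr_gt0// pi_gt0.
Qed.

(** Moving the point of evaluation is the same as translating the kernel, so a derivative in [x]
    becomes one in a parameter of the kernel; [hk_shift_le] gives the domination for displacements
    below 1. *)
Lemma conv_is_derive_space j (k k' f : E -> R) C s x : 0 < s -> gauss_integrable f ->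
  measurable_fun setT k ->
  (forall z, `|k z| <= C * hk s z) -> (forall z, `|k' z| <= C * hk s z) ->
  (forall z, is_derive z (e_ j) k (k' z)) ->
  is_derive x (e_ j) (conv k f) (conv k' f x).
Proof.
move=> s0 gf mk hk0 hk_dx dk; apply: is_derive_line.
rewrite (_ : (fun s : R => _) = (fun s => conv (fun z => k (s *: e_ j + z)) f x)); last first.
  by apply/funext => r; rewrite conv_line.
rewrite (_ : k' = fun z => k' (0 *: e_ j + z)); last first.
  by apply/funext => z; rewrite scale0r add0r.
have C0 := hk_bound_ge0 s0 hk0.
have hs r z : -1 < r < 1 -> C * hk s (r *: e_ j + z) <=
    C * (@heat_doubling R d * expR (2^-1 / s)) * hk (2 * s) z.
  move=> hr; rewrite -[leRHS]mulrA ler_wpM2l// hk_shift_le//.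
  by rewrite ltW// ltr_norml.
apply: (@conv_is_derive _ _ (fun r z => k (r *: e_ j + z))
  (fun r z => k' (r *: e_ j + z)) 0 (-1) 1 (2 * s)) => //.
- by rewrite ltrN10 ltr01.
- by rewrite mulr_gt0.
- by move=> r _; apply: (measurableT_comp mk); exact: measurable_addlV.
- by move=> r z hr; exact: le_trans (hk0 _) (hs _ _ hr).
- by move=> r z hr; exact: le_trans (hk_dx _) (hs _ _ hr).
- by move=> r z _; apply: is_derive_along.
Qed.

(** The kernel and its first two derivatives are bounded with one common constant, since
    [conv_is_derive_space] takes the same [C] for a kernel and for its derivative. *)
Lemma hk_dx_bound j t (z : E) : 0 < t ->
  `|hk_dx j t z| <= (@heat_doubling R d / Num.sqrt t + 3 * @heat_doubling R d / t + @heat_doubling R d) * hk (2 * t) z.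
Proof.
move=> t0; apply: le_trans (hk_dx_le _ _ t0) _; rewrite ler_wpM2r ?heat_kernel_ge0//.
have h0 := @heat_doubling_gt0 R d.
by rewrite -addrA lerDl addr_ge0 ?divr_ge0 ?mulr_ge0// ltW.
Qed.

Lemma hk_dxx_bound j t (z : E) : 0 < t ->
  `|hk_dxx j t z| <= (@heat_doubling R d / Num.sqrt t + 3 * @heat_doubling R d / t + @heat_doubling R d) * hk (2 * t) z.
Proof.
move=> t0; apply: le_trans (hk_dxx_le _ _ t0) _; rewrite ler_wpM2r ?heat_kernel_ge0//.
have h0 := @heat_doubling_gt0 R d.
by rewrite addrAC lerDr addr_ge0 ?divr_ge0 ?sqrtr_ge0// ltW.
Qed.

Lemma hk_bound t (z : E) : 0 < t ->
  `|hk t z| <= (@heat_doubling R d / Num.sqrt t + 3 * @heat_doubling R d / t + @heat_doubling R d) * hk (2 * t) z.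
Proof.
move=> t0; rewrite heat_kernel_norm; apply: le_trans (hk_le _ t0) _.
rewrite ler_wpM2r ?heat_kernel_ge0//; have h0 := @heat_doubling_gt0 R d.
by rewrite lerDr addr_ge0 ?divr_ge0 ?sqrtr_ge0 ?mulr_ge0// ltW.
Qed.

Lemma conv_hk_is_derive j t (f : E -> R) x : 0 < t -> gauss_integrable f ->
  is_derive x (e_ j) (conv (hk t) f) (conv (hk_dx j t) f x).
Proof.
move=> t0 gf; have t2 : 0 < 2 * t by lra.
apply: (conv_is_derive_space x t2 gf (measurable_heat_kernel t)).
- by move=> z; exact: hk_bound.
- by move=> z; exact: hk_dx_bound.
- by move=> z; exact: is_derive_hk.
Qed.

Lemma conv_hk_dx_is_derive j t (f : E -> R) x : 0 < t -> gauss_integrable f ->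
  is_derive x (e_ j) (conv (hk_dx j t) f) (conv (hk_dxx j t) f x).
Proof.
move=> t0 gf; have t2 : 0 < 2 * t by lra.
apply: (conv_is_derive_space x t2 gf (measurable_hk_dx j t)).
- by move=> z; exact: hk_dx_bound.
- by move=> z; exact: hk_dxx_bound.
- by move=> z; exact: is_derive_hk_dx.
Qed.

Lemma conv_sum (k : 'I_d -> E -> R) (f : E -> R) C s x : 0 < s -> gauss_integrable f ->
  (forall j, measurable_fun setT (k j)) ->
  (forall j z, `|k j z| <= C * hk s z) ->
  conv (fun z => \sum_j k j z) f x = \sum_j conv (k j) f x.
Proof.
move=> s0 gf mk hk0; rewrite /conv /Rintegral.
have ik j : mu.-integrable setT (fun y : E => (k j (x - y) * f y)%:E).
  by apply: (conv_integrable x (mk j) _ s0 gf) => z; exact: hk0.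
under eq_integral do rewrite mulr_suml -sumEFin.
rewrite integral_sum//= -sum_fine// => j _.
exact: integrable_fin_num.
Qed.

Lemma conv_hk_is_derive_time (t : R) (f : E -> R) x : 0 < t -> gauss_integrable f ->
  is_derive t (1 : R) (fun s => conv (hk s) f x) (\sum_j conv (hk_dxx j t) f x).
Proof.
move=> t0 gf; have h0 := @heat_doubling_gt0 R d; have t2 : 0 < 2 * t by lra.
rewrite -(@conv_sum _ f _ (2 * t) x t2 gf (fun j => measurable_hk_dxx j t)
  (fun j z => hk_dxx_bound j z t0)).
pose D := 2 `^ d%:R : R; have D0 : 0 < D by exact: powR_gt0.
have t4 : 0 < 2 * (2 * t) by lra.
(* On []t / 2, 2 t[] the kernel is at most [D] times the one at [2 t], hence [D * heat_doubling]
   times the one at [4 t]; each second derivative is at most [3 heat_doubling / (t / 2)] times a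
   kernel at time [2 s], itself at most [D] times the one at [4 t]. The constant is the sum of both
   bounds. *)
apply: (@conv_is_derive _ _ (fun s z => hk s z) (fun s z => \sum_j hk_dxx j s z)
   t (t / 2) (2 * t) (2 * (2 * t)) (D * @heat_doubling R d + d%:R * (6 * @heat_doubling R d / t * (D)))) => //.
- by apply/andP; split; lra.
- by move=> r _; exact: measurable_heat_kernel.
- move=> r z hr; rewrite heat_kernel_norm; apply: le_trans (hk_time_le _ t0 hr) _.
  apply: (@le_trans _ _ (D * (@heat_doubling R d * hk (2 * (2 * t)) z))).
    by rewrite ler_wpM2l ?(ltW D0)// hk_le.
  rewrite mulrA ler_wpM2r ?heat_kernel_ge0// lerDl.
  by rewrite !mulr_ge0 ?invr_ge0// ltW.
- move=> r z /andP[tr rt]; have r0 : 0 < r by lra.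
  apply: le_trans (ler_norm_sum _ _ _) _.
  apply: (@le_trans _ _ (\sum_(j < d) (6 * @heat_doubling R d / t * D) * hk (2 * (2 * t)) z)).
    apply: ler_sum => j _; apply: le_trans (hk_dxx_le _ _ r0) _; rewrite -[leRHS]mulrA.
    apply: ler_pM => //; rewrite ?heat_kernel_ge0 ?divr_ge0 ?mulr_ge0 ?(ltW h0) ?(ltW r0)//.
      have -> : 6 * @heat_doubling R d / t = 3 * @heat_doubling R d / (t / 2) by field; lra.
      by rewrite ler_wpM2l ?mulr_ge0 ?(ltW h0)// lef_pV2 ?posrE; lra.
    by apply: hk_time_le => //; apply/andP; split; lra.
  rewrite sumr_const card_ord -[leLHS]mulr_natl [leLHS]mulrA ler_wpM2r ?heat_kernel_ge0// lerDr.
  by rewrite mulr_ge0// ltW.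
- by move=> r z /andP[tr rt]; apply: is_derive_hk_time; lra.
Qed.

End conv_theory.

(** * Sup and integral estimates for convolutions *)

Section conv_bounds.
Context {R : realType} {d : nat}.
Local Notation E := 'rV[R]_d.
Local Notation mu := (lebesgue_rV R d).
Local Notation hk := (@heat_kernel R d).

Lemma Rintegral_rVD (v : E) (g : E -> R) : measurable_fun setT g ->
  Rintegral mu setT (fun y => g (y + v)) = Rintegral mu setT g.
Proof.
move=> mg; rewrite /Rintegral; congr fine.
have mG : measurable_fun setT (EFin \o g) by exact/measurable_EFinP.
rewrite [LHS]integralE [RHS]integralE; congr (_ - _)%E.
  rewrite -(ge0_integral_rVD v (measurable_funepos mG) (funepos_ge0 _)).
  by apply: eq_integral => y _; rewrite !funeposE.
rewrite -(ge0_integral_rVD v (measurable_funeneg mG) (funeneg_ge0 _)).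
by apply: eq_integral => y _; rewrite !funenegE.
Qed.

Lemma measurable_convol (k f : E -> R) x : measurable_fun setT k ->
  measurable_fun setT f -> measurable_fun setT (fun y : E => k (x - y) * f y).
Proof.
move=> mk mf; apply: measurable_funM => //.
exact: (measurableT_comp mk (measurable_subV x)).
Qed.

Lemma conv_shift (k f : E -> R) v x :
  measurable_fun setT k -> measurable_fun setT f ->
  conv k (fun y => f (y + v)) x = conv k f (x + v).
Proof.
move=> mk mf; rewrite /conv -(Rintegral_rVD v (measurable_convol (x + v) mk mf)).
by apply: eq_Rintegral => y _; rewrite opprD addrACA subrr addr0.
Qed.

Lemma convB (k f g : E -> R) C s x : 0 < s -> gauss_integrable f -> gauss_integrable g ->
  measurable_fun setT k -> (forall z, `|k z| <= C * hk s z) ->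
  conv k (fun y => f y - g y) x = conv k f x - conv k g x.
Proof.
move=> s0 gf gg mk hk0; rewrite /conv -RintegralB//.
- by apply: eq_Rintegral => y _; rewrite mulrBr.
- exact: conv_integrable mk hk0 s0 gf.
- exact: conv_integrable mk hk0 s0 gg.
Qed.

Lemma convD (k f g : E -> R) C s x : 0 < s -> gauss_integrable f -> gauss_integrable g ->
  measurable_fun setT k -> (forall z, `|k z| <= C * hk s z) ->
  conv k (fun y => f y + g y) x = conv k f x + conv k g x.
Proof.
move=> s0 gf gg mk hk0; rewrite /conv -RintegralD//.
- by apply: eq_Rintegral => y _; rewrite mulrDr.
- exact: conv_integrable mk hk0 s0 gf.
- exact: conv_integrable mk hk0 s0 gg.
Qed.

Lemma conv_ae (k f g : E -> R) x : measurable_fun setT k ->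
  measurable_fun setT f -> measurable_fun setT g ->
  {ae mu, forall y, f y = g y} -> conv k f x = conv k g x.
Proof.
move=> mk mf mg fg; rewrite /conv /Rintegral; congr fine.
apply: ae_eq_integral => //.
- by apply/measurable_EFinP; exact: measurable_convol.
- by apply/measurable_EFinP; exact: measurable_convol.
- by apply: filterS fg => y -> _.
Qed.

Lemma measurable_hk_sub s x : measurable_fun setT (fun y : E => hk s (x - y)).
Proof. exact: (measurableT_comp (measurable_heat_kernel s) (measurable_subV x)). Qed.

Lemma integral_hk_sub s (x : E) : 0 < s ->
  (\int[mu]_y (hk s (x - y)%R)%:E = 1)%E.
Proof.
move=> s0; rewrite -[RHS](@integral_heat_kernel R d s s0).
have m : measurable_fun setT (fun y : E => (hk s y)%:E).
  by apply/measurable_EFinP; exact: measurable_heat_kernel.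
rewrite -(ge0_integral_rVD (- x) m); last by move=> y; rewrite lee_fin heat_kernel_ge0.
by apply: eq_integral => y _; rewrite -heat_kernelN opprB.
Qed.

Lemma integral_hk_subr s (y : E) : 0 < s ->
  (\int[mu]_x (hk s (x - y)%R)%:E = 1)%E.
Proof.
move=> s0; rewrite -[RHS](@integral_heat_kernel R d s s0).
have m : measurable_fun setT (fun y : E => (hk s y)%:E).
  by apply/measurable_EFinP; exact: measurable_heat_kernel.
by rewrite -(ge0_integral_rVD (- y) m)// => x; rewrite lee_fin heat_kernel_ge0.
Qed.

Lemma conv_le (k f : E -> R) C s x : 0 < s -> gauss_integrable f ->
  measurable_fun setT k -> (forall z, `|k z| <= C * hk s z) ->
  (`|conv k f x|%:E <= \int[mu]_y (C * (hk s (x - y)%R * `|f y|))%:E)%E.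
Proof.
move=> s0 gf mk hk0; rewrite /conv.
have ik := conv_integrable x mk hk0 s0 gf.
have C0 := hk_bound_ge0 s0 hk0.
have mf : measurable_fun setT f by case: gf.
rewrite EFin_normr_Rintegral//.
apply: le_trans (le_abse_integral _ _ _) _ => //; first exact: measurable_int ik.
apply: ge0_le_integral => //.
- apply: measurableT_comp => //; exact: measurable_int ik.
- apply/measurable_EFinP/measurable_funM => //; apply: measurable_funM.
    exact: measurable_hk_sub.
  exact: measurableT_comp.
- by move=> y _; rewrite /= lee_fin normrM mulrA ler_wpM2r.
Qed.

Lemma conv_bounded (k f : E -> R) C s M x : 0 < s -> 0 <= M ->
  measurable_fun setT f -> {ae mu, forall y, `|f y| <= M} ->
  measurable_fun setT k -> (forall z, `|k z| <= C * hk s z) ->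
  `|conv k f x| <= C * M.
Proof.
move=> s0 M0 mf fM mk hk0; have C0 := hk_bound_ge0 s0 hk0.
have gf : gauss_integrable f.
  apply: (@gauss_integrable_le _ _ f (cst 0) M) => //; first exact: gauss_integrable_cst.
  by apply: filterS fM => y; rewrite /cst normr0 addr0.
rewrite -lee_fin; apply: le_trans (conv_le x s0 gf mk hk0) _.
have mh := measurable_hk_sub s x.
apply: (@le_trans _ _ (\int[mu]_y ((C * M) * hk s (x - y)%R)%:E)%E).
  apply: ae_ge0_le_integral => //.
  - by move=> y _; rewrite lee_fin mulr_ge0// mulr_ge0// heat_kernel_ge0.
  - apply/measurable_EFinP/measurable_funM => //; apply: measurable_funM => //.
    exact: measurableT_comp.
  - move=> y _; rewrite lee_fin; apply: mulr_ge0; last exact: heat_kernel_ge0.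
    exact: mulr_ge0.
  - by apply/measurable_EFinP/measurable_funM.
  - apply: filterS fM => y fy _; rewrite lee_fin -mulrA ler_wpM2l// mulrC.
    by rewrite ler_wpM2r ?heat_kernel_ge0.
rewrite ge0_integralZl_real ?mulr_ge0//; first by rewrite integral_hk_sub// mule1.
by move=> y; exact: heat_kernel_ge0.
Qed.

(** Young's inequality: after exchanging the integrals, the kernel has mass 1 in [x] for each fixed
    [y]. *)
Lemma conv_L1 (k f : E -> R) C s : 0 < s -> gauss_integrable f ->
  measurable_fun setT k -> (forall z, `|k z| <= C * hk s z) ->
  (\int[mu]_x `|conv k f x|%:E <= C%:E * \int[mu]_y `|f y|%:E)%E.
Proof.
move=> s0 gf mk hk0; have C0 := hk_bound_ge0 s0 hk0.
have mf : measurable_fun setT f by case: gf.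
have mnf : measurable_fun setT (fun y => `|f y|) by exact: measurableT_comp.
pose F (z : E * E) := (C * (hk s (z.1 - z.2) * `|f z.2|))%:E.
have F0 z : (0 <= F z)%E.
  by rewrite lee_fin mulr_ge0// mulr_ge0// heat_kernel_ge0.
have mF : measurable_fun setT F.
  apply/measurable_EFinP/measurable_funM => //; apply: measurable_funM; last first.
    exact: (measurableT_comp mnf measurable_snd).
  apply: (measurableT_comp (measurable_heat_kernel s)); apply: measurable_fun_rV => i.
  under eq_fun do rewrite !mxE.
  apply: measurable_funB.
    exact: (measurableT_comp (measurable_coord i) measurable_fst).
  exact: (measurableT_comp (measurable_coord i) measurable_snd).
apply: (@le_trans _ _ (\int[mu]_x \int[mu]_y F (x, y))%E).
  apply: ge0_le_integral => //.
  - apply/measurable_EFinP; apply: measurableT_comp => //; exact: measurable_conv.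
  - exact: (measurable_fun_fubini_tonelli_F F mF F0).
  - by move=> x _; exact: (conv_le x s0 gf mk hk0).
rewrite (fubini_tonelli F mF F0).
rewrite -ge0_integralZl//; last exact/measurable_EFinP.
apply: ge0_le_integral => //.
- by move=> y _; apply: integral_ge0.
- exact: (measurable_fun_fubini_tonelli_G F mF F0).
- by apply/measurable_EFinP; exact: measurable_funM.
- move=> y _; rewrite /fubini_G /F /=.
  under eq_integral do rewrite mulrA mulrAC.
  rewrite ge0_integralZl_real ?mulr_ge0//.
  + by rewrite integral_hk_subr// mule1 EFinM.
  + apply: (measurableT_comp (measurable_heat_kernel s)).
    exact: measurable_addrV.
  + by move=> x; exact: heat_kernel_ge0.
Qed.

(** Convolution commutes with translations, so the increment falls on [f]. *)
Lemma conv_diff_L1 (k f : E -> R) C s v : 0 < s -> gauss_integrable f ->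
  measurable_fun setT k -> (forall z, `|k z| <= C * hk s z) ->
  (\int[mu]_x `|conv k f (x + v)%R - conv k f x|%:E <=
   C%:E * \int[mu]_y `|f (y + v)%R - f y|%:E)%E.
Proof.
move=> s0 gf mk hk0.
have gv := gauss_integrable_shift v gf.
have gd : gauss_integrable (fun y => f (y + v) - f y) by apply: gauss_integrableD => //; exact: gauss_integrableN.
rewrite (eq_integral (fun x => `|conv k (fun y => f (y + v) - f y) x|%:E)).
  exact: conv_L1 gd mk hk0.
move=> x _; rewrite (convB x s0 gv gf mk hk0) conv_shift//.
by case: gf.
Qed.

(** The difference quotients with steps [1 / (n + 1)] have [L^1] norm at most [C V], the step
    cancelling against the bound on increments of [f]. The constant is that of [k] and not of [k'],
    because one derivative is charged to [f]; this is the gain for functions of bounded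
    variation. *)
Lemma conv_derive_L1 (k k' f : E -> R) C s (v : E) V : 0 < s -> gauss_integrable f ->
  measurable_fun setT k -> (forall z, `|k z| <= C * hk s z) ->
  (forall x, is_derive x v (conv k f) (conv k' f x)) ->
  (forall h, 0 < h -> (\int[mu]_y `|f (y + h *: v)%R - f y|%:E <= (h * V)%:E)%E) ->
  (\int[mu]_x `|conv k' f x|%:E <= (C * V)%:E)%E.
Proof.
move=> s0 gf mk hk0 dk hV; have C0 := hk_bound_ge0 s0 hk0.
have mf : measurable_fun setT f by case: gf.
pose h (n : nat) : R := n.+1%:R^-1.
have h0 n : 0 < h n by rewrite invr_gt0.
pose phi n x := `|(h n)^-1 * (conv k f (x + h n *: v) - conv k f x)|%:E.
have mphi n : measurable_fun setT (phi n).
  apply/measurable_EFinP; apply: measurableT_comp => //; apply: measurable_funM => //.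
  apply: measurable_funB; last exact: measurable_conv.
  exact: (measurableT_comp (measurable_conv mk mf) (measurable_addrV _)).
have cphi x : phi n x @[n --> \oo] --> `|conv k' f x|%:E.
  apply: cvg_EFin; first exact: nearW.
  apply: cvg_norm.
  have [dx dxE] := dk x.
  have /cvg_ex[/= l dl] := dx.
  have -> : conv k' f x = l by rewrite -dxE; apply/cvg_lim.
  have hh : (forall n, h n != 0) /\ h n @[n --> \oo] --> 0.
    by split => [n|]; [rewrite gt_eqF|exact: cvg_harmonic].
  move/cvgr_dnbhsP : dl => /(_ h hh) /=.
  by under eq_fun do rewrite [_ *: v + x]addrC.
rewrite (_ : (fun x => _) = fun x => limn_einf (phi ^~ x)); last first.
  apply/funext => x; apply/esym.
  by have /cvg_limn_einf_sup[] := cphi x.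
have phi0 n x : setT x -> (0 <= phi n x)%E by move=> _; rewrite lee_fin.
apply: le_trans (fatou _ measurableT mphi phi0) _.
rewrite limn_einf_lim; apply: lime_le; first exact: is_cvg_einfs.
apply: nearW => n; apply: (@le_trans _ _ (\int[mu]_x phi n x)%E).
  by apply: ereal_inf_lbound; exists n => /=.
rewrite /phi; under eq_integral do rewrite normrM normfV.
rewrite ge0_integralZl_real ?invr_ge0//; last first.
  apply: measurableT_comp => //; apply: measurable_funB; last exact: measurable_conv.
  exact: (measurableT_comp (measurable_conv mk mf) (measurable_addrV _)).
apply: (@le_trans _ _ ((h n)^-1%:E * (C%:E * (h n * V)%:E))%E); last first.
  by rewrite -!EFinM lee_fin mulrCA mulKf ?gt_eqF.
rewrite (gtr0_norm (h0 n)); apply: lee_wpmul2l; first by rewrite lee_fin invr_ge0 ltW.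
apply: le_trans (conv_diff_L1 _ s0 gf mk hk0) _.
by apply: lee_wpmul2l => //; exact: hV.
Qed.

End conv_bounds.

(** * Smooth approximations of indicators of boxes *)

Section smooth_real_functions.
Context {R : realType}.
Implicit Types (f g : R -> R) (n : nat).

(** Finite orders of differentiability serve as the induction variable for the closure properties of
    smooth functions. *)
Fixpoint smoothn n f : Prop :=
  if n is m.+1 then (forall x, derivable f x 1) /\ smoothn m (derive1 f) else True.

Definition smooth1 f := forall n, smoothn n f.

Lemma derivable_is_derive1 f x : derivable f x 1 -> is_derive x (1 : R) f (derive1 f x).
Proof. by move=> df; rewrite derive1E; exact: derivableP. Qed.

Lemma smoothnW n f : smoothn n.+1 f -> smoothn n f.
Proof. by elim: n f => // n IH f [h1 h2]; split => //; exact: IH. Qed.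

Lemma smoothnD n f g : smoothn n f -> smoothn n g -> smoothn n (f + g).
Proof.
elim: n f g => // n IH f g [df sf] [dg sg]; split.
  by move=> x; exact: derivableD.
rewrite (_ : derive1 (f + g) = (derive1 f) + (derive1 g)); first exact: IH.
apply/funext => x; rewrite [LHS]derive1E.
by have [_ ->] := is_deriveD (derivable_is_derive1 (df x)) (derivable_is_derive1 (dg x)).
Qed.

Lemma smoothnN n f : smoothn n f -> smoothn n (- f).
Proof.
elim: n f => // n IH f [df sf]; split.
  by move=> x; exact: derivableN.
rewrite (_ : derive1 (- f) = - (derive1 f)); first exact: IH.
apply/funext => x; rewrite [LHS]derive1E.
by have [_ ->] := is_deriveN (derivable_is_derive1 (df x)).
Qed.

Lemma smoothnM n f g : smoothn n f -> smoothn n g -> smoothn n (f * g).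
Proof.
elim: n f g => // n IH f g [df sf] [dg sg]; split.
  by move=> x; exact: derivableM.
rewrite (_ : derive1 (f * g) = f * (derive1 g) + g * (derive1 f)).
  by apply: smoothnD; apply: IH => //; exact: smoothnW.
apply/funext => x; rewrite [LHS]derive1E.
by have [_ ->] := is_deriveM (derivable_is_derive1 (df x)) (derivable_is_derive1 (dg x)).
Qed.

Lemma smoothn_cst n (a : R) : smoothn n (cst a).
Proof.
elim: n a => // n IH a; split; first by move=> x; exact: derivable_cst.
rewrite (_ : derive1 _ = cst 0); first exact: IH.
by apply/funext => x; rewrite derive1E; exact: derive_cst.
Qed.

Lemma smoothn_affine n f (a b : R) : smoothn n f -> smoothn n (fun x => f (a * x + b)).
Proof.
elim: n f => // n IH f [df sf].
have h x : is_derive x (1 : R) (fun x => f (a * x + b)) (a * (derive1 f) (a * x + b)).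
  have h1 : is_derive x (1 : R) (fun x => a * x + b) a.
    by apply: is_derive_eq; rewrite /GRing.scale/=; ring.
  have h2 : is_derive (a * x + b) (1 : R) f ((derive1 f) (a * x + b)).
    by rewrite derive1E; exact: derivableP.
  have h3 := @is_derive1_comp R f (fun x => a * x + b) x _ _ h2 h1.
  by move: h3; rewrite mulrC.
split; first by move=> x; case: (h x).
rewrite (_ : derive1 _ = cst a * (fun x => (derive1 f) (a * x + b))).
  apply: smoothnM; last exact: IH.
  exact: smoothn_cst.
by apply/funext => x; rewrite derive1E; case: (h x).
Qed.

Lemma smooth1_derivable f n x : smooth1 f -> derivable (derive1n n f) x 1.
Proof.
move=> sf; have := sf n.+1; elim: n f {sf} => [|n IH] f [df sf]; first exact: df.
by rewrite derive1Sn; exact: IH.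
Qed.

Lemma smooth1_derive f : (forall x, derivable f x 1) -> smooth1 (derive1 f) -> smooth1 f.
Proof. by move=> df sf [|n]//; split. Qed.

(* The functions [x |-> p(1/x) exp(-1/x)] extended by 0 to [x <= 0] are stable
   under differentiation. *)
Definition flat (p : {poly R}) (x : R) : R :=
  if 0 < x then p.[x^-1] * expR (- x^-1) else 0.

(** With [y = 1 / x], the derivative of [p(y) exp(-y)] in [x] is [y^2 (p(y) - p'(y)) exp(-y)]. *)
Definition dflat (p : {poly R}) : {poly R} := 'X^2 * (p - p^`()).

(** [exp y = (exp (y / n))^n >= (y / n)^n] with [n = size p + 2]. The two spare powers of [y] make
    the difference quotient of [flat p] vanish at the origin. *)
Lemma poly_expR_bound (p : {poly R}) : exists2 C, 0 <= C &
  forall y, 1 <= y -> `|p.[y]| * expR (- y) <= C / y ^+ 2.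
Proof.
pose n := (size p + 2)%N; pose A := \sum_(i < size p) `|p`_i|.
have A0 : 0 <= A by exact: sumr_ge0.
exists (A * n%:R ^+ n); first by rewrite mulr_ge0// exprn_ge0.
move=> y y1; have y0 : 0 < y by lra.
have n0 : (0 : R) < n%:R by rewrite ltr0n /n addn2.
have h1 : `|p.[y]| <= A * y ^+ size p.
  rewrite horner_coef; apply: le_trans (ler_norm_sum _ _ _) _.
  rewrite mulr_suml; apply: ler_sum => i _; rewrite normrM ler_wpM2l//.
  by rewrite ger0_norm ?exprn_ge0 ?(ltW y0)// ler_weXn2l// ltnW.
have h2 : expR (- y) <= n%:R ^+ n / y ^+ n.
  rewrite expRN -[leRHS]invrK lef_pV2 ?posrE ?expR_gt0//; last first.
    by rewrite invr_gt0 divr_gt0 ?exprn_gt0.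
  rewrite invfM invrK mulrC -expr_div_n.
  have -> : expR y = expR (y / n%:R) ^+ n.
    by rewrite -expRM_natl mulrC divfK// gt_eqF.
  apply: lerXn2r; rewrite ?nnegrE ?expR_ge0 ?divr_ge0 ?(ltW y0) ?(ltW n0)//.
  by apply: le_trans (expR_ge1Dx _); rewrite lerDr.
apply: (@le_trans _ _ ((A * y ^+ size p) * (n%:R ^+ n / y ^+ n))).
  by apply: ler_pM => //; exact: expR_ge0.
have -> : y ^+ n = y ^+ size p * y ^+ 2 by rewrite -exprD.
have y2 : y != 0 by rewrite gt_eqF.
have y3 := expf_neq0 (size p) y2.
rewrite [leRHS](_ : _ = A * y ^+ size p * (n%:R ^+ n / (y ^+ size p * y ^+ 2)))//.
by field; rewrite y2 y3.
Qed.

Lemma is_derive_flat p x : is_derive x (1 : R) (flat p) (flat (dflat p) x).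
Proof.
have [x0|x0|->] := ltgtP x 0.
- rewrite {2}/flat ltNge (ltW x0)/=.
  have h0 : is_derive x (1 : R) (cst (0 : R) : R -> R) 0 by exact: is_derive_cst.
  apply: near_eq_is_derive h0; near=> y; rewrite /flat ltNge.
  suff -> : y <= 0 by [].
  by near: y; apply: filterS (lt_nbhsl x0) => z /ltW.
- rewrite {2}/flat x0.
  apply: (near_eq_is_derive (f := (horner p \o (@GRing.inv R)) * (expR \o (-%R \o @GRing.inv R)))).
    near=> y; rewrite /flat.
    suff -> : 0 < y by [].
    by near: y; exact: (lt_nbhsr x0).
  have x1 : x != 0 by rewrite gt_eqF.
  have hV : is_derive x (1 : R) (@GRing.inv R) (- x ^- 2).
    have := @is_deriveV R id x 1 1 x1 (is_derive_id _ _).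
    by rewrite /GRing.scale/= mulr1.
  have hp : is_derive x (1 : R) (horner p \o (@GRing.inv R)) (p^`().[x^-1] * (- x ^- 2)).
    exact: is_derive1_comp.
  have hN : is_derive x (1 : R) (-%R \o @GRing.inv R) (x ^- 2).
    by have := is_deriveN hV; rewrite opprK.
  have he : is_derive x (1 : R) (expR \o (-%R \o @GRing.inv R)) (expR (- x^-1) * x ^- 2).
    exact: is_derive1_comp.
  apply: is_derive_eq; rewrite /GRing.scale/= /dflat hornerM hornerXn hornerD hornerN.
  rewrite -exprVn; ring.
(* At the origin, [y = 1 / h] in the polynomial bound makes the quotient at most
   [h^-1 * C h^2 = C h] for [h > 0]; for [h < 0] it is zero. *)
- rewrite {2}/flat ltxx.
  have [C C0 hC] := poly_expR_bound p.
  have : (h^-1 *: ((flat p \o shift 0) (h *: 1) - flat p 0)) @[h --> 0^'] --> (0 : R).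
    apply/cvgr0Pnorm_lt => e e0.
    near=> h.
    rewrite /= addr0 [h *: 1]mulr1 {2}/flat ltxx subr0 /GRing.scale/=.
    rewrite /flat; case: (ltP 0 h) => h0; last by rewrite mulr0 normr0.
    have h1 : h <= 1.
      apply: le_trans (ler_norm _) _; apply: ltW; near: h.
      by apply: dnbhs0_lt.
    have hC1 : `|h| < e / (C + 1).
      near: h; apply: dnbhs0_lt; rewrite divr_gt0//; lra.
    rewrite !normrM normfV (gtr0_norm h0) (gtr0_norm (expR_gt0 _)).
    have hi : 1 <= h^-1 by rewrite -[leLHS]invr1 lef_pV2 ?posrE.
    have := hC _ hi; rewrite exprVn invrK => hb.
    apply: (@le_lt_trans _ _ (h^-1 * (C * h ^+ 2))).
      by rewrite ler_wpM2l// invr_ge0 ltW.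
    have -> : h^-1 * (C * h ^+ 2) = C * h by field; rewrite gt_eqF.
    rewrite (gtr0_norm h0) ltr_pdivlMr in hC1; last lra.
    nra.
  move=> hc; split; first by apply/cvg_ex; exists 0.
  exact: cvg_lim hc.
Unshelve. all: by end_near. Qed.

Lemma smooth1_flat p : smooth1 (flat p).
Proof.
move=> n; elim: n p => // n IH p; split.
  by move=> x; case: (is_derive_flat p x).
rewrite (_ : derive1 (flat p) = flat (dflat p)); first exact: IH.
by apply/funext => x; rewrite derive1E; case: (is_derive_flat p x).
Qed.

End smooth_real_functions.

Section dominated.
Context d (T : measurableType d) {R : realType} (m : {measure set T -> \bar R}).

Lemma Rintegral_dominated_cvg (D : set T) (f_ : nat -> T -> R) (f g : T -> R) :
  measurable D -> (forall n, measurable_fun D (f_ n)) -> measurable_fun D f ->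
  (forall x, D x -> f_ n x @[n --> \oo] --> f x) ->
  m.-integrable D (EFin \o g) ->
  (forall n x, D x -> `|f_ n x| <= g x) ->
  m.-integrable D (EFin \o f) /\
  Rintegral m D (f_ n) @[n --> \oo] --> Rintegral m D f.
Proof.
move=> mD mf_ mf ff ig fg.
have [|||||h1 _ h2] := @dominated_convergence _ _ _ m D mD
  (fun n => EFin \o f_ n) (EFin \o f) (EFin \o g).
- by move=> n; exact/measurable_EFinP.
- exact/measurable_EFinP.
- by apply: aeW => x Dx; apply: cvg_EFin; [exact: nearW|exact: ff].
- by [].
- by apply: aeW => x n Dx; rewrite /= lee_fin fg.
split => //; apply: fine_cvg; rewrite fineK; first exact: h2.
exact: integrable_fin_num.
Qed.

Lemma integrable_cst_lty (D : set T) (k : R) : measurable D -> (m D < +oo)%E ->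
  m.-integrable D (EFin \o cst k).
Proof.
move=> mD mDoo; apply: measurable_bounded_integrable => //.
exact: bounded_cst.
Qed.

End dominated.

(** * Test functions built as tensor products *)

Section tensor_products.
Context {R : realType} {d : nat}.
Local Notation E := 'rV[R]_d.
Local Notation e_ j := (delta_mx ord0 j : E).
Implicit Type g : 'I_d -> R -> R.

Definition tensor g (x : E) : R := \prod_i g i (x ord0 i).

Lemma is_derive_tensor g j x : (forall i y, derivable (g i) y 1) ->
  is_derive x (e_ j) (tensor g) (tensor (fun i => if i == j then derive1 (g i) else g i) x).
Proof.
move=> dg; apply: is_derive_line.
pose c := \prod_(i < d | i != j) g i (x ord0 i).
rewrite (_ : (fun s : R => _) = (fun s : R => c * g j (1 * s + x ord0 j))); last first.
  apply/funext => s; rewrite /tensor (bigD1 j)//= coord_line eqxx mulr1 mul1r mulrC.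
  congr (_ * _); apply: eq_bigr => i /negbTE ij.
  by rewrite coord_line ij mulr0 add0r.
rewrite /tensor (bigD1 j)//= eqxx mulrC (eq_bigr (fun i => g i (x ord0 i))); last first.
  by move=> i /negbTE ->.
rewrite -/c.
have h1 : is_derive (0 : R) (1 : R) (fun s : R => 1 * s + x ord0 j) 1.
  by apply: is_derive_eq; rewrite /GRing.scale/=; ring.
have h2 : is_derive (1 * 0 + x ord0 j) (1 : R) (g j) (derive1 (g j) (x ord0 j)).
  by rewrite mulr0 add0r; exact: derivable_is_derive1.
have h3 := @is_derive1_comp R (g j) (fun s => 1 * s + x ord0 j) 0 _ _ h2 h1.
by have h4 := is_deriveZ c h3; apply: is_derive_eq h4 _; rewrite /GRing.scale/= mulr1.
Qed.

(** Partial derivatives act factor by factor, so only the number of occurrences of each index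
    matters, and smoothness reduces to one variable. *)
Lemma iter_partial_tensor g (s : seq 'I_d) : (forall i, smooth1 (g i)) ->
  iter_partial s (tensor g) = tensor (fun i => derive1n (count_mem i s) (g i)).
Proof.
move=> sg; elim: s => [//|j s IH].
apply/funext => x; rewrite /= -/(iter_partial s (tensor g)) IH.
have [_ ->] := @is_derive_tensor (fun i => derive1n (count_mem i s) (g i)) j x
  (fun i y => @smooth1_derivable _ _ _ y (sg i)).
rewrite /tensor; apply: eq_bigr => i _; rewrite eq_sym.
by case: (j == i); rewrite /= ?add0n ?add1n.
Qed.

Lemma continuous_tensor g : (forall i, continuous (g i)) -> continuous (tensor g).
Proof.
move=> cg; rewrite /tensor.
elim: (index_enum _) => [|i r IH].
  rewrite (_ : (fun x : E => _) = cst (1 : R)); first exact: cst_continuous.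
  by apply/funext => x; rewrite big_nil.
rewrite (_ : (fun x : E => _) = (fun x : E => g i (x ord0 i)) * (fun x : E => \prod_(j <- r) g j (x ord0 j))).
  move=> x; apply: continuousM; last exact: IH.
  apply: continuous_comp; first exact: coord_continuous.
  exact: cg.
by apply/funext => x; rewrite big_cons.
Qed.

Lemma smooth_tensor g : (forall i, smooth1 (g i)) -> smooth (tensor g).
Proof.
move=> sg s; rewrite iter_partial_tensor//; split.
  apply: continuous_tensor => i y.
  by apply/differentiable_continuous/derivable1_diffP; exact: smooth1_derivable.
move=> j x.
by have [] := @is_derive_tensor (fun i => derive1n (count_mem i s) (g i)) j x
  (fun i y => @smooth1_derivable _ _ _ y (sg i)).
Qed.

Lemma compact_box (M : R) : compact [set v : E | forall i, `[- M, M]%classic (v ord0 i)].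
Proof. exact: (@rV_compact R d (fun=> `[- M, M]%classic) (fun=> @segment_compact R (- M) M)). Qed.

Lemma test_function_tensor g (M : R) : (forall i, smooth1 (g i)) ->
  (forall i s, g i s != 0 -> - M <= s <= M) -> test_function (tensor g).
Proof.
move=> sg gM; split; first exact: smooth_tensor.
have cB := @compact_box M.
have clB : closed [set v : E | forall i, `[- M, M]%classic (v ord0 i)].
  by apply: compact_closed cB; exact: norm_hausdorff.
have sB : closure [set x | tensor g x != 0] `<=` [set v : E | forall i, `[- M, M]%classic (v ord0 i)].
  rewrite [X in _ `<=` X](closure_id _).1//; apply: closure_subset => x /= hx i.
  rewrite in_itv/=; apply: (gM i).
  by apply: contra hx => /eqP h; rewrite /tensor (bigD1 i)//= h mul0r.
have cC := @closed_closure _ [set x | tensor g x != 0].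
have := @subclosed_compact _ _ _ cC cB sB.
exact.
Qed.

End tensor_products.

Lemma integrable_cst_itv {R : realType} (a b k : R) :
  (@lebesgue_measure R).-integrable `]a, b]%classic (EFin \o cst k).
Proof.
apply: integrable_cst_lty; first exact: measurable_itv.
have := @lebesgue_measure_itv R `]a, b]; rewrite /= => ->.
by case: ifP => _; rewrite ?ltry.
Qed.

(** * One-dimensional bumps and their primitives *)

Section bumps.
Context {R : realType}.
Implicit Types (a b s h c : R).

(** A smooth function positive exactly on []a, b[] when [c > 0]. Each factor is there
    [exp (- 1 / (c y))] with [y] the distance to an endpoint, so it tends to 1 as [c] grows. *)
Definition bump c a b s : R := flat 1 (c * (s - a)) * flat 1 (c * (b - s)).

Lemma flat1E s : flat 1 s = if 0 < s then expR (- s^-1) else 0 :> R.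
Proof. by rewrite /flat hornerC mul1r. Qed.

Lemma flat1_ge0 s : 0 <= flat 1 s.
Proof. by rewrite flat1E; case: ifP => // _; exact: expR_ge0. Qed.

Lemma flat1_le1 s : flat 1 s <= 1.
Proof.
rewrite flat1E; case: ltP => // s0.
by rewrite -[leRHS]expR0 ler_expR oppr_le0 invr_ge0 ltW.
Qed.

Lemma bump_ge0 c a b s : 0 <= bump c a b s.
Proof. by rewrite mulr_ge0// flat1_ge0. Qed.

Lemma bump_le1 c a b s : bump c a b s <= 1.
Proof. by rewrite -[leRHS]mulr1 ler_pM// ?flat1_ge0// flat1_le1. Qed.

Lemma bump_eq0 c a b s : 0 < c -> s \notin `]a, b[ -> bump c a b s = 0.
Proof.
move=> c0; rewrite in_itv/= negb_and -!leNgt /bump !flat1E => /orP[h|h].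
  by rewrite ltNge pmulr_rle0// subr_le0 h mul0r.
by rewrite [X in _ * X]ifF ?mulr0// ltNge pmulr_rle0// subr_le0 h.
Qed.

Lemma smooth1_bump c a b : smooth1 (bump c a b).
Proof.
move=> n; rewrite (_ : bump c a b = (fun s => flat 1 (c * s + (- c * a))) *
    (fun s => flat 1 ((- c) * s + c * b))).
  by apply: smoothnM; apply: smoothn_affine; exact: smooth1_flat.
by apply/funext => s; rewrite /bump; congr (flat 1 _ * flat 1 _); ring.
Qed.

Lemma bump_cvg a b s :
  bump n.+1%:R a b s @[n --> \oo] --> (\1_`]a, b[%classic s : R).
Proof.
have [sab|sab] := boolP (s \in `]a, b[); last first.
  rewrite indicE memNset; last by move/negP : sab.
  rewrite (_ : (fun n => _) = cst 0); first exact: cvg_cst.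
  by apply/funext => n; rewrite bump_eq0.
rewrite indicE mem_set//=.
move: sab; rewrite in_itv/= => /andP[sa sb].
have h y : 0 < y -> flat 1 (n.+1%:R * y) @[n --> \oo] --> (1 : R).
  move=> y0.
  rewrite (_ : (fun n => _) = (fun n => expR (- (n.+1%:R^-1 * y^-1)))); last first.
    by apply/funext => n; rewrite flat1E mulr_gt0// invfM.
  have : expR (- (n.+1%:R^-1 * y^-1)) @[n --> \oo] --> expR (- (0 * y^-1)).
    apply: continuous_cvg; first exact: continuous_expR.
    by apply: cvgN; apply: cvgM; [exact: cvg_harmonic|exact: cvg_cst].
  by rewrite mul0r oppr0 expR0.
have h1 : 0 < s - a by lra.
have h2 : 0 < b - s by lra.
by have := cvgM (h _ h1) (h _ h2); rewrite mulr1; apply.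
Qed.

Lemma measurable_bump c a b : measurable_fun setT (bump c a b).
Proof.
apply: continuous_measurable_fun => x.
apply/differentiable_continuous/derivable1_diffP.
by have [] := @smooth1_bump c a b 1%N.
Qed.

Lemma integrable_bump c a b : 0 < c ->
  lebesgue_measure.-integrable setT (EFin \o bump c a b).
Proof.
move=> c0; have := @integrable_indic_itv R a b false true.
apply: le_integrable => //.
  by apply/measurable_EFinP; exact: measurable_bump.
move=> x _ /=; rewrite lee_fin ger0_norm ?bump_ge0// indicE.
have [xab|xab] := boolP (x \in `]a, b[).
  by rewrite mem_set//= ger0_norm// bump_le1.
by rewrite bump_eq0// normr_ge0.
Qed.

Definition primitive (f : R -> R) s : R := Rintegral lebesgue_measure `]-oo, s]%classic f.

Lemma is_derive_primitive c a b s : 0 < c ->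
  is_derive s (1 : R) (primitive (bump c a b)) (bump c a b s).
Proof.
move=> c0; have ss : s < s + 1 by lra.
have ib : lebesgue_measure.-integrable `]-oo, s + 1]%classic (EFin \o bump c a b).
  exact: integrableS (integrable_bump a b c0).
have cb : {for s, continuous (bump c a b)}.
  apply/differentiable_continuous/derivable1_diffP.
  by have [] := @smooth1_bump c a b 1%N.
have [h1 h2] := continuous_FTC1 ss ib (ltNyr _) cb.
by split; [exact: h1|rewrite -derive1E; exact: h2].
Qed.

(* [slab h f s] is the integral of [f] over [s, s + h], so that its derivative is
   the increment [f (s + h) - f s]. *)
Definition slab h (f : R -> R) s : R := primitive f (s + h) - primitive f s.

Lemma slabE h c a b s : 0 < c -> 0 <= h ->
  slab h (bump c a b) s = Rintegral lebesgue_measure `]s, s + h]%classic (bump c a b).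
Proof.
move=> c0 h0; rewrite /slab /primitive Rintegral_itvB//.
- exact: integrableS (integrable_bump a b c0).
- by rewrite bnd_simp; lra.
Qed.

Lemma smooth1_primitive c a b : 0 < c -> smooth1 (primitive (bump c a b)).
Proof.
move=> c0; apply: smooth1_derive.
  by move=> x; case: (is_derive_primitive a b x c0).
rewrite (_ : derive1 _ = bump c a b); first exact: smooth1_bump.
by apply/funext => x; rewrite derive1E; case: (is_derive_primitive a b x c0).
Qed.

Lemma slab_affine h c a b : slab h (bump c a b) =
  (fun s => primitive (bump c a b) (1 * s + h)) + (- primitive (bump c a b)).
Proof. by apply/funext => s; rewrite /slab; under [in RHS]eq_fun do rewrite mul1r. Qed.

Lemma smooth1_slab h c a b : 0 < c -> smooth1 (slab h (bump c a b)).
Proof.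
move=> c0 n; rewrite slab_affine; apply: smoothnD.
  by apply: smoothn_affine; exact: smooth1_primitive.
by apply: smoothnN; exact: smooth1_primitive.
Qed.

Lemma derive1_slab h c a b s : 0 < c ->
  derive1 (slab h (bump c a b)) s = bump c a b (s + h) - bump c a b s.
Proof.
move=> c0; rewrite slab_affine derive1E.
have h1 : is_derive s (1 : R) (fun s : R => 1 * s + h) 1.
  by apply: is_derive_eq; rewrite /GRing.scale/=; ring.
have h3 := @is_derive1_comp R _ (fun s => 1 * s + h) s _ _
  (is_derive_primitive a b (1 * s + h) c0) h1.
have [_ ->] := is_deriveD h3 (is_deriveN (is_derive_primitive a b s c0)).
by rewrite mulr1 mul1r.
Qed.

Lemma slab_ge0 h c a b s : 0 < c -> 0 <= h -> 0 <= slab h (bump c a b) s.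
Proof.
by move=> c0 h0; rewrite slabE//; apply: Rintegral_ge0 => x _; exact: bump_ge0.
Qed.

Lemma slab_le h c a b s : 0 < c -> 0 <= h -> slab h (bump c a b) s <= h.
Proof.
move=> c0 h0; rewrite slabE//.
apply: (@le_trans _ _ (Rintegral lebesgue_measure `]s, s + h]%classic (cst 1))).
  apply: le_Rintegral => //.
  - exact: integrableS (integrable_bump a b c0).
  - exact: integrable_cst_itv.
  - by move=> x _; exact: bump_le1.
rewrite Rintegral_cst//= mul1r lebesgue_measure_itv/= lte_fin.
by case: ifP => _ /=; rewrite ?h0// [s + h]addrC addrK.
Qed.

Lemma slab_eq0 h c a b s : 0 < c -> 0 <= h -> s \notin `]a - h, b[ ->
  slab h (bump c a b) s = 0.
Proof.
move=> c0 h0; rewrite in_itv/= negb_and -!leNgt => hs; rewrite slabE//.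
rewrite (@eq_Rintegral _ _ _ (@lebesgue_measure R) _ (cst 0)); first by rewrite Rintegral_cst// mul0r.
move=> x; rewrite inE/= in_itv/= => /andP[h1 h2]; apply: bump_eq0 => //.
by rewrite in_itv/= negb_and -!leNgt; case/orP: hs => h3; apply/orP; [left|right]; lra.
Qed.

Lemma slab_cvg h a b s : 0 <= h ->
  slab h (bump n.+1%:R a b) s @[n --> \oo] -->
  Rintegral lebesgue_measure `]s, s + h]%classic (\1_`]a, b[%classic : R -> R).
Proof.
move=> h0; under eq_fun do rewrite slabE//.
have [||||||_ hh] := @Rintegral_dominated_cvg _ _ _ (@lebesgue_measure R) `]s, s + h]%classic
  (fun n => bump n.+1%:R a b) (\1_`]a, b[%classic) (cst 1).
- exact: measurable_itv.
- by move=> n; apply: measurable_funTS; exact: measurable_bump.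
- exact: measurable_indic.
- by move=> x _; exact: bump_cvg.
- exact: integrable_cst_itv.
- by move=> n x _; rewrite ger0_norm ?bump_ge0// bump_le1.
exact: hh.
Qed.

End bumps.

(** * Translation estimate for functions of bounded variation *)

Section box_identity.
Context {R : realType} {d : nat}.
Local Notation E := 'rV[R]_d.
Local Notation mu := (lebesgue_rV R d).
Local Notation e_ j := (delta_mx ord0 j : E).

Lemma cvg_tensor (g_ : nat -> 'I_d -> R -> R) (g : 'I_d -> R -> R) (x : E) :
  (forall i, g_ n i (x ord0 i) @[n --> \oo] --> g i (x ord0 i)) ->
  tensor (g_ n) x @[n --> \oo] --> tensor g x.
Proof.
move=> h; rewrite /tensor; elim: (index_enum _) => [|i r IH].
  under eq_fun do rewrite big_nil.
  by rewrite big_nil; exact: cvg_cst.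
under eq_fun do rewrite big_cons.
by rewrite big_cons; exact: cvgM.
Qed.

Lemma indic_obox a b (x : E) : \1_(obox a b) x = tensor (fun i => \1_(`]a i, b i[%classic)) x :> R.
Proof.
rewrite indicE; have [/set_mem h|h] := boolP (x \in obox a b).
  by rewrite /tensor big1// => i _; rewrite indicE mem_set//; exact: (h i).
have [i hi] : exists i, x ord0 i \notin `]a i, b i[.
  apply/existsP; rewrite -negb_forall; apply: contra h => /forallP h.
  by apply/mem_set => i; exact: h.
rewrite /tensor (bigD1 i)//= indicE memNset ?mul0r//.
by move/negP : hi.
Qed.

Lemma tensor_bump_ge0 c a b (x : E) : 0 <= tensor (fun i => bump c (a i) (b i)) x.
Proof. by apply: prodr_ge0 => i _; exact: bump_ge0. Qed.

Lemma tensor_bump_le1 c a b (x : E) : tensor (fun i => bump c (a i) (b i)) x <= 1.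
Proof.
by apply: prodr_ile1 => i _; rewrite bump_ge0 bump_le1.
Qed.

Lemma tensor_bump_eq0 c a b (x : E) : 0 < c -> ~ obox a b x ->
  tensor (fun i => bump c (a i) (b i)) x = 0.
Proof.
move=> c0 h; have [i hi] : exists i, x ord0 i \notin `]a i, b i[.
  by apply/existsP; rewrite -negb_forall; apply/negP => /forallP.
by rewrite /tensor (bigD1 i)//= bump_eq0// mul0r.
Qed.

(* The [j]-th partial derivative of the tensor product of these functions is the
   increment, along [h *: e_ j], of the tensor product of the bumps. *)
Definition slabs (j : 'I_d) (h c : R) (a b : 'I_d -> R) : 'I_d -> R -> R :=
  fun i => if i == j then slab h (bump c (a i) (b i)) else bump c (a i) (b i).

(** Pointwise limits of [slabs] as the sharpness [c] grows; in direction [j] the factor is the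
    length of the part of []s, s + h]] that lies in the interval. *)
Definition slabs_lim (j : 'I_d) (h : R) (a b : 'I_d -> R) : 'I_d -> R -> R :=
  fun i => if i == j
    then fun s => Rintegral lebesgue_measure `]s, s + h]%classic (\1_`]a i, b i[%classic)
    else \1_(`]a i, b i[%classic).

Lemma slabs_ge0 j h c a b i s : 0 < c -> 0 <= h -> 0 <= slabs j h c a b i s.
Proof.
by move=> c0 h0; rewrite /slabs; case: eqP => _; rewrite ?slab_ge0 ?bump_ge0.
Qed.

Lemma tensor_slabs_le j h c a b x : 0 < c -> 0 <= h ->
  `|tensor (slabs j h c a b) x| <= h.
Proof.
move=> c0 h0; rewrite ger0_norm; last first.
  by apply: prodr_ge0 => i _; exact: slabs_ge0.
rewrite /tensor (bigD1 j)//= {1}/slabs eqxx -[leRHS]mulr1.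
apply: ler_pM; [exact: slab_ge0| |exact: slab_le|].
  by apply: prodr_ge0 => i _; exact: slabs_ge0.
apply: prodr_ile1 => i /negbTE ij; rewrite slabs_ge0//= /slabs ij.
exact: bump_le1.
Qed.

Lemma smooth1_slabs j h c a b i : 0 < c -> smooth1 (slabs j h c a b i).
Proof.
by move=> c0; rewrite /slabs; case: eqP => _; [exact: smooth1_slab|exact: smooth1_bump].
Qed.

(** The integral of a bump over a window of length [h] vanishes as soon as the window misses []a,
    b[], so passing to [slab] keeps the support compact, unlike passing to a primitive. *)
Lemma test_function_slabs j h c a b : 0 < c -> 0 <= h ->
  test_function (tensor (slabs j h c a b)).
Proof.
move=> c0 h0.
pose M := \sum_i (`|a i| + `|b i|) + h.
have aM i : `|a i| + h <= M /\ `|b i| <= M.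
  rewrite /M (bigD1 i)//=; have := normr_ge0 (a i); have := normr_ge0 (b i).
  have : 0 <= \sum_(k | k != i) (`|a k| + `|b k|) by apply: sumr_ge0 => k _; rewrite addr_ge0.
  by split; lra.
apply: (@test_function_tensor _ _ _ M); first by move=> i; exact: smooth1_slabs.
move=> i s si; have [h1 h2] := aM i.
have : s \in `]a i - h, b i[.
  apply: contraNT si; rewrite /slabs; case: ifP => _ hs; apply/eqP.
    exact: slab_eq0.
  apply: bump_eq0 => //; apply: contra hs; rewrite !in_itv/= => /andP[h3 ->].
  by rewrite andbT; lra.
rewrite in_itv/= => /andP[h3 h4]; have := ler_norm (b i); have := ler_norm (- a i).
rewrite normrN => h5 h6; apply/andP; split; lra.
Qed.

Lemma derive_tensor_slabs j h c a b (x : E) : 0 < c ->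
  'D_(e_ j) (tensor (slabs j h c a b)) x =
  tensor (fun i => bump c (a i) (b i)) (h *: e_ j + x) -
  tensor (fun i => bump c (a i) (b i)) x.
Proof.
move=> c0.
have ds i y : derivable (slabs j h c a b i) y 1.
  exact: (@smooth1_derivable _ _ 0 y (smooth1_slabs j h a b i c0)).
have [_ ->] := is_derive_tensor j x ds.
rewrite /tensor (bigD1 j)//= eqxx [X in _ = X - _](bigD1 j)//= [X in _ = _ - X](bigD1 j)//=.
rewrite coord_line eqxx mulr1 {1}/slabs eqxx derive1_slab// [h + _]addrC.
rewrite mulrBl; congr (_ * _ - _ * _); apply: eq_bigr => i ij.
  by rewrite (negbTE ij) /slabs (negbTE ij) coord_line (negbTE ij) mulr0 add0r.
by rewrite (negbTE ij) /slabs (negbTE ij).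
Qed.

(** [pi_] and [eta_] will be the positive and negative Jordan parts of one real component of the
    gradient; the order [eta_] minus [pi_] is the sign of the integration by parts. *)
Variables (f : E -> R) (j : 'I_d) (pi_ eta_ : {finite_measure set E -> \bar R}).
Hypothesis mf : measurable_fun setT f.
Hypothesis lf : forall N, mu.-integrable (nbox N) (EFin \o f).
Hypothesis gradf : forall phi, test_function phi ->
  Rintegral mu setT (fun x => f x * 'D_(e_ j) phi x) =
  Rintegral eta_ setT phi - Rintegral pi_ setT phi.

Lemma obox_nbox a b h : exists N, forall x, obox a b x \/ obox a b (h *: e_ j + x) -> nbox N x.
Proof.
pose M := \sum_i (`|a i| + `|b i|) + `|h|.
have M0 : 0 <= M by rewrite addr_ge0// sumr_ge0// => k _; rewrite addr_ge0.
exists (Num.bound M) => x hx; apply/nboxP => i.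
apply: (@le_lt_trans _ _ M); last by have := archi_boundP M0.
have h1 : `|a i| + `|b i| + `|h| <= M.
  rewrite /M (bigD1 i)//=.
  have : 0 <= \sum_(k | k != i) (`|a k| + `|b k|) by apply: sumr_ge0 => k _; rewrite addr_ge0.
  by lra.
have := ler_norm (b i); have := ler_norm (- a i); rewrite normrN => h5 h6.
have := ler_norm h; have := ler_norm (- h); rewrite normrN => h7 h8.
have h9 := normr_ge0 (a i); have h10 := normr_ge0 (b i).
rewrite ler_norml; case: hx => /(_ i).
  by rewrite in_itv/= => /andP[h3 h4]; apply/andP; split; lra.
rewrite in_itv/= coord_line; case: (i == j); rewrite ?mulr1 ?mulr0 ?add0r.
  by move=> /andP[h3 h4]; apply/andP; split; lra.
by move=> /andP[h3 h4]; apply/andP; split; lra.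
Qed.

(** The gradient identity is applied to [slabs] of sharpness [n + 1] and the limit is taken on both
    sides by dominated convergence: locally on the left, and with the constant bound [h] on the
    right, where the measures are finite. *)
Lemma box_Rintegral a b h : 0 <= h ->
  mu.-integrable setT (fun x => (f x * (\1_(obox a b) (h *: e_ j + x) - \1_(obox a b) x))%:E) /\
  Rintegral mu setT (fun x => f x * (\1_(obox a b) (h *: e_ j + x) - \1_(obox a b) x)) =
  Rintegral eta_ setT (tensor (slabs_lim j h a b)) -
  Rintegral pi_ setT (tensor (slabs_lim j h a b)).
Proof.
move=> h0; have [N hN] := obox_nbox a b h.
have mt (g : 'I_d -> R -> R) : (forall i, measurable_fun setT (g i)) ->
    measurable_fun setT (tensor g) by exact: measurable_prod_coord.
have mb n : measurable_fun setT (tensor (fun i => bump n.+1%:R (a i) (b i)) : E -> R).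
  by apply: mt => i; exact: measurable_bump.
have mi : measurable_fun setT (\1_(obox a b) : E -> R).
  by apply: measurable_indic; exact: measurable_obox.
have cb x : tensor (fun i => bump n.+1%:R (a i) (b i)) x @[n --> \oo] --> (\1_(obox a b) x : R).
  by rewrite indic_obox; apply: cvg_tensor => i; exact: bump_cvg.
(* Two bump products, each at most 1, both vanish off [nbox N], which contains the box and its
   translate. *)
pose g x := 2 * `|f x| * \1_(nbox N) x.
have ig : mu.-integrable setT (EFin \o g).
  have -> : EFin \o g = (EFin \o (fun x => 2 * `|f x|)) \_ (nbox N).
    apply/funext => x; rewrite /g /patch /= indicE.
    by case: ifPn => hx; rewrite ?mulr1 ?mulr0.
  apply/integrable_restrict => //; first exact: measurable_nbox.
  rewrite setTI; have := integrableZl (measurable_nbox N) 2 (integrable_norm (lf N)).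
  by [].
pose F n x := f x * (tensor (fun i => bump n.+1%:R (a i) (b i)) (h *: e_ j + x) -
  tensor (fun i => bump n.+1%:R (a i) (b i)) x).
pose Fl x := f x * (\1_(obox a b) (h *: e_ j + x) - \1_(obox a b) x).
have [||||||iF cF] := @Rintegral_dominated_cvg _ _ _ mu setT F Fl g.
- exact: measurableT.
- move=> n; apply: measurable_funM => //; apply: measurable_funB => //.
  by apply: measurableT_comp => //; exact: measurable_addlV.
- apply: measurable_funM => //; apply: measurable_funB => //.
  by apply: measurableT_comp => //; exact: measurable_addlV.
- by move=> x _; apply: cvgM; [exact: cvg_cst|apply: cvgB; exact: cb].
- exact: ig.
- move=> n x _; rewrite /F /g normrM mulrAC [leRHS]mulrC ler_wpM2l//.
  rewrite indicE; have [hx|hx] := pselect (nbox N x).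
    rewrite mem_set// mulr1; apply: le_trans (ler_normB _ _) _.
    rewrite !ger0_norm ?tensor_bump_ge0//.
    by rewrite (_ : 2 = 1 + 1)//; apply: lerD; exact: tensor_bump_le1.
  rewrite memNset// mulr0 !tensor_bump_eq0 ?subrr ?normr0//.
    by move=> h1; apply: hx; apply: hN; left.
  by move=> h1; apply: hx; apply: hN; right.
split; first exact: iF.
have cS x : tensor (slabs j h n.+1%:R a b) x @[n --> \oo] --> tensor (slabs_lim j h a b) x.
  apply: cvg_tensor => i; rewrite /slabs /slabs_lim; case: eqP => _; last exact: bump_cvg.
  exact: slab_cvg.
have mS n : measurable_fun setT (tensor (slabs j h n.+1%:R a b)).
  apply: mt => i; apply: continuous_measurable_fun => y.
  apply/differentiable_continuous/derivable1_diffP.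
  exact: (@smooth1_derivable _ _ 0 y (smooth1_slabs j h a b i _)).
have mSl : measurable_fun setT (tensor (slabs_lim j h a b)).
  by apply: (@measurable_fun_cvg _ _ _ setT (fun n => tensor (slabs j h n.+1%:R a b))).
have cm (m : {finite_measure set E -> \bar R}) :
    Rintegral m setT (tensor (slabs j h n.+1%:R a b)) @[n --> \oo] -->
    Rintegral m setT (tensor (slabs_lim j h a b)).
  have [||||||_ hh] := @Rintegral_dominated_cvg _ _ _ m setT
    (fun n => tensor (slabs j h n.+1%:R a b)) (tensor (slabs_lim j h a b)) (cst h).
  - exact: measurableT.
  - by [].
  - by [].
  - by move=> x _; exact: cS.
  - by apply: finite_measure_integrable_cst.
  - by move=> n x _; exact: tensor_slabs_le.
  exact: hh.
have c2 := cvgB (cm eta_) (cm pi_).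
have e : (fun n => Rintegral mu setT (F n)) = (fun n =>
    Rintegral eta_ setT (tensor (slabs j h n.+1%:R a b))) -
    (fun n => Rintegral pi_ setT (tensor (slabs j h n.+1%:R a b))).
  apply/funext => n; transitivity (Rintegral eta_ setT (tensor (slabs j h n.+1%:R a b)) -
    Rintegral pi_ setT (tensor (slabs j h n.+1%:R a b))); last by [].
  rewrite -(gradf (test_function_slabs j a b _ h0))//.
  by apply: eq_Rintegral => x _; rewrite derive_tensor_slabs.
rewrite e in cF.
by rewrite -(cvg_lim (@Rhausdorff R) (c2 _)) -(cvg_lim (@Rhausdorff R) cF).
Qed.

End box_identity.

Lemma lebesgue_measureD (R : realType) (v : R) (A : set R) : measurable A ->
  (@lebesgue_measure R) ((fun x : R => x + v) @^-1` A) = (@lebesgue_measure R) A.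
Proof.
move=> mA.
have mv : measurable_fun setT ((fun x : R => x + v) : R -> measurableTypeR R).
  exact: measurable_funD.
suff : pushforward (@lebesgue_measure R) ((fun x => x + v) : _ -> measurableTypeR R) A =
  (@lebesgue_measure R) A by [].
apply/esym/lebesgue_measure_unique => //= _ [[a b]] _ <-.
rewrite /pushforward/=.
rewrite [X in _ = lebesgue_measure X](_ : _ = `]a - v, b - v]%classic); last first.
  by apply/seteqP; split => x /=; rewrite !in_itv/= ltrBlDr lerBrDr.
by rewrite !lebesgue_measure_itv/= !lte_fin ltrD2r -!EFinB opprB addrA subrK.
Qed.

(** * Densities and measures swept along a direction *)

Section density.
Context dd (T : measurableType dd) {R : realType} (m : {measure set T -> \bar R}).

(** The proofs [mg] and [g0] are carried by the term so that its measure structure can be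
    inferred. *)
Definition density (g : T -> R) (mg : measurable_fun setT g) (g0 : forall x, 0 <= g x)
  (A : set T) : \bar R := (\int[m]_(x in A) (g x)%:E)%E.

Variables (g : T -> R) (mg : measurable_fun setT g) (g0 : forall x, 0 <= g x).

Let density_set0 : density mg g0 set0 = 0%E.
Proof. exact: integral_set0. Qed.

Let density_ge0 A : (0 <= density mg g0 A)%E.
Proof. by apply: integral_ge0 => x _; rewrite lee_fin. Qed.

Let density_sigma_additive : semi_sigma_additive (density mg g0).
Proof.
apply: semi_sigma_additive_nng_induced; first exact/measurable_EFinP.
by move=> x; rewrite lee_fin.
Qed.

HB.instance Definition _ := isMeasure.Build _ _ _ (density mg g0)
  density_set0 density_ge0 density_sigma_additive.

End density.

Section shear.
Context {R : realType} {d : nat}.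
Local Notation E := 'rV[R]_d.
Local Notation e_ j := (delta_mx ord0 j : E).
Variables (m : {finite_measure set E -> \bar R}) (j : 'I_d) (h : R).

Definition shear (z : E * R) : E := z.2 *: e_ j + z.1.

Lemma measurable_shear : measurable_fun setT shear.
Proof.
apply: measurable_fun_rV => i; rewrite /shear.
under eq_fun do rewrite !mxE.
apply: measurable_funD; last exact: (measurableT_comp (measurable_coord i) measurable_fst).
by apply: measurable_funM => //; exact: measurable_snd.
Qed.

Definition shear_dom : set (E * R) := setT `*` `]0, h]%classic.

Lemma measurable_shear_dom : measurable shear_dom.
Proof. by apply: measurableX => //; exact: measurable_itv. Qed.

(* [swept A] is the integral over [0 < r <= h] of [m (A - r *: e_ j)]. *)
Definition swept (A : set E) : \bar R :=
  mrestr (m \x @lebesgue_measure R)%E measurable_shear_dom (shear @^-1` A).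

Lemma sweptE A : swept A =
  (m \x @lebesgue_measure R)%E (shear @^-1` A `&` shear_dom).
Proof. by []. Qed.

Let swept0 : swept set0 = 0%E.
Proof. by rewrite /swept preimage_set0 measure0. Qed.

Let swept_ge0 A : (0 <= swept A)%E.
Proof. exact: measure_ge0. Qed.

Let swept_sigma_additive : semi_sigma_additive swept.
Proof.
move=> F mF tF mUF; rewrite /swept preimage_bigcup.
have mpre A : measurable A -> measurable (shear @^-1` A).
  by move=> mA; rewrite -[X in measurable X]setTI; exact: measurable_shear.
apply: measure_semi_sigma_additive => [k| |]; first exact: mpre.
  apply/trivIsetP => /= i k _ _ ik; rewrite -preimage_setI.
  by move/trivIsetP : tF => /(_ _ _ _ _ ik) ->//; rewrite preimage_set0.
by rewrite -preimage_bigcup; exact: mpre.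
Qed.

HB.instance Definition _ := isMeasure.Build _ _ _ swept
  swept0 swept_ge0 swept_sigma_additive.

Lemma swept_le A : measurable A -> 0 <= h -> (swept A <= h%:E * m setT)%E.
Proof.
move=> mA h0; rewrite sweptE.
have -> : (h%:E * m setT)%E = (m \x @lebesgue_measure R)%E shear_dom.
  rewrite product_measure1E//.
  rewrite muleC; congr (_ * _)%E.
  have := @lebesgue_measure_itv R `]0, h]; rewrite /= => ->.
  rewrite lte_fin; case: ltP => h1; first by rewrite sube0.
  by have -> : h = 0 by apply/eqP; rewrite eq_le h0 h1.
apply: le_measure; rewrite ?inE.
- apply: measurableI; last exact: measurable_shear_dom.
  by rewrite -[X in measurable X]setTI; exact: measurable_shear.
- exact: measurable_shear_dom.
- by move=> z [].
Qed.

(** For fixed [x] whose other coordinates lie in their intervals, the admissible displacements are,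
    up to a translation by [x_j], the intersection of []x_j, x_j + h]] with []a_j, b_j[]; otherwise
    there are none. The length of this section is the value of the limit tensor. *)
Lemma swept_obox a b : 0 <= h ->
  swept (obox a b) = (\int[m]_x (tensor (slabs_lim j h a b) x)%:E)%E.
Proof.
move=> h0; rewrite sweptE /product_measure1; apply: eq_integral => x _ /=.
rewrite /tensor (bigD1 j)//= {1}/slabs_lim eqxx.
have -> : \prod_(i < d | i != j) slabs_lim j h a b i (x ord0 i) =
    \prod_(i < d | i != j) \1_(`]a i, b i[%classic) (x ord0 i) :> R.
  by apply: eq_bigr => i /negbTE ij; rewrite /slabs_lim ij.
have [hx|hx] := pselect (forall i, i != j -> x ord0 i \in `]a i, b i[); last first.
  have [i ij hi] : exists2 i, i != j & x ord0 i \notin `]a i, b i[.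
    apply: contrapT => hn; apply: hx => i ij; apply: contrapT => hi.
    by apply: hn; exists i => //; apply/negP.
  rewrite [X in _ = (_ * X)%:E](bigD1 i)//= indicE memNset; last by move/negP: hi.
  rewrite mul0r mulr0 (_ : xsection _ _ = set0) ?measure0//.
  apply/seteqP; split => // r; rewrite /xsection/= inE => -[/= /(_ i)].
  by rewrite /shear coord_line (negbTE ij) mulr0 add0r (negbTE hi).
rewrite big1 ?mulr1; last by move=> i ij; rewrite indicE mem_set//; exact: hx.
have mI : measurable (`]x ord0 j, x ord0 j + h]%classic `&` `]a j, b j[%classic).
  by apply: measurableI; exact: measurable_itv.
have -> : xsection (shear @^-1` obox a b `&` shear_dom) x =
    (fun r : R => r + x ord0 j) @^-1`
      (`]x ord0 j, x ord0 j + h]%classic `&` `]a j, b j[%classic).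
  apply/seteqP; split => r; rewrite /xsection/= inE.
    move=> [/= /(_ j)]; rewrite /shear coord_line eqxx mulr1 /= => h1 [_ /=].
    rewrite !in_itv/= => /andP[h2 h3]; split; last by move: h1; rewrite in_itv.
    by apply/andP; split; lra.
  rewrite !in_itv/= => -[/andP[h1 h2] h3]; split => /=.
    move=> i; rewrite /shear coord_line; have [->|ij] := eqVneq i j.
      by rewrite mulr1 in_itv.
    by rewrite mulr0 add0r; exact: hx.
  by split => //=; rewrite ?in_itv/=; apply/andP; split; lra.
have := lebesgue_measureD (x ord0 j) mI; rewrite /= => ->.
rewrite /Rintegral integral_indic//; try exact: measurable_itv.
rewrite setIC fineK//.
have hf : ((@lebesgue_measure R) (`]x ord0 j, x ord0 j + h]%classic)%R < +oo)%E.
  have := @lebesgue_measure_itv R `](x ord0 j), (x ord0 j + h)]; rewrite /= => ->.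
  by case: ifP => _; rewrite ?ltry.
rewrite ge0_fin_numE//; apply: le_lt_trans hf.
apply: le_measure; rewrite ?inE; [by rewrite setIC| |by move=> ? []].
exact: (measurable_itv `]x ord0 j, (x ord0 j + h)]).
Qed.

End shear.

(** * Increments as differences of swept measures *)

Section translation_bound.
Context {R : realType} {d : nat}.
Local Notation E := 'rV[R]_d.
Local Notation mu := (lebesgue_rV R d).
Local Notation e_ j := (delta_mx ord0 j : E).

Lemma integrable_rVD (v : E) (g : E -> R) :
  mu.-integrable setT (EFin \o g) ->
  mu.-integrable setT (EFin \o (fun x => g (x + v))).
Proof.
move=> /integrableP[/measurable_EFinP mg ig].
have mv := measurable_addrV v.
apply/integrableP; split.
  by apply/measurable_EFinP; exact: (measurableT_comp mg mv).
have mn : measurable_fun setT (fun x => `|(EFin \o g) x|%E).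
  by apply: measurableT_comp => //; exact/measurable_EFinP.
by rewrite -(ge0_integral_rVD v mn (fun x => abse_ge0 _)) in ig.
Qed.

Variables (f : E -> R) (j : 'I_d) (pi_ eta_ : {finite_measure set E -> \bar R}).
Hypothesis mf : measurable_fun setT f.
Hypothesis lf : forall N, mu.-integrable (nbox N) (EFin \o f).
Hypothesis gradf : forall phi, test_function phi ->
  Rintegral mu setT (fun x => f x * 'D_(e_ j) phi x) =
  Rintegral eta_ setT phi - Rintegral pi_ setT phi.

Lemma integrable_mul_indic (B : set E) N : measurable B -> B `<=` nbox N ->
  mu.-integrable setT (EFin \o (fun x => f x * \1_B x)).
Proof.
move=> mB BN.
have -> : EFin \o (fun x => f x * \1_B x) = (EFin \o f) \_ B.
  apply/funext => x; rewrite /patch /= indicE.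
  by case: ifPn => _; rewrite ?mulr1 ?mulr0.
apply/integrable_restrict => //; rewrite setTI.
by apply: integrableS (lf N) => //; exact: measurable_nbox.
Qed.

Variable h : R.
Hypothesis h0 : 0 <= h.
Let v : E := h *: e_ j.
(** The shift is by [-v]: a change of variables carries the translate [x + v] from the indicator of
    the box to [f (x - v)]. *)
Let w (x : E) : R := f (x - v) - f x.
Let wp x := Num.max (w x) 0.
Let wn x := Num.max (- w x) 0.

Let mw : measurable_fun setT w.
Proof.
by apply: measurable_funB => //; exact: (measurableT_comp mf (measurable_addrV _)).
Qed.

Let mwp : measurable_fun setT wp.
Proof. exact: measurable_maxr. Qed.

Let mwn : measurable_fun setT wn.
Proof. by apply: measurable_maxr => //; exact: measurableT_comp. Qed.

Let wp0 x : 0 <= wp x. Proof. by rewrite le_max lexx orbT. Qed.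
Let wn0 x : 0 <= wn x. Proof. by rewrite le_max lexx orbT. Qed.

Let integrable_w a b : mu.-integrable (obox a b) (EFin \o w) /\
  Rintegral mu (obox a b) w =
  Rintegral eta_ setT (tensor (slabs_lim j h a b)) -
  Rintegral pi_ setT (tensor (slabs_lim j h a b)).
Proof.
set A := obox a b; have mA : measurable A by exact: measurable_obox.
have [N hN] := @obox_nbox R d j a b h.
pose B := (fun x : E => v + x) @^-1` A.
have mB : measurable B.
  by rewrite -[X in measurable X]setTI; exact: measurable_addlV.
have iA : mu.-integrable setT (EFin \o (fun x => f x * \1_A x)).
  by apply: (@integrable_mul_indic _ N) => // x Ax; apply: hN; left.
have iB : mu.-integrable setT (EFin \o (fun x => f x * \1_B x)).
  by apply: (@integrable_mul_indic _ N) => // x Ax; apply: hN; right.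
have eB x : \1_A (v + x) = \1_B x :> R by rewrite !indicE.
have eS : (fun x => f (x - v) * \1_B (x - v)) = (fun x => f (x - v) * \1_A x).
  by apply/funext => x; rewrite -eB [v + _]addrC subrK.
have iS : mu.-integrable setT (EFin \o (fun x => f (x - v) * \1_A x)).
  by rewrite -eS; exact: (integrable_rVD (- v) iB).
have eW : (EFin \o w) \_ A = (fun x => (f (x - v) * \1_A x)%:E - (f x * \1_A x)%:E)%E.
  apply/funext => x; rewrite /patch /w/= indicE.
  by case: ifPn => _; rewrite ?mulr1 ?mulr0 -EFinB ?subr0.
have iw : mu.-integrable A (EFin \o w).
  by rewrite -(setTI A); apply/integrable_restrict => //; rewrite eW; exact: integrableB.
split => //.
have [_ <-] := box_Rintegral mf lf gradf a b h0.
rewrite -/A -/v.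
transitivity (Rintegral mu setT (fun x => f x * \1_B x) - Rintegral mu setT (fun x => f x * \1_A x)).
  rewrite -(Rintegral_rVD (- v)); last first.
    by apply: measurable_funM => //; exact: measurable_indic.
  rewrite eS -RintegralB// Rintegral_mkcond.
  apply: eq_Rintegral => x _; rewrite /patch /w indicE.
  by case: ifPn => _; rewrite ?mulr1 ?mulr0 ?subr0.
rewrite -RintegralB//; apply: eq_Rintegral => x _.
by rewrite mulrBr eB.
Qed.

Let fin_swept (m : {finite_measure set E -> \bar R}) A : measurable A ->
  swept m j h A \is a fin_num.
Proof.
move=> mA; rewrite ge0_fin_numE; last exact: measure_ge0.
apply: le_lt_trans (swept_le _ _ mA h0) _.
by rewrite lte_mul_pinfty// -ge0_fin_numE// fin_num_measure.
Qed.

Let wE A : (\int[mu]_(x in A) (EFin \o w)^\+ x = density mu mwp wp0 A)%E /\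
  (\int[mu]_(x in A) (EFin \o w)^\- x = density mu mwn wn0 A)%E.
Proof.
by split; apply: eq_integral => x _; rewrite ?funeposE ?funenegE /= ?EFin_max.
Qed.

Let fin_density a b : density mu mwp wp0 (obox a b) \is a fin_num /\
  density mu mwn wn0 (obox a b) \is a fin_num.
Proof.
have [iw _] := integrable_w a b.
have mA := measurable_obox a b.
have [<- <-] := wE (obox a b); split; apply: integrable_fin_num => //.
  exact: integrable_funepos.
exact: integrable_funeneg.
Qed.

(** At this stage [w] is only integrable on boxes, so [w dx] is no finite signed measure. The
    identity [w dx = swept eta_ - swept pi_] is therefore stated between positive measures, with the
    negative terms on the other side. *)
Let m1 : {measure set E -> \bar R} := measure_add (density mu mwp wp0) (swept pi_ j h).
Let m2 : {measure set E -> \bar R} := measure_add (density mu mwn wn0) (swept eta_ j h).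

Let m1E A : m1 A = (density mu mwp wp0 A + swept pi_ j h A)%E.
Proof. exact: measure_addE. Qed.

Let m2E A : m2 A = (density mu mwn wn0 A + swept eta_ j h A)%E.
Proof. exact: measure_addE. Qed.

Let m1m2_obox a b : m1 (obox a b) = m2 (obox a b).
Proof.
have [_ iw] := integrable_w a b; have [f1 f2] := fin_density a b.
have mA := measurable_obox a b.
have f3 := fin_swept pi_ mA; have f4 := fin_swept eta_ mA.
rewrite m1E m2E; move: iw; rewrite /Rintegral.
rewrite -!swept_obox// integralE; have [-> ->] := wE (obox a b).
rewrite -(fineK f1) -(fineK f2) -(fineK f3) -(fineK f4) -!EFinD.
by move=> /= e; congr (_%:E); lra.
Qed.

Let m1m2 A : measurable A -> m1 A = m2 A.
Proof.
apply: obox_measure_unique; first exact: m1m2_obox.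
move=> N; rewrite m1E lte_add_pinfty//.
  by have [f1 _] := fin_density (fun=> - N%:R) (fun=> N%:R); rewrite -ge0_fin_numE.
by rewrite -ge0_fin_numE//; apply: fin_swept; exact: measurable_nbox.
Qed.

(** Evaluated on [{w > 0}], where the negative part vanishes, the equality of [m1] and [m2] leaves
    the integral of the positive part bounded by the mass of [swept eta_]. *)
Let wp_le : (\int[mu]_x (wp x)%:E <= h%:E * eta_ setT)%E.
Proof.
pose A := [set x | 0 < w x].
have mA : measurable A.
  by rewrite -[X in measurable X]setTI; apply: measurable_fun_ltr => //.
have -> : (\int[mu]_x (wp x)%:E = density mu mwp wp0 A)%E.
  rewrite /density integral_mkcond; apply: eq_integral => x _.
  rewrite /patch; case: ifPn => //; rewrite notin_setE /A/= => /negP.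
  by rewrite -leNgt /wp => hx; rewrite max_r.
have := m1m2 mA; rewrite m1E m2E.
have -> : density mu mwn wn0 A = 0%E.
  rewrite /density (eq_integral (cst 0%E)); first exact: integral0.
  by move=> x; rewrite inE /A/= => hx; rewrite /wn max_r// oppr_le0 ltW.
rewrite add0e => e.
apply: (@le_trans _ _ (swept eta_ j h A)); last exact: swept_le.
by rewrite -e leeDl.
Qed.

Let wn_le : (\int[mu]_x (wn x)%:E <= h%:E * pi_ setT)%E.
Proof.
pose A := [set x | w x < 0].
have mA : measurable A.
  by rewrite -[X in measurable X]setTI; apply: measurable_fun_ltr => //.
have -> : (\int[mu]_x (wn x)%:E = density mu mwn wn0 A)%E.
  rewrite /density integral_mkcond; apply: eq_integral => x _.
  rewrite /patch; case: ifPn => //; rewrite notin_setE /A/= => /negP.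
  by rewrite -leNgt /wn => hx; rewrite max_r// oppr_le0.
have := m1m2 mA; rewrite m1E m2E.
have -> : density mu mwp wp0 A = 0%E.
  rewrite /density (eq_integral (cst 0%E)); first exact: integral0.
  by move=> x; rewrite inE /A/= => hx; rewrite /wp max_r// ltW.
rewrite add0e => e.
apply: (@le_trans _ _ (swept pi_ j h A)); last exact: swept_le.
by rewrite e leeDl.
Qed.

Lemma translation_L1 :
  (\int[mu]_x `|f (x + h *: e_ j)%R - f x|%:E <= h%:E * (pi_ setT + eta_ setT))%E.
Proof.
have mn : measurable_fun setT (fun x : E => `|f (x + h *: e_ j)%R - f x|%:E).
  apply/measurable_EFinP; apply: measurableT_comp => //; apply: measurable_funB => //.
  exact: (measurableT_comp mf (measurable_addrV _)).
rewrite -(ge0_integral_rVD (- v) mn)//.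
apply: (@le_trans _ _ (\int[mu]_x ((wp x)%:E + (wn x)%:E))%E).
  apply: ge0_le_integral => //.
  - exact: (measurableT_comp mn (measurable_addrV (- v))).
  - by apply: emeasurable_funD; exact/measurable_EFinP.
  - move=> x _; rewrite -EFinD lee_fin /v subrK distrC -/(w x) /wp /wn.
    have p1 := wp0 x; have p2 := wn0 x.
    have p3 : w x <= wp x by rewrite le_max lexx.
    have p4 : - w x <= wn x by rewrite le_max lexx.
    by rewrite -/(wp x) -/(wn x) ler_norml; apply/andP; split; lra.
rewrite ge0_integralD//; last first.
- exact/measurable_EFinP.
- by move=> x _; rewrite lee_fin.
- exact/measurable_EFinP.
- by move=> x _; rewrite lee_fin.
rewrite ge0_muleDr//; rewrite addeC; apply: leeD; [exact: wn_le|exact: wp_le].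
Qed.

End translation_bound.

(** * Gaussian integrability from integrable increments *)

Section growth.
Context {R : realType} {d : nat}.
Local Notation E := 'rV[R]_d.
Local Notation mu := (lebesgue_rV R d).
Local Notation e_ j := (delta_mx ord0 j : E).

Variables (f : E -> R) (V : R).
Hypothesis mf : measurable_fun setT f.
Hypothesis V0 : 0 <= V.
Hypothesis fV : forall j h, 0 <= h ->
  (\int[mu]_x `|f (x + h *: e_ j)%R - f x|%:E <= (h * V)%:E)%E.

Let mdiff (u v : E) : measurable_fun setT (fun x : E => `|f (x + u)%R - f (x + v)%R|%:E).
Proof.
apply/measurable_EFinP; apply: measurableT_comp => //; apply: measurable_funB.
  exact: (measurableT_comp mf (measurable_addrV _)).
exact: (measurableT_comp mf (measurable_addrV _)).
Qed.

Let shift_diff (u v : E) :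
  (\int[mu]_x `|f (x + u)%R - f (x + v)%R|%:E =
   \int[mu]_x `|f (x + (u - v))%R - f x|%:E)%E.
Proof.
rewrite -(ge0_integral_rVD (- v) (mdiff u v))//.
by apply: eq_integral => x _; rewrite subrK -addrA [- v + u]addrC.
Qed.

(** The vector is travelled along the coordinate axes one after the other; a negative displacement
    is a positive one seen from its endpoint. *)
Lemma translation_L1_vector (r : E) :
  (\int[mu]_x `|f (x + r)%R - f x|%:E <= ((\sum_j `|r ord0 j|) * V)%:E)%E.
Proof.
have coord j (h : R) :
    (\int[mu]_x `|f (x + h *: e_ j)%R - f x|%:E <= (`|h| * V)%:E)%E.
  have [h0|h0] := leP 0 h; first by rewrite (ger0_norm h0); exact: fV.
  have h1 : 0 <= - h by lra.
  rewrite (ltr0_norm h0); have := fV j h1; rewrite scaleNr.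
  have := shift_diff 0 (h *: e_ j); rewrite sub0r => <-.
  by under eq_integral do rewrite addr0 distrC.
rewrite {1}(_ : r = \sum_j r ord0 j *: e_ j); last first.
  by rewrite {1}[r]row_sum_delta.
elim: (index_enum _) => [|j s IH].
  rewrite !big_nil mul0r (eq_integral (cst 0%E)) ?integral0//.
  by move=> x _; rewrite addr0 subrr normr0.
rewrite !big_cons; set u := _ *: _; set w := \sum_(i <- s) _ *: _.
apply: (@le_trans _ _ (\int[mu]_x (`|f (x + (u + w))%R - f (x + w)%R|%:E + `|f (x + w)%R - f (x + 0)%R|%:E))%E).
  apply: ge0_le_integral => //.
  - by have := mdiff (u + w) 0; under eq_fun do rewrite addr0.
  - by apply: emeasurable_funD; exact: mdiff.
  - move=> x _; rewrite -EFinD lee_fin addr0; apply: le_trans (ler_normD _ _).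
    by rewrite [X in _ <= `|X|]addrA subrK.
rewrite ge0_integralD//.
rewrite mulrDl EFinD; apply: leeD; first by rewrite shift_diff addrK; exact: coord.
by rewrite shift_diff subr0.
Qed.

Lemma lebesgue_nbox1 : lebesgue_rV R d (nbox 1) = (2 ^+ d)%:E.
Proof.
rewrite lebesgue_obox (eq_bigr (fun=> 2%:E)).
  by rewrite prodEFin prodr_const card_ord.
move=> i _; have := @lebesgue_measure_itv R `](- 1%:R), 1%:R[; rewrite /= => ->.
rewrite ifT ?lte_fin; last by lra.
by rewrite -EFinB; congr (_%:E); lra.
Qed.

Hypothesis lf : (\int[mu]_(x in nbox 1) `|f x|%:E < +oo)%E.

(** The double integral of [G] is computed in both orders. Integrating over [r] gives the wanted
    integral times the volume [2^d] of the box. Integrating over [x] in the box for fixed [r]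
    compares [f (x + r)] with [f x], at a cost linear in [r], while the weight decays like a
    Gaussian in [r]. *)
Lemma gauss_integrable_translation : gauss_integrable f.
Proof.
split => // a a0.
pose w (x : E) := expR (- a * sqn x).
have mw : measurable_fun setT w by exact: measurable_gauss.
pose G (z : E * E) := (\1_(nbox 1) z.1 * (`|f (z.1 + z.2)%R| * w (z.1 + z.2)%R))%:E.
have mS : measurable_fun setT (fun z : E * E => z.1 + z.2).
  apply: measurable_fun_rV => i; under eq_fun do rewrite mxE.
  apply: measurable_funD.
    exact: (measurableT_comp (measurable_coord i) measurable_fst).
  exact: (measurableT_comp (measurable_coord i) measurable_snd).
have mI : measurable_fun setT (\1_(nbox 1) : E -> R).
  by apply: measurable_indic; exact: measurable_nbox.
have mfw : measurable_fun setT (fun x => (`|f x| * w x)).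
  by apply: measurable_funM => //; exact: measurableT_comp.
have mG : measurable_fun setT G.
  apply/measurable_EFinP; apply: measurable_funM.
    exact: (measurableT_comp mI measurable_fst).
  exact: (measurableT_comp mfw mS).
have w0 x : 0 <= w x by exact: expR_ge0.
have G0 z : (0 <= G z)%E by rewrite lee_fin !mulr_ge0.
have mfwE : measurable_fun setT (fun x => (`|f x| * w x)%:E) by exact/measurable_EFinP.
have e1 : (\int[mu]_x \int[mu]_r G (x, r) = (2 ^+ d)%:E * \int[mu]_x (`|f x| * w x)%:E)%E.
  rewrite -lebesgue_nbox1 -[X in (lebesgue_rV R d X * _)%E]setIT -integral_indic//; last exact: measurable_nbox.
  rewrite -ge0_integralZr//; last 2 first.
  - exact/measurable_EFinP.
  - by apply: integral_ge0 => x _; rewrite lee_fin mulr_ge0.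
  apply: eq_integral => x _; rewrite /G /=.
  have e3 : (\int[mu]_r (`|f (x + r)%R| * w (x + r)%R)%:E = \int[mu]_x (`|f x| * w x)%:E)%E.
    rewrite -(ge0_integral_rVD x mfwE); last by move=> r; rewrite lee_fin mulr_ge0.
    by apply: eq_integral => r _; rewrite addrC.
  rewrite -e3; apply: ge0_integralZl_real => //.
    by apply: (measurableT_comp mfw); exact: measurable_addlV.
  by move=> r; rewrite mulr_ge0.
have F0 : (0 <= \int[mu]_(x in nbox 1) `|f x|%:E)%E.
  by apply: integral_ge0 => z _; rewrite lee_fin.
have lf' := lf; set F := (\int[mu]_(x in nbox 1) `|f x|%:E)%E in lf' F0.
have Ff : F \is a fin_num by rewrite ge0_fin_numE.
pose B := fine F + V * d%:R.
have B0 : 0 <= B by rewrite addr_ge0 ?mulr_ge0 ?fine_ge0.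
(* For [x] in the box [sqn x <= d], so the weight at [x + r] is at most
   [exp (a d) exp (- (a / 2) sqn r)]. Half of this Gaussian absorbs the polynomial growth through
   [sqn r * exp (- sqn r / (4 / a)) <= 4 / a]; the other half is the one in the bound. *)
have e2 (r : E) : (\int[mu]_x G (x, r) <=
    (expR (a * d%:R) * (B + V * (4 / a)) * expR (- (a / 4) * sqn r))%:E)%E.
  have a4 : 0 < 4 / a by rewrite divr_gt0.
  have s1 : \sum_j `|r ord0 j| <= d%:R + sqn r.
    have -> : (d%:R : R) = \sum_(j < d) 1 by rewrite sumr_const card_ord.
    rewrite /sqn -big_split/=; apply: ler_sum => j _.
    rewrite -[r ord0 j ^+ 2]real_normK ?num_real//.
    by move: (`|r ord0 j|) => y; nra.
  have i1 : (\int[mu]_x (\1_(nbox 1) x * `|f (x + r)%R|)%:E <= (fine F + (d%:R + sqn r) * V)%:E)%E.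
    apply: (@le_trans _ _ (\int[mu]_x ((\1_(nbox 1) x * `|f x|)%:E + `|f (x + r)%R - f (x + 0)%R|%:E))%E).
      apply: ge0_le_integral => //.
      - apply/measurable_EFinP/measurable_funM => //; apply: measurableT_comp => //.
        exact: (measurableT_comp mf (measurable_addrV _)).
      - apply: emeasurable_funD; last exact: mdiff.
        by apply/measurable_EFinP/measurable_funM => //; exact: measurableT_comp.
      - move=> x _; rewrite -EFinD lee_fin addr0 indicE.
        case: (x \in _); rewrite ?mul1r ?mul0r ?add0r//.
        by rewrite -[X in `|X| <= _](subrK (f x)) addrC ler_normD.
    rewrite ge0_integralD//; last first.
    - by apply/measurable_EFinP/measurable_funM => //; exact: measurableT_comp.
    rewrite EFinD; apply: leeD.
      rewrite fineK// /F le_eqVlt; apply/orP; left; apply/eqP; rewrite [RHS]integral_mkcond.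
      apply: eq_integral => x _; rewrite /patch indicE.
      by case: ifPn => _; rewrite ?mul1r ?mul0r.
    apply: (@le_trans _ _ ((\sum_j `|r ord0 j|) * V)%:E).
      by under eq_integral do rewrite addr0; exact: translation_L1_vector.
    by rewrite lee_fin ler_wpM2r.
  apply: (@le_trans _ _ ((expR (a * d%:R) * expR (- (a / 2) * sqn r))%:E * (fine F + (d%:R + sqn r) * V)%:E)%E).
    apply: (@le_trans _ _ ((expR (a * d%:R) * expR (- (a / 2) * sqn r))%:E * \int[mu]_x (\1_(nbox 1) x * `|f (x + r)%R|)%:E)%E); last first.
      by apply: lee_wpmul2l => //; rewrite lee_fin mulr_ge0 ?expR_ge0.
    rewrite -ge0_integralZl_real; last 3 first.
    - by rewrite mulr_ge0 ?expR_ge0.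
    - apply: measurable_funM => //; apply: measurableT_comp => //.
      exact: (measurableT_comp mf (measurable_addrV _)).
    - by move=> x; rewrite mulr_ge0.
    apply: ge0_le_integral => //.
    - exact: (measurableT_comp mG (pair2_measurable r)).
    - apply/measurable_EFinP/measurable_funM => //; apply: measurable_funM => //; apply: measurableT_comp => //.
      exact: (measurableT_comp mf (measurable_addrV _)).
    - move=> x _; rewrite lee_fin /G/= indicE.
      have [/set_mem/nboxP hx|_] := boolP (x \in nbox 1); last by rewrite !mul0r mulr0.
      rewrite !mul1r [leLHS]mulrC ler_wpM2r// -expRD ler_expR.
      have hq : sqn x <= d%:R.
        have -> : (d%:R : R) = \sum_(j < d) 1 by rewrite sumr_const card_ord.
        apply: ler_sum => j _; rewrite -real_normK ?num_real// expr_le1//.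
        exact: ltW.
      have := sqnD_le (x + r) (- x); rewrite addrAC subrr add0r sqnN.
      nra.
  rewrite -EFinM lee_fin -!mulrA ler_wpM2l ?expR_ge0//.
  have -> : - (a / 2) * sqn r = - (sqn r / (4 / a)) + - (a / 4) * sqn r by field; lra.
  have q1 := sqn_expR r a4; have q2 := expR_sqn_le1 r a4.
  have q3 := expR_ge0 (- (sqn r / (4 / a))).
  rewrite expRD mulrAC ler_wpM2r ?expR_ge0//.
  move: (expR _) q1 q2 q3 => e q1 q2 q3; rewrite /B.
  have Ff0 := fine_ge0 F0.
  have q4 : sqn r * e * V <= (4 / a) * V by rewrite ler_wpM2r.
  have q5 : e * (fine F + d%:R * V) <= fine F + d%:R * V.
    by rewrite ler_piMl// addr_ge0// mulr_ge0.
  lra.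
have : (\int[mu]_x \int[mu]_r G (x, r) < +oo)%E.
  rewrite (fubini_tonelli G mG G0).
  apply: (@le_lt_trans _ _ (\int[mu]_r (expR (a * d%:R) * (B + V * (4 / a)) * expR (- (a / 4) * sqn r))%:E)%E).
    apply: ge0_le_integral => //.
    - by move=> r _; apply: integral_ge0.
    - exact: (measurable_fun_fubini_tonelli_G G mG G0).
    - by apply/measurable_EFinP/measurable_funM => //; exact: measurable_gauss.
  have B1 : 0 <= B + V * (4 / a) by rewrite addr_ge0// mulr_ge0// divr_ge0// ltW.
  rewrite ge0_integralZl_real ?mulr_ge0 ?expR_ge0//; last exact: measurable_gauss.
  rewrite lte_mul_pinfty// ?lee_fin ?mulr_ge0 ?expR_ge0//.
  by apply: integral_gauss_lty; lra.
rewrite e1.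
have : (0 <= \int[mu]_x (`|f x| * w x)%:E)%E by apply: integral_ge0 => x _; rewrite lee_fin mulr_ge0.
case: (integral _ _ _) => [r||] //; rewrite ?ltry//.
by move=> _; rewrite gt0_muley ?lte_fin// exprn_gt0.
Qed.

End growth.

(** * Level sets and a monotone function of the interpolation parameter *)

Section power_integral.
Context {R : realType}.
Implicit Types (a b p q t x y U V : R).

Lemma ler_powR_neg x y r : 0 < x -> x <= y -> r <= 0 -> y `^ r <= x `^ r.
Proof.
move=> x0 xy r0; have y0 : 0 < y by exact: lt_le_trans x0 xy.
rewrite -[r]opprK [leLHS]powRN [leRHS]powRN lef_pV2 ?posrE ?powR_gt0//.
by apply: ge0_ler_powR; rewrite ?nnegrE; lra.
Qed.

Lemma integral_powR_itv x y q : 0 < x -> x < y -> q != 0 ->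
  (\int[lebesgue_measure]_(t in `[x, y]) (t `^ (q - 1))%:E = ((y `^ q - x `^ q) / q)%:E)%E.
Proof.
move=> x0 xy q0.
have dF (z : R) : 0 < z -> is_derive z (1 : R) (fun t => q^-1 * t `^ q) (z `^ (q - 1)).
  move=> z0; have h := @is_derive1_powR R q z z0.
  have h2 := is_deriveZ q^-1 h.
  by apply: is_derive_eq h2 _; rewrite /GRing.scale/= mulKf.
have cpow (r z : R) : 0 < z -> {for z, continuous (fun t : R => t `^ r)}.
  move=> z0; apply/differentiable_continuous/derivable1_diffP.
  by case: (@is_derive1_powR R r z z0).
have cF (z : R) : 0 < z -> {for z, continuous (fun t => q^-1 * t `^ q)}.
  by move=> z0; apply/differentiable_continuous/derivable1_diffP; case: (dF z z0).
rewrite (@continuous_FTC2 _ _ (fun t => q^-1 * t `^ q))//.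
- by rewrite -EFinB; congr (_%:E); field.
- apply: continuous_in_subspaceT => z; rewrite inE/= in_itv/= => /andP[h1 h2].
  by apply: cpow; lra.
- split.
  + move=> z; rewrite in_itv/= => /andP[h1 h2].
    have z0 : 0 < z by lra.
    by case: (dF z z0).
  + exact: cvg_at_right_filter (cF x x0).
  + have y0 : 0 < y by lra.
    exact: cvg_at_left_filter (cF y y0).
- move=> z; rewrite in_itv/= => /andP[h1 h2]; rewrite derive1E.
  have z0 : 0 < z by lra.
  by case: (dF z z0).
Qed.

Lemma measurable_powR_EFin (D : set R) q :
  measurable_fun D (fun t : R => (t `^ q)%:E).
Proof. by apply/measurable_EFinP; apply: measurable_funTS; exact: measurable_powR. Qed.

(** With [V = U^(1/b)] the set is []0, V]] for [b > 0] and [[V, +oo[] for [b < 0]. As [q = b p] has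
    the sign of [b], the primitive [t^q / q] is finite at the far end in either case, and its value
    at [V] has modulus [U^p / |q|]. *)
Lemma integral_powR_sublevel b p U : b != 0 -> 1 < p -> 0 < U ->
  (\int[lebesgue_measure]_(t in [set t | ((0 < t) && (t `^ b <= U))%R]) (t `^ (b * p - 1))%:E
   <= (U `^ p / `|b * p|)%:E)%E.
Proof.
move=> b0 p1 U0; set q := b * p; have q0 : q != 0 by rewrite mulf_neq0// gt_eqF//; lra.
set V := U `^ b^-1; have V0 : 0 < V by exact: powR_gt0.
have Vq : V `^ q = U `^ p by rewrite /V /q -powRrM mulKf.
have mT : measurable [set t : R | (0 < t) && (t `^ b <= U)].
  have mp : measurable_fun setT (fun t : R => t `^ b) by exact: measurable_powR.
  rewrite (_ : [set _ | _] = [set t : R | 0 < t] `&` [set t : R | t `^ b <= U]); last first.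
    by apply/seteqP; split => t /=; [move/andP|move=> [-> ->]].
  apply: measurableI.
    by have := measurable_itv `]0 : R, +oo[; congr (measurable _); apply/seteqP; split => t /=; rewrite in_itv/= andbT.
  by rewrite -[X in measurable X]setTI; apply: measurable_fun_ler.
(* Exhaustion by compact intervals away from 0, where the fundamental theorem of calculus
   applies. *)
have key (F : nat -> set R) : nondecreasing_seq F ->
    (forall n, measurable (F n)) ->
    (forall n, (\int[lebesgue_measure]_(t in F n) (t `^ (q - 1))%:E <= (U `^ p / `|q|)%:E)%E) ->
    [set t | (0 < t) && (t `^ b <= U)] `<=` \bigcup_n F n ->
    (\int[lebesgue_measure]_(t in [set t | ((0 < t) && (t `^ b <= U))%R]) (t `^ (q - 1))%:E
   <= (U `^ p / `|q|)%:E)%E.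
  move=> ndF mF hF TF.
  apply: (@le_trans _ _ (\int[lebesgue_measure]_(t in \bigcup_n F n) (t `^ (q - 1))%:E)%E).
    apply: ge0_subset_integral => //; first by apply: bigcup_measurable => k _; exact: mF.
      exact: measurable_powR_EFin.
    by move=> t _; rewrite lee_fin powR_ge0.
  have h : (\int[lebesgue_measure]_(t in F i) (t `^ (q - 1))%:E @[i --> \oo] -->
      \int[lebesgue_measure]_(t in \bigcup_i F i) (t `^ (q - 1))%:E)%E.
    apply: ge0_nondecreasing_set_cvg_integral => //.
      by move=> n; exact: measurable_powR_EFin.
    by move=> n t _; rewrite lee_fin powR_ge0.
  by rewrite -(cvg_lim _ h)//; apply: lime_le; [apply/cvg_ex; eexists; exact: h|exact: nearW].
have [b1|b1|b1] := ltgtP b 0; last by rewrite b1 eqxx in b0.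
- have q1 : q < 0 by rewrite nmulr_rlt0//; lra.
  apply: (key (fun n => `[V, n.+1%:R]%classic)).
  + move=> m n mn; apply/subsetPset => t /=; rewrite !in_itv/= => /andP[-> h]/=.
    by apply: le_trans h _; rewrite ler_nat.
  + by move=> n; exact: measurable_itv.
  + move=> n; have [h|h] := ltP V n.+1%:R.
      rewrite integral_powR_itv// lee_fin (ltr0_norm q1) Vq.
      by rewrite invrN mulrN -mulNr ler_wnM2r ?invr_le0 ?(ltW q1)// lerDr powR_ge0.
    rewrite -integral_itv_bndo_bndc; last exact: measurable_powR_EFin.
    by rewrite set_itv_ge ?bnd_simp -?leNgt// integral_set0 lee_fin divr_ge0 ?powR_ge0.
  + move=> t /= /andP[t0 tU]; exists (Num.bound t) => //=.
    rewrite in_itv/=; apply/andP; split.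
      rewrite /V; have -> : t = (t `^ b) `^ b^-1 by rewrite -powRrM mulfV// powRr1// ltW.
      by apply: ler_powR_neg; rewrite ?powR_gt0// invr_le0 ltW.
    by apply: ltW; apply: lt_le_trans (archi_boundP (ltW t0)) _; rewrite ler_nat.
- have q1 : 0 < q by rewrite mulr_gt0//; lra.
  apply: (key (fun n => `[n.+1%:R^-1, V]%classic)).
  + move=> m n mn; apply/subsetPset => t /=; rewrite !in_itv/= => /andP[h ->]; rewrite andbT.
    by apply: le_trans h; rewrite lef_pV2 ?posrE// ler_nat.
  + by move=> n; exact: measurable_itv.
  + move=> n; have [h|h] := ltP n.+1%:R^-1 V.
      rewrite integral_powR_itv// lee_fin (gtr0_norm q1) Vq.
      rewrite ler_wpM2r ?invr_ge0 ?(ltW q1)//.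
      by rewrite lerBlDr lerDl powR_ge0.
    rewrite -integral_itv_bndo_bndc; last exact: measurable_powR_EFin.
    by rewrite set_itv_ge ?bnd_simp -?leNgt// integral_set0 lee_fin divr_ge0 ?powR_ge0.
  + move=> t /= /andP[t0 tU]; exists (Num.bound t^-1) => //=.
    rewrite in_itv/=; apply/andP; split.
      rewrite -[leRHS]invrK lef_pV2 ?posrE ?invr_gt0//.
      apply: ltW; apply: lt_le_trans (archi_boundP _) _; first by rewrite invr_ge0 ltW.
      by rewrite ler_nat.
    rewrite /V; have -> : t = (t `^ b) `^ b^-1 by rewrite -powRrM mulfV// powRr1// ltW.
    by apply: ge0_ler_powR; rewrite ?nnegrE ?powR_ge0 ?invr_ge0// ltW.
Qed.

End power_integral.

(** * From a bound on time sections to an integral of the K-functional *)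

Section level_sets.
Context {R : realType}.
Local Notation leb := (@lebesgue_measure R).

(** In the application [k] is the K-functional, [m t] the measure of the section at time [t] of the
    level set at height [l], [kappa] is proportional to [l], and [N] is the interpolation norm.
    Hypothesis [mk] is what Markov's inequality yields. *)
Variables (p b beta kappa C N : R) (k : R -> R) (m : R -> \bar R).
Hypotheses (p1 : 1 < p) (b0 : b != 0) (bp : beta + 2^-1 = b * p).
Hypotheses (kappa0 : 0 < kappa) (C0 : 0 <= C) (N0 : 0 <= N).
Hypotheses (k0 : forall x, 0 <= k x) (hk : {homo k : x y / x <= y}).
Hypothesis m0 : forall t, (0 <= m t)%E.
Hypothesis mm : measurable_fun setT m.
Hypothesis mk : forall t tau, 0 < t -> 0 < tau -> k tau < kappa * t `^ b ->
  (m t <= (C * t `^ 2^-1 / tau)%:E)%E.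
Hypothesis kN : (\int[leb]_(tau in `]0%R, +oo[) (tau `^ (- p^-1 - 1) * k tau)%:E <= N%:E)%E.

Let c : R := 2 `^ (p^-1 + 1).

Let mkf : measurable_fun setT k.
Proof. exact: nondecreasing_measurable. Qed.

Let c0 : 0 < c. Proof. exact: powR_gt0. Qed.

Lemma integral_ge_itv (f : R -> R) (D : set R) (x y l : R) : x < y ->
  measurable D -> measurable_fun D f -> (forall t, D t -> 0 <= f t) -> 0 <= l ->
  (forall t, x < t -> t <= y -> D t /\ l <= f t) ->
  (((y - x) * l)%:E <= \int[leb]_(t in D) (f t)%:E)%E.
Proof.
move=> xy mD mf f0 l0 hl.
have sD : `]x, y]%classic `<=` D.
  by move=> t /=; rewrite in_itv/= => /andP[h1 h2]; case: (hl _ h1 h2).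
have mI : measurable (`]x, y]%classic : set R) by exact: measurable_itv.
apply: (@le_trans _ _ (\int[leb]_(t in `]x, y]) (f t)%:E)%E); last first.
  apply: ge0_subset_integral => //; first exact/measurable_EFinP.
apply: (@le_trans _ _ (\int[leb]_(t in `]x, y]) (cst l%:E t))%E).
  rewrite integral_cst; last exact: measurable_itv.
  have := @lebesgue_measure_itv R `]x, y]; rewrite /= => ->.
  by rewrite lte_fin xy -EFinB -EFinM mulrC.
apply: ge0_le_integral => //.
- by apply/measurable_EFinP; exact: measurable_funS mf.
- by move=> t /=; rewrite in_itv/= => /andP[h1 h2]; rewrite lee_fin; case: (hl _ h1 h2).
Qed.

Let p0 : 0 < p. Proof. exact: lt_trans ltr01 p1. Qed.

Let ip0 : 0 < p^-1. Proof. by rewrite invr_gt0. Qed.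

(** As [k] is nondecreasing, the integral over []tau, 2 tau]] is at least [tau (2 tau)^(-1/p - 1)
    k(tau) = k(tau) / (c tau^(1/p))]; hence the value of [c]. *)
Let k_le tau : 0 < tau -> k tau <= c * N * tau `^ p^-1.
Proof.
move=> t0.
have h1 : (((2 * tau - tau) * ((2 * tau) `^ (- p^-1 - 1) * k tau))%:E <= N%:E)%E.
  apply: le_trans kN; apply: integral_ge_itv => //.
  - by lra.
  - by apply: measurable_funM; apply: measurable_funTS => //; exact: measurable_powR.
  - by move=> t _; rewrite mulr_ge0 ?powR_ge0.
  - by rewrite mulr_ge0 ?powR_ge0.
  - move=> t h1 h2; rewrite /= in_itv/=; split; first by rewrite andbT; lra.
    apply: ler_pM; rewrite ?powR_ge0//; last by apply: hk; lra.
    apply: ler_powR_neg => //; first by lra.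
    by have := ip0; lra.
rewrite lee_fin in h1.
have e : (2 * tau - tau) * ((2 * tau) `^ (- p^-1 - 1) * k tau) = k tau / (c * tau `^ p^-1).
  have -> : - p^-1 - 1 = - (p^-1 + 1) by ring.
  rewrite powRN powRM//; last exact: ltW.
  rewrite [tau `^ _]powRD; last by rewrite (gt_eqF t0) implybT.
  rewrite [tau `^ 1]powRr1; last exact: ltW.
  have := powR_gt0 p^-1 t0; rewrite -/c; move: (tau `^ p^-1) => X X0.
  by field; rewrite !gt_eqF.
rewrite e ler_pdivrMr in h1; last by rewrite mulr_gt0// powR_gt0.
by rewrite mulrAC [c * _ * N]mulrC.
Qed.

Let J (t tau : R) : R :=
  if (0 < tau) && (kappa * t `^ b <= k tau) then tau `^ (-2) else 0.

Let J0 t tau : 0 <= J t tau.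
Proof. by rewrite /J; case: ifP => // _; exact: powR_ge0. Qed.

Let mJ t : measurable_fun setT (J t).
Proof.
apply: measurable_fun_ifT => //.
have h1 : measurable_fun setT (fun tau : R => 0 < tau) by exact: measurable_fun_ltr.
have h2 : measurable_fun setT (fun tau : R => kappa * t `^ b <= k tau).
  exact: measurable_fun_ler.
by have := measurable_and h1 h2.
Qed.

(** The parameter grows by doubling. If [s] is the last value with [k s < kappa t^b], then [k] is
    above the threshold on []2 s, 4 s]], where the integral of [tau^(-2)] is at least
    [2 s (4 s)^(-2) = 1 / (8 s)]; this is the factor 8. *)
Let m_le t : 0 < t ->
  (m t <= (8 * C * t `^ 2^-1)%:E * \int[leb]_tau (J t tau)%:E)%E.
Proof.
move=> t0; have tb0 : 0 < kappa * t `^ b by rewrite mulr_gt0// powR_gt0.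
set X := C * t `^ 2^-1; have X0 : 0 <= X by rewrite mulr_ge0// powR_ge0.
(* [k tau -> 0] at 0, so that the sublevel set is not empty *)
have [tau0 tau00 htau0] : exists2 tau, 0 < tau & k tau < kappa * t `^ b.
  pose u := kappa * t `^ b / (c * N + 1); have u0 : 0 < u.
    by rewrite divr_gt0// ltr_wpDl// mulr_ge0// ltW.
  exists (u `^ p); first exact: powR_gt0.
  apply: le_lt_trans (k_le (powR_gt0 _ u0)) _.
  rewrite -powRrM mulfV ?powRr1 ?(ltW u0)//; last by rewrite gt_eqF//; lra.
  rewrite /u mulrCA -[ltRHS]mulr1 ltr_pM2l// ltr_pdivrMr ?mul1r; first lra.
  by rewrite ltr_wpDl// mulr_ge0// ltW.
pose tn n := tau0 * 2 ^+ n.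
have tn0 n : 0 < tn n by rewrite mulr_gt0// exprn_gt0.
(* If doubling never reaches the threshold, the bound [X / tau] tends to 0 along the sequence and
   [m t] vanishes. *)
have [hall|] := pselect (forall n, k (tn n) < kappa * t `^ b).
  have mt0 : (m t <= 0)%E.
    apply/lee_addgt0Pr => e e0; rewrite add0e.
    pose n := Num.bound (X / (tau0 * e)).
    apply: le_trans (mk t0 (tn0 n) (hall n)) _; rewrite lee_fin -/X.
    rewrite ler_pdivrMr// /tn mulrA -ler_pdivrMl ?mulr_gt0// mulrC [e * _]mulrC.
    apply: le_trans (ltW (archi_boundP _)) _; first by rewrite divr_ge0// ltW// mulr_gt0.
    by rewrite -natrX ler_nat ltnW// ltn_expl.
  apply: le_trans mt0 _; apply: mule_ge0.
    by rewrite lee_fin -mulrA mulr_ge0.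
  by apply: integral_ge0 => tau _; rewrite lee_fin.
move=> /existsNP[n0 hn0].
have exn : exists n, kappa * t `^ b <= k (tn n) by exists n0; rewrite leNgt; apply/negP.
case: (ex_minnP exn) => -[|n] hn hmin.
  by move: hn; rewrite /tn expr0 mulr1 leNgt htau0.
have hn' : k (tn n) < kappa * t `^ b.
  by rewrite ltNge; apply/negP => /hmin; rewrite ltnn.
apply: le_trans (mk t0 (tn0 n) hn') _; rewrite -/X.
have s0 := tn0 n.
have hn2 : kappa * t `^ b <= k (2 * tn n) by move: hn; rewrite /tn exprS mulrCA.
move: (tn n) s0 hn2 => s s0 hn2.
have h1 : (((4 * s - 2 * s) * (4 * s) `^ (-2))%:E <= \int[leb]_tau (J t tau)%:E)%E.
  apply: integral_ge_itv => //; [by lra|exact: powR_ge0|].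
  move=> tau h1 h2; split => //; rewrite /J.
  have tau1 : 0 < tau by lra.
  rewrite tau1 (le_trans hn2)/=; last by apply: hk; lra.
  by apply: ler_powR_neg => //; lra.
apply: (@le_trans _ _ ((8 * X)%:E * ((4 * s - 2 * s) * (4 * s) `^ (-2))%:E)%E); last first.
  by rewrite -mulrA -/X; apply: lee_wpmul2l => //; rewrite lee_fin mulr_ge0.
rewrite -EFinM lee_fin powRN powR_mulrn; last by rewrite mulr_ge0// ltW.
rewrite le_eqVlt; apply/orP; left; apply/eqP; field; lra.
Qed.

(** The exponent of time collects [t^(beta - 1)] from the measure and [t^(1/2)] from [m_le]:
    [beta - 1 + 1/2 = b p - 1]. *)
Let H (z : R * R) : R :=
  if [&& 0 < z.1, 0 < z.2 & kappa * z.1 `^ b <= k z.2]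
  then z.1 `^ (b * p - 1) * z.2 `^ (-2) else 0.

Let H0 z : (0 <= (H z)%:E)%E.
Proof. by rewrite lee_fin /H; case: ifP => // _; rewrite mulr_ge0 ?powR_ge0. Qed.

Let mH : measurable_fun setT (fun z => (H z)%:E).
Proof.
apply/measurable_EFinP; apply: measurable_fun_ifT => //; last first.
  by apply: measurable_funM; apply: measurable_powRl; [exact: measurable_fst|exact: measurable_snd].
have h1 : measurable_fun setT (fun z : R * R => 0 < z.1).
  by apply: measurable_fun_ltr => //; exact: measurable_fst.
have h2 : measurable_fun setT (fun z : R * R => 0 < z.2).
  by apply: measurable_fun_ltr => //; exact: measurable_snd.
have h3 : measurable_fun setT (fun z : R * R => kappa * z.1 `^ b <= k z.2).
  apply: measurable_fun_ler.
    by apply: measurable_funM => //; apply: measurable_powRl; exact: measurable_fst.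
  exact: (measurableT_comp mkf measurable_snd).
by have := measurable_and h1 (measurable_and h2 h3).
Qed.

(** Integrating in time produces [k(tau)^p], of which one factor [k(tau)] is kept and the power
    [p - 1] is bounded by [k_le]. The exponents of [tau] add up to [-2 + (p - 1) / p = -1/p - 1],
    the weight in the norm. *)
Let H_time tau : 0 < tau -> (\int[leb]_t (H (t, tau))%:E <=
  ((kappa `^ (- p) / `|b * p|) * (c * N) `^ (p - 1) * (tau `^ (- p^-1 - 1) * k tau))%:E)%E.
Proof.
move=> tau0; have bp0 : 0 < `|b * p| by rewrite normr_gt0 mulf_neq0// gt_eqF.
have [ktau|ktau] := ltP 0 (k tau); last first.
  rewrite (eq_integral (cst 0%E)) ?integral0.
    by rewrite lee_fin !mulr_ge0 ?invr_ge0 ?powR_ge0// ltW.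
  move=> t _; rewrite /H /=; case: ifP => // /and3P[t0 _ h].
  have : 0 < kappa * t `^ b by rewrite mulr_gt0// powR_gt0.
  by rewrite ltNge (le_trans h ktau).
have U0 : 0 < k tau / kappa by rewrite divr_gt0.
have -> : (\int[leb]_t (H (t, tau))%:E = (tau `^ (-2))%:E *
    \int[leb]_(t in [set t | ((0 < t) && (t `^ b <= k tau / kappa))%R]) (t `^ (b * p - 1))%:E)%E.
  rewrite [in RHS]integral_mkcond -ge0_integralZl//=; last 3 first.
  - apply/(measurable_restrictT _ _).1.
      rewrite (_ : [set _ | _] = [set t : R | 0 < t] `&` [set t : R | t `^ b <= k tau / kappa]); last first.
        by apply/seteqP; split => t /=; [move/andP|move=> [-> ->]].
      apply: measurableI.
        by have := measurable_itv `]0 : R, +oo[; congr (measurable _); apply/seteqP; split => t /=; rewrite in_itv/= andbT.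
      rewrite -[X in measurable X]setTI; apply: measurable_fun_ler => //; exact: measurable_powR.
    exact: measurable_powR_EFin.
  - by move=> t _; rewrite /patch; case: ifP => // _; rewrite lee_fin powR_ge0.
  - by rewrite lee_fin powR_ge0.
  apply: eq_integral => t _; rewrite /H /patch /= tau0 /=.
  have e : (kappa * t `^ b <= k tau) = (t `^ b <= k tau / kappa).
    by rewrite ler_pdivlMr// mulrC.
  rewrite e; have [h|h] := boolP ((0 < t) && (t `^ b <= k tau / kappa)).
    by rewrite mem_set//= -EFinM mulrC.
  by rewrite memNset ?mule0//; apply/negP.
apply: (@le_trans _ _ ((tau `^ (-2))%:E * ((k tau / kappa) `^ p / `|b * p|)%:E)%E).
  by apply: lee_wpmul2l; [rewrite lee_fin powR_ge0|exact: integral_powR_sublevel].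
rewrite -EFinM lee_fin powRM ?invr_ge0 ?(ltW kappa0)//.
have -> : kappa^-1 `^ p = kappa `^ (- p) by rewrite -powR_inv1 ?(ltW kappa0)// -powRrM mulN1r.
have -> : k tau `^ p = k tau * k tau `^ (p - 1) by rewrite mulr_powRB1.
rewrite [leLHS](_ : _ = kappa `^ (- p) / `|b * p| * (tau `^ (-2) * k tau `^ (p - 1) * k tau)); last by ring.
rewrite -[leRHS]mulrA ler_wpM2l ?divr_ge0 ?powR_ge0//.
rewrite mulrA ler_wpM2r//.
have h1 : k tau `^ (p - 1) <= (c * N * tau `^ p^-1) `^ (p - 1).
  apply: ge0_ler_powR; rewrite ?nnegrE//; first by have := p1; lra.
    by rewrite !mulr_ge0 ?powR_ge0.
  exact: k_le.
apply: (@le_trans _ _ (tau `^ (-2) * (c * N * tau `^ p^-1) `^ (p - 1))).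
  by rewrite ler_wpM2l ?powR_ge0.
rewrite powRM ?powR_ge0 ?mulr_ge0 ?powR_ge0// -powRrM mulrCA ler_wpM2l ?powR_ge0//.
rewrite -powRD; last by rewrite (gt_eqF tau0) implybT.
rewrite le_eqVlt; apply/orP; left; apply/eqP; congr (_ `^ _).
by have := p0; move=> pp; field; lra.
Qed.

Let D1 : R := kappa `^ (- p) / `|b * p| * (c * N) `^ (p - 1).

Lemma level_sets_bound :
  (\int[leb]_(t in `]0%R, +oo[) ((t `^ (beta - 1))%:E * m t) <=
   (8 * C * (D1 * N))%:E)%E.
Proof.
have D10 : 0 <= D1 by rewrite mulr_ge0 ?divr_ge0 ?powR_ge0.
have mI : measurable (`]0%R, +oo[%classic : set R) by exact: measurable_itv.
have mHt t : measurable_fun setT (fun tau => (H (t, tau))%:E).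
  exact: (measurableT_comp mH (pair1_measurable t)).
have mF := measurable_fun_fubini_tonelli_F (m2 := leb) (fun z => (H z)%:E) mH H0.
apply: (@le_trans _ _ (\int[leb]_t ((8 * C)%:E * \int[leb]_tau (H (t, tau))%:E))%E).
  rewrite [leLHS]integral_mkcond.
  apply: ge0_le_integral => //.
  - by move=> t _; rewrite /patch; case: ifP => // _; rewrite mule_ge0// lee_fin powR_ge0.
  - apply/(measurable_restrictT _ _).1 => //.
    apply: measurable_funTS; apply: emeasurable_funM => //.
    exact: measurable_powR_EFin.
  - by apply: emeasurable_funM => //; exact: mF.
  - move=> t _; rewrite /patch; case: ifPn => [|_]; last first.
      apply: mule_ge0; first by rewrite lee_fin mulr_ge0.
      by apply: integral_ge0.
    rewrite inE/= in_itv/= andbT => t0.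
    apply: (@le_trans _ _ ((t `^ (beta - 1))%:E * ((8 * C * t `^ 2^-1)%:E * \int[leb]_tau (J t tau)%:E))%E).
      by apply: lee_wpmul2l; [rewrite lee_fin powR_ge0|exact: m_le].
    rewrite muleA -EFinM mulrCA EFinM -muleA; apply: lee_wpmul2l.
      by rewrite lee_fin mulr_ge0.
    rewrite -ge0_integralZl_real ?mulr_ge0 ?powR_ge0//.
    rewrite le_eqVlt; apply/orP; left; apply/eqP; apply: eq_integral => tau _.
    congr (_%:E); rewrite /J /H /= t0/=; case: ifP => _; last by rewrite mulr0.
    congr (_ * _); rewrite -powRD; last by rewrite (gt_eqF t0) implybT.
    by congr (_ `^ _); rewrite -bp; ring.
    exact: mJ.
have C80 : (0 <= (8 * C)%:E)%E by rewrite lee_fin mulr_ge0.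
have F0 r : setT r -> (0 <= fubini_F leb (fun z => (H z)%:E) r)%E.
  by move=> _; apply: integral_ge0 => tau _; exact: H0.
rewrite [leLHS](ge0_integralZl leb measurableT mF F0 C80).
rewrite (EFinM (8 * C)); apply: lee_wpmul2l; first by rewrite lee_fin mulr_ge0.
rewrite [leLHS](_ : _ = \int[leb]_y fubini_G leb (fun z => (H z)%:E) y)%E; last first.
  exact: (fubini_tonelli (m1 := leb) (m2 := leb) (fun z => (H z)%:E) mH H0).
apply: (@le_trans _ _ (\int[leb]_(tau in `]0%R, +oo[) (D1 * (tau `^ (- p^-1 - 1) * k tau))%:E)%E).
  rewrite [leRHS]integral_mkcond.
  apply: ge0_le_integral.
  - exact: measurableT.
  - by move=> tau _; apply: integral_ge0 => t _; exact: H0.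
  - exact: (measurable_fun_fubini_tonelli_G (m1 := leb) (fun z => (H z)%:E) mH H0).
  - apply/(measurable_restrictT _ _).1 => //; apply: measurable_funTS.
    apply/measurable_EFinP; apply: measurable_funM => //.
    by apply: measurable_funM; [exact: measurable_powR|exact: mkf].
  - move=> tau _; rewrite /fubini_G /patch; case: ifPn => [|].
      by rewrite inE/= in_itv/= andbT => tau0; rewrite /D1; exact: H_time.
    rewrite notin_setE/= in_itv/= andbT => /negP tau0.
    rewrite (eq_integral (cst 0%E)) ?integral0// => t _.
    by rewrite /H /= (negbTE tau0) andbF.
have mg : measurable_fun (`]0%R, +oo[%classic : set R) (fun tau : R => (tau `^ (- p^-1 - 1) * k tau)%:E).
  apply/measurable_EFinP; apply: measurable_funTS.
  by apply: measurable_funM; [exact: measurable_powR|exact: mkf].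
under eq_integral do rewrite EFinM.
rewrite (ge0_integralZl leb mI mg)//; last by move=> tau _; rewrite lee_fin mulr_ge0 ?powR_ge0.
by rewrite (EFinM D1 N); apply: lee_wpmul2l.
Qed.
End level_sets.

(** * Real and imaginary parts *)

Section complex_norms.
Context {R : realType}.
Implicit Types z : R[i].

Lemma normcE2 z : Normc.normc z = Num.sqrt (complex.Re z ^+ 2 + complex.Im z ^+ 2).
Proof. by case: z. Qed.

Lemma Re_le_normc z : `|complex.Re z| <= Normc.normc z.
Proof.
rewrite normcE2 -sqrtr_sqr ler_sqrt ?sqr_ge0 ?addr_ge0 ?sqr_ge0//.
by rewrite lerDl sqr_ge0.
Qed.

Lemma Im_le_normc z : `|complex.Im z| <= Normc.normc z.
Proof.
rewrite normcE2 -sqrtr_sqr ler_sqrt ?sqr_ge0 ?addr_ge0 ?sqr_ge0//.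
by rewrite lerDr sqr_ge0.
Qed.

Lemma sqrt_sum_sqr_le (I : finType) (a : I -> R) : (forall i, 0 <= a i) ->
  Num.sqrt (\sum_i a i ^+ 2) <= \sum_i a i.
Proof.
move=> a0; have s0 : 0 <= \sum_i a i by exact: sumr_ge0.
rewrite -[leRHS]ger0_norm// -sqrtr_sqr ler_sqrt ?sqr_ge0//.
elim: (index_enum I) => [|i r IH]; first by rewrite !big_nil expr0n.
rewrite !big_cons sqrrD -addrA lerD2l; apply: le_trans IH _.
by rewrite lerDr mulrn_wge0// mulr_ge0// sumr_ge0.
Qed.

Lemma normc_le_sum z : Normc.normc z <= `|complex.Re z| + `|complex.Im z|.
Proof.
rewrite normcE2 -[leRHS]ger0_norm ?addr_ge0// -sqrtr_sqr ler_sqrt ?sqr_ge0//.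
rewrite sqrrD !real_normK ?num_real// lerD2r lerDl.
by rewrite mulrn_wge0// mulr_ge0.
Qed.

Lemma normc_ge0 z : 0 <= Normc.normc z.
Proof. by rewrite normcE2 sqrtr_ge0. Qed.

Lemma cvec_norm_le n (z : 'rV[R[i]]_n) :
  cvec_norm z <= \sum_(j < n) (`|complex.Re (z ord0 j)| + `|complex.Im (z ord0 j)|).
Proof.
apply: le_trans (sqrt_sum_sqr_le (fun j => normc_ge0 (z ord0 j))) _.
by apply: ler_sum => j _; exact: normc_le_sum.
Qed.

Lemma normc_le_cvec_norm n (z : 'rV[R[i]]_n) j : Normc.normc (z ord0 j) <= cvec_norm z.
Proof.
rewrite /cvec_norm -[leLHS]ger0_norm ?normc_ge0// -sqrtr_sqr ler_sqrt; last first.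
  by apply: sumr_ge0 => i _; exact: sqr_ge0.
by rewrite (bigD1 j)//= lerDl; apply: sumr_ge0 => i _; exact: sqr_ge0.
Qed.

End complex_norms.

(** * Total variation and Jordan parts *)

Section variation.
Context {R : realType} {d : nat}.
Local Notation E := 'rV[R]_d.
Local Notation mu := (lebesgue_rV R d).

(** The masses of the Jordan parts are given as values on the Hahn sets, since the variation is a
    supremum of such values over partitions. *)
Lemma charge_integral_jordan (nu : {charge set E -> \bar R}) :
  exists pi_ eta_ : {finite_measure set E -> \bar R}, exists P N : set E,
    [/\ forall phi, charge_integral nu phi = Rintegral pi_ setT phi - Rintegral eta_ setT phi,
        [/\ measurable P, measurable N, P `|` N = setT & P `&` N = set0],
        pi_ setT = `|nu P|%E & eta_ setT = `|nu N|%E].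
Proof.
rewrite /charge_integral; case: cid => P hP; case: cid => N nuPN.
have [[mP pP] [mN pN] PNT PN0] := nuPN.
have e1 : jordan_pos nuPN setT = `|nu P|%E.
  rewrite jordan_posE cjordan_posE /crestr0 mem_set// /crestr setTI gee0_abs//.
  exact: pP.
have e2 : jordan_neg nuPN setT = `|nu N|%E.
  rewrite jordan_negE cjordan_negE /crestr0 mem_set// /crestr setTI lee0_abs//.
  exact: pN.
by exists (jordan_pos nuPN), (jordan_neg nuPN), P, N.
Qed.

(** The partition [P], [N], followed by empty sets, is admissible in the supremum. The function [l]
    stands for the modulus of either the real or the imaginary part of a value. *)
Lemma variation_ge (nu : 'I_d -> cmeasure) (P N : set E) (l : cmeasure -> set E -> R) j :
  measurable P -> measurable N -> P `|` N = setT -> P `&` N = set0 ->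
  (forall m A, l m A <= Normc.normc (cmeasure_val m A)) ->
  ((l (nu j) P + l (nu j) N)%:E <= vmeasure_variation nu)%E.
Proof.
move=> mP mN PNT PN0 hl.
pose A n := if n is 0 then P else if n is 1 then N else set0.
have hA : [/\ forall k, measurable (A k), trivIset setT A & \bigcup_k A k = setT].
  split.
  - by move=> [|[|k]]; [exact: mP|exact: mN|exact: measurable0].
  - apply/trivIsetP => -[|[|i]] [|[|k]] _ _ //= _; rewrite ?setI0 ?set0I//.
    by rewrite setIC.
  - rewrite -PNT; apply/seteqP; split => x.
      by move=> [[|[|k]] _ /=] //; [left|right].
    by move=> [h|h]; [exists 0%N|exists 1%N].
apply: le_trans (_ : _ <= \sum_(k <oo) (cvec_norm (\row_j cmeasure_val (nu j) (A k)))%:E)%E _; last first.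
  by apply: ereal_sup_ubound; exists A.
have c0 k : (0 <= (cvec_norm (\row_j cmeasure_val (nu j) (A k)))%:E)%E.
  by rewrite lee_fin sqrtr_ge0.
apply: le_trans (nneseries_lim_ge 2%N (fun k _ _ => c0 k)).
rewrite big_nat_recr//= big_nat1 EFinD; apply: leeD; rewrite lee_fin.
  by apply: le_trans (normc_le_cvec_norm _ j); rewrite mxE; exact: hl.
by apply: le_trans (normc_le_cvec_norm _ j); rewrite mxE; exact: hl.
Qed.

Lemma vmeasure_variation_ge0 (nu : 'I_d -> @cmeasure R d) : (0 <= vmeasure_variation nu)%E.
Proof.
apply: le_ereal_sup_tmp; exists (\sum_(k <oo) (cvec_norm (\row_j cmeasure_val (nu j)
    ((fun n => if n is 0 then setT else set0) k)))%:E)%E.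
  exists (fun n => if n is 0 then setT else set0) => //; split.
  - by move=> [|k]; [exact: measurableT|exact: measurable0].
  - by apply/trivIsetP => -[|i] [|k] _ _ //= _; rewrite ?setI0 ?set0I.
  - by apply/seteqP; split => // x _; exists 0%N.
by apply: nneseries_ge0 => k _ _; rewrite lee_fin sqrtr_ge0.
Qed.

End variation.

Section components.
Context {R : realType} {d : nat}.
Local Notation E := 'rV[R]_d.
Local Notation mu := (lebesgue_rV R d).
Local Notation e_ j := (delta_mx ord0 j : E).

Lemma Re_mulC (z : R[i]) (r : R) : complex.Re (z * r%:C)%C = complex.Re z * r.
Proof. by case: z => a b /=; rewrite mulr0 subr0. Qed.

Lemma Im_mulC (z : R[i]) (r : R) : complex.Im (z * r%:C)%C = complex.Im z * r.
Proof. by case: z => a b /=; rewrite mulr0 add0r. Qed.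

Lemma Re_Cmul (z : R[i]) (r : R) : complex.Re (r%:C * z)%C = r * complex.Re z.
Proof. by rewrite mulrC Re_mulC mulrC. Qed.

Lemma Im_Cmul (z : R[i]) (r : R) : complex.Im (r%:C * z)%C = r * complex.Im z.
Proof. by rewrite mulrC Im_mulC mulrC. Qed.

Lemma ReN (z : R[i]) : complex.Re (- z) = - complex.Re z. Proof. by case: z. Qed.
Lemma ImN (z : R[i]) : complex.Im (- z) = - complex.Im z. Proof. by case: z. Qed.
Lemma ReD (z w : R[i]) : complex.Re (z + w) = complex.Re z + complex.Re w.
Proof. by case: z; case: w. Qed.
Lemma ImD (z w : R[i]) : complex.Im (z + w) = complex.Im z + complex.Im w.
Proof. by case: z; case: w. Qed.

Lemma measurable_compact_box (M : R) :
  measurable [set v : E | forall i, `[- M, M]%classic (v ord0 i)].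
Proof. exact: (measurable_rV_box (fun i => measurable_itv `[- M, M])). Qed.

Lemma measurable_normc (f : E -> R[i]) : cmeasurable setT f ->
  measurable_fun setT (fun x => Normc.normc (f x)).
Proof.
move=> [mr mi].
rewrite (_ : (fun x => _) = fun x => (complex.Re (f x) ^+ 2 + complex.Im (f x) ^+ 2) `^ 2^-1).
  by apply: measurable_powRl; apply: measurable_funD; exact: measurable_funX.
by apply/funext => x; rewrite normcE2 powR12_sqrt// addr_ge0 ?sqr_ge0.
Qed.

Lemma loc_integrable_nbox (f : E -> R[i]) N : loc_integrable f ->
  (\int[mu]_(x in nbox N) (Normc.normc (f x))%:E < +oo)%E.
Proof.
move=> [mf hf]; apply: le_lt_trans (hf _ (@compact_box R d N%:R)).
apply: ge0_subset_integral => //.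
- exact: measurable_nbox.
- exact: measurable_compact_box.
- by apply/measurable_EFinP; apply: measurable_funTS; exact: measurable_normc.
- by move=> x _; rewrite lee_fin normc_ge0.
- move=> x /nboxP hx i /=; rewrite in_itv/=; have := hx i.
  by rewrite ltr_norml => /andP[h1 h2]; rewrite !ltW.
Qed.

Lemma integrable_component (f : E -> R[i]) (g : E -> R) N : loc_integrable f ->
  measurable_fun setT g -> (forall x, `|g x| <= Normc.normc (f x)) ->
  mu.-integrable (nbox N) (EFin \o g).
Proof.
move=> lf mg hg.
have h := loc_integrable_nbox N lf; have [mf _] := lf.
apply/integrableP; split.
  by apply/measurable_EFinP; exact: measurable_funTS.
apply: le_lt_trans h; apply: ge0_le_integral => //.
- exact: measurable_nbox.
- apply: measurableT_comp => //; apply/measurable_EFinP; exact: measurable_funTS.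
- by apply/measurable_EFinP; apply: measurable_funTS; exact: measurable_normc.
- by move=> x _; rewrite lee_fin.
Qed.

Lemma translation_component (f : E -> R[i]) (g : E -> R) j
    (nu : {charge set E -> \bar R}) (W : R) :
  loc_integrable f -> measurable_fun setT g ->
  (forall x, `|g x| <= Normc.normc (f x)) ->
  (forall phi, test_function phi ->
    Rintegral mu setT (fun x => g x * 'D_(e_ j) phi x) = - charge_integral nu phi) ->
  (forall P N, measurable P -> measurable N -> P `|` N = setT -> P `&` N = set0 ->
    `|fine (nu P)| + `|fine (nu N)| <= W) ->
  forall h, 0 <= h -> (\int[mu]_x `|g (x + h *: e_ j)%R - g x|%:E <= (h * W)%:E)%E.
Proof.
move=> lf mg hg hgrad hW h h0.
have [pi_ [eta_ [P [N [hnu [mP mN PNT PN0] e1 e2]]]]] := charge_integral_jordan nu.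
have lg k : mu.-integrable (nbox k) (EFin \o g) by exact: integrable_component lf mg hg.
have gradg phi : test_function phi ->
    Rintegral mu setT (fun x => g x * 'D_(e_ j) phi x) =
    Rintegral eta_ setT phi - Rintegral pi_ setT phi.
  by move=> tphi; rewrite hgrad// hnu opprB.
apply: le_trans (translation_L1 mg lg gradg h0) _.
rewrite e1 e2 EFinM; apply: lee_wpmul2l => //.
have fP : nu P \is a fin_num by exact: fin_num_measure.
have fN : nu N \is a fin_num by exact: fin_num_measure.
rewrite -(fineK fP) -(fineK fN) -EFinD lee_fin; exact: hW.
Qed.

(** One bound [W] on the variation of the whole vector measure serves for the real and the imaginary
    part and for each direction. The translation estimate comes first, as Gaussian integrability is
    derived from it. *)
Lemma BV_components (f : E -> R[i]) (nu : 'I_d -> cmeasure) (W : R) :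
  loc_integrable f -> distr_gradient f nu -> (vmeasure_variation nu <= W%:E)%E ->
  forall g, g = (fun x => complex.Re (f x)) \/ g = (fun x => complex.Im (f x)) ->
  gauss_integrable g /\ forall j h, 0 <= h ->
    (\int[mu]_x `|g (x + h *: e_ j)%R - g x|%:E <= (h * W)%:E)%E.
Proof.
move=> lf hf hW g hg.
have mg : measurable_fun setT g by case: lf => -[mr mi] _; case: hg => ->.
have hgn x : `|g x| <= Normc.normc (f x).
  by case: hg => ->; [exact: Re_le_normc|exact: Im_le_normc].
have hT j h : 0 <= h -> (\int[mu]_x `|g (x + h *: e_ j)%R - g x|%:E <= (h * W)%:E)%E.
  case: hg => hg.
    apply: (@translation_component f g j (nu j).1) => //.
      move=> phi tphi; have := hf phi tphi j; move/(congr1 (@complex.Re R)).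
      rewrite ReN /= => <-; rewrite hg.
      by apply: eq_Rintegral => x _; rewrite Re_mulC.
    move=> P N mP mN PNT PN0; rewrite -lee_fin; apply: le_trans hW.
    apply: (@variation_ge _ _ nu P N (fun m A => `|fine (m.1 A)|)) => // m A.
    exact: Re_le_normc (cmeasure_val m A).
  apply: (@translation_component f g j (nu j).2) => //.
    move=> phi tphi; have := hf phi tphi j; move/(congr1 (@complex.Im R)).
    rewrite ImN /= => <-; rewrite hg.
    by apply: eq_Rintegral => x _; rewrite Im_mulC.
  move=> P N mP mN PNT PN0; rewrite -lee_fin; apply: le_trans hW.
  apply: (@variation_ge _ _ nu P N (fun m A => `|fine (m.2 A)|)) => // m A.
  exact: Im_le_normc (cmeasure_val m A).
split => //.
have W0 : 0 <= W.
  by rewrite -lee_fin; exact: le_trans (vmeasure_variation_ge0 nu) hW.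
apply: (gauss_integrable_translation mg W0 hT).
have /integrableP[_] := integrable_component 1 lf mg hgn.
by [].
Qed.

(** The norm of [L^oo] is an essential supremum only over a space of positive measure. *)
Lemma lebesgue_rV_gt0 : (0 < mu setT)%E.
Proof.
apply: (@lt_le_trans _ _ (mu (nbox 1))).
  by rewrite lebesgue_nbox1 lte_fin exprn_gt0.
by apply: le_measure; rewrite ?inE//; exact: measurable_nbox.
Qed.

Lemma Linfty_components (f : E -> R[i]) (M : R) :
  (Linfty_norm f <= M%:E)%E ->
  {ae mu, forall x, `|complex.Re (f x)| <= M} /\
  {ae mu, forall x, `|complex.Im (f x)| <= M}.
Proof.
rewrite /Linfty_norm unlock lebesgue_rV_gt0 => /ess_supP h.
by split; apply: filterS h => x /=; rewrite lee_fin ger0_norm ?normc_ge0//;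
  apply: le_trans; [exact: Re_le_normc|exact: Im_le_normc].
Qed.

End components.

(** * Sup and L1 bounds for the heat extension *)

Section heat_gradient_bounds.
Context {R : realType} {d : nat}.
Local Notation E := 'rV[R]_d.
Local Notation mu := (lebesgue_rV R d).
Local Notation hk := (@heat_kernel R d).
Local Notation e_ j := (delta_mx ord0 j : E).
Local Notation hc := (@heat_doubling R d).

(* Dominates [t^b |H^b f(x, t)|]; the time derivative enters through the second
   space derivatives. *)
Definition heat_size (f : E -> R) (x : E) (t : R) : R :=
  \sum_j (Num.sqrt t * `|conv (hk_dx j t) f x| + t * `|conv (hk_dxx j t) f x|).

Lemma heat_size_ge0 f x t : 0 < t -> 0 <= heat_size f x t.
Proof.
by move=> t0; apply: sumr_ge0 => j _; rewrite addr_ge0 ?mulr_ge0 ?sqrtr_ge0// ltW.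
Qed.

Lemma heat_sizeD f g x t : 0 < t -> gauss_integrable f -> gauss_integrable g ->
  heat_size (fun y => f y + g y) x t <= heat_size f x t + heat_size g x t.
Proof.
move=> t0 gf gg; have t2 : 0 < 2 * t by lra.
rewrite /heat_size -big_split/=; apply: ler_sum => j _.
rewrite (convD x t2 gf gg (measurable_hk_dx j t) (fun z => hk_dx_bound j z t0)).
rewrite (convD x t2 gf gg (measurable_hk_dxx j t) (fun z => hk_dxx_bound j z t0)).
rewrite addrACA -!mulrDr; apply: lerD.
  by apply: ler_wpM2l; [exact: sqrtr_ge0|exact: ler_normD].
by apply: ler_wpM2l; [exact: ltW|exact: ler_normD].
Qed.

Lemma heat_size_ae f g x t : measurable_fun setT f -> measurable_fun setT g ->
  {ae mu, forall y, f y = g y} -> heat_size f x t = heat_size g x t.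
Proof.
move=> mf mg fg; apply: eq_bigr => j _.
rewrite (conv_ae x (measurable_hk_dx j t) mf mg fg).
by rewrite (conv_ae x (measurable_hk_dxx j t) mf mg fg).
Qed.

(** By translation invariance the convolution of a kernel with a constant is constant, so its
    derivative vanishes. This makes [heat_size] insensitive to constants, as the quotient norm
    requires. *)
Lemma conv_derive_cst (k k' : E -> R) (c : R) j x : measurable_fun setT k ->
  is_derive x (e_ j) (conv k (cst c)) (conv k' (cst c) x) -> conv k' (cst c) x = 0.
Proof.
move=> mk [_ <-].
have -> : conv k (cst c) = cst (conv k (cst c) 0).
  apply/funext => y; rewrite -[y in LHS]add0r.
  by rewrite -(conv_shift y 0 mk (measurable_cst c)).
by rewrite derive_cst.
Qed.

Lemma heat_size_cst c x t : 0 < t -> heat_size (cst c) x t = 0.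
Proof.
move=> t0; have gc := @gauss_integrable_cst R d c.
apply: big1 => j _.
rewrite (conv_derive_cst (measurable_heat_kernel t) (conv_hk_is_derive j x t0 gc)).
rewrite (conv_derive_cst (measurable_hk_dx j t) (conv_hk_dx_is_derive j x t0 gc)).
by rewrite normr0 !mulr0 addr0.
Qed.

(** After subtraction of [c], each direction contributes [heat_doubling] from the first derivative
    and [3 heat_doubling] from the second, the powers of [t] cancelling. *)
Lemma heat_size_bounded (f : E -> R) (c M : R) x t : 0 < t -> 0 <= M ->
  measurable_fun setT f -> {ae mu, forall y, `|f y - c| <= M} ->
  heat_size f x t <= d%:R * (4 * hc) * M.
Proof.
move=> t0 M0 mf fM; have t2 : 0 < 2 * t by lra.
have mg : measurable_fun setT (fun y => f y - c) by exact: measurable_funB.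
have gg : gauss_integrable (fun y => f y - c).
  apply: (@gauss_integrable_le _ _ _ (cst 0) M) => //; first exact: gauss_integrable_cst.
  by apply: filterS fM => y; rewrite /cst normr0 addr0.
have gc := @gauss_integrable_cst R d c.
have := heat_sizeD x t0 gg gc.
rewrite heat_size_cst// addr0.
rewrite (_ : (fun y => f y - c + cst c y) = f); last first.
  by apply/funext => y; rewrite subrK.
move=> h; apply: le_trans h _; rewrite /heat_size.
apply: (@le_trans _ _ (\sum_(j < d) (4 * hc) * M)); last first.
  by rewrite sumr_const card_ord -[leLHS]mulr_natl mulrA.
apply: ler_sum => j _.
have b1 := conv_bounded x t2 M0 mg fM (measurable_hk_dx j t) (fun z => hk_dx_le j z t0).
have b2 := conv_bounded x t2 M0 mg fM (measurable_hk_dxx j t) (fun z => hk_dxx_le j z t0).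
have s0 : 0 < Num.sqrt t by rewrite sqrtr_gt0.
have -> : 4 * hc * M = Num.sqrt t * (hc / Num.sqrt t * M) + t * (3 * hc / t * M).
  by field; rewrite !gt_eqF.
by apply: lerD; apply: ler_wpM2l => //; exact: ltW.
Qed.

(** In each derivative, one order is charged to [f]: the first costs the mass 1 of the kernel, the
    second the constant [heat_doubling / sqrt t] of [hk_dx]. The weights [sqrt t] and [t] thus both
    leave [sqrt t]. *)
Lemma heat_size_L1 (f : E -> R) (V : R) t : 0 < t -> gauss_integrable f ->
  (forall j h, 0 <= h -> (\int[mu]_x `|f (x + h *: e_ j)%R - f x|%:E <= (h * V)%:E)%E) ->
  (\int[mu]_x (heat_size f x t)%:E <= (Num.sqrt t * (d%:R * (1 + hc)) * V)%:E)%E.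
Proof.
move=> t0 gf hV; have t2 : 0 < 2 * t by lra.
have mf : measurable_fun setT f by case: gf.
have s0 : 0 < Num.sqrt t by rewrite sqrtr_gt0.
have mn (k : E -> R) : measurable_fun setT k -> measurable_fun setT (fun x => `|conv k f x|).
  by move=> mk; apply: measurableT_comp => //; exact: measurable_conv.
have b1 j : (\int[mu]_x `|conv (hk_dx j t) f x|%:E <= (1 * V)%:E)%E.
  apply: (@conv_derive_L1 _ _ (hk t) (hk_dx j t) f 1 t (e_ j) V) => //.
  - exact: measurable_heat_kernel.
  - by move=> z; rewrite heat_kernel_norm mul1r.
  - by move=> x; exact: conv_hk_is_derive.
  - by move=> h h0; apply: hV; exact: ltW.
have b2 j : (\int[mu]_x `|conv (hk_dxx j t) f x|%:E <= (hc / Num.sqrt t * V)%:E)%E.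
  apply: (@conv_derive_L1 _ _ (hk_dx j t) (hk_dxx j t) f _ (2 * t) (e_ j) V) => //.
  - exact: measurable_hk_dx.
  - by move=> z; exact: hk_dx_le.
  - by move=> x; exact: conv_hk_dx_is_derive.
  - by move=> h h0; apply: hV; exact: ltW.
under eq_integral do rewrite /heat_size -sumEFin.
have mterm j : measurable_fun setT (fun x => (Num.sqrt t * `|conv (hk_dx j t) f x| + t * `|conv (hk_dxx j t) f x|)%:E).
  apply/measurable_EFinP; apply: measurable_funD; apply: measurable_funM => //; apply: mn.
    exact: measurable_hk_dx.
  exact: measurable_hk_dxx.
rewrite ge0_integral_sum//; last first.
  by move=> j x _; rewrite lee_fin addr_ge0 ?mulr_ge0 ?sqrtr_ge0// ltW.
apply: (@le_trans _ _ (\sum_(j < d) (Num.sqrt t * (1 + hc) * V)%:E)%E); last first.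
  by rewrite sumEFin lee_fin sumr_const card_ord -[leLHS]mulr_natl; rewrite le_eqVlt; apply/orP; left; apply/eqP; ring.
apply: lee_sum => j _; under eq_integral do rewrite EFinD.
rewrite ge0_integralD//; last 3 first.
- by apply/measurable_EFinP; apply: measurable_funM => //; apply: mn; exact: measurable_hk_dx.
- by move=> x _; rewrite lee_fin mulr_ge0// ltW.
- by apply/measurable_EFinP; apply: measurable_funM => //; apply: mn; exact: measurable_hk_dxx.
rewrite !ge0_integralZl_real ?(ltW s0) ?(ltW t0)//; last 2 first.
- by apply: mn; exact: measurable_hk_dxx.
- by apply: mn; exact: measurable_hk_dx.
apply: (@le_trans _ _ ((Num.sqrt t)%:E * (1 * V)%:E + t%:E * (hc / Num.sqrt t * V)%:E)%E).
  by apply: leeD; apply: lee_wpmul2l => //; rewrite lee_fin ltW.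
rewrite -!EFinM -EFinD lee_fin.
have -> : t * (hc / Num.sqrt t * V) = Num.sqrt t * hc * V.
  rewrite -[X in X * (_ / _ * _)](sqr_sqrtr (ltW t0)); field.
  by rewrite gt_eqF.
rewrite le_eqVlt; apply/orP; left; apply/eqP; ring.
Qed.

End heat_gradient_bounds.

(** * Derivatives of the heat extension and their measurability *)

Section heat_extension_formulas.
Context {R : realType} {d : nat}.
Local Notation E := 'rV[R]_d.
Local Notation mu := (lebesgue_rV R d).
Local Notation hk := (@heat_kernel R d).
Local Notation e_ j := (delta_mx ord0 j : E).
Local Notation Ref f := (fun y => complex.Re (f y)).
Local Notation Imf f := (fun y => complex.Im (f y)).
Implicit Types f : E -> R[i].

Lemma complexP (z w : R[i]) :
  complex.Re z = complex.Re w -> complex.Im z = complex.Im w -> z = w.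
Proof. by case: z; case: w => a b c e /= -> ->. Qed.

Lemma Re_sum (I : finType) (g : I -> R[i]) : complex.Re (\sum_i g i) = \sum_i complex.Re (g i).
Proof. exact: (big_morph _ (@ReD R) erefl). Qed.

Lemma Im_sum (I : finType) (g : I -> R[i]) : complex.Im (\sum_i g i) = \sum_i complex.Im (g i).
Proof. exact: (big_morph _ (@ImD R) erefl). Qed.

Lemma heat_extE f x t :
  heat_ext f x t = (conv (hk t) (Ref f) x +i* conv (hk t) (Imf f) x)%C.
Proof.
by apply: complexP; apply: eq_Rintegral => y _; rewrite (Re_Cmul, Im_Cmul).
Qed.

Variable f : E -> R[i].
Hypotheses (gr : gauss_integrable (Ref f)) (gi : gauss_integrable (Imf f)).

Let dr1 j t (x : E) (t0 : 0 < t) := conv_hk_is_derive j x t0 gr.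
Let di1 j t (x : E) (t0 : 0 < t) := conv_hk_is_derive j x t0 gi.

Lemma dx_heat_ext j x t : 0 < t ->
  dx j (heat_ext f) x t = (conv (hk_dx j t) (Ref f) x +i* conv (hk_dx j t) (Imf f) x)%C.
Proof.
move=> t0; have [_ <-] := dr1 j x t0; have [_ <-] := di1 j x t0.
by rewrite /dx /cderive; under eq_fun do rewrite heat_extE;
  under [X in (_ +i* 'D__ X _)%C]eq_fun do rewrite heat_extE.
Qed.

Lemma dxx_heat_ext j x t : 0 < t ->
  dx j (dx j (heat_ext f)) x t = (conv (hk_dxx j t) (Ref f) x +i* conv (hk_dxx j t) (Imf f) x)%C.
Proof.
move=> t0; have [_ <-] := conv_hk_dx_is_derive j x t0 gr.
have [_ <-] := conv_hk_dx_is_derive j x t0 gi.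
rewrite {1}/dx /cderive; under eq_fun do rewrite dx_heat_ext//.
by under [X in (_ +i* 'D__ X _)%C]eq_fun do rewrite dx_heat_ext//.
Qed.

Lemma dt_heat_ext x t : 0 < t ->
  dt (heat_ext f) x t =
  ((\sum_j conv (hk_dxx j t) (Ref f) x) +i* (\sum_j conv (hk_dxx j t) (Imf f) x))%C.
Proof.
move=> t0; rewrite /dt /cderive; under eq_fun do rewrite heat_extE.
under [X in (_ +i* 'D__ X _)%C]eq_fun do rewrite heat_extE.
apply: complexP => /=; first exact: (@derive_val _ _ _ _ _ _ _ (conv_hk_is_derive_time x t0 gr)).
exact: (@derive_val _ _ _ _ _ _ _ (conv_hk_is_derive_time x t0 gi)).
Qed.

Lemma heat_equation_heat_ext : heat_equation (heat_ext f).
Proof.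
move=> x t t0; split.
- split; under eq_fun do rewrite heat_extE.
    by have [] := conv_hk_is_derive_time x t0 gr.
  by have [] := conv_hk_is_derive_time x t0 gi.
- move=> j; split; split.
  + by under eq_fun do rewrite heat_extE; have [] := dr1 j x t0.
  + by under eq_fun do rewrite heat_extE; have [] := di1 j x t0.
  + by under eq_fun do rewrite dx_heat_ext//; have [] := conv_hk_dx_is_derive j x t0 gr.
  + by under eq_fun do rewrite dx_heat_ext//; have [] := conv_hk_dx_is_derive j x t0 gi.
- rewrite dt_heat_ext// /laplacian; rewrite [RHS](eq_bigr _ (fun j _ => dxx_heat_ext j x t0)).
  by apply: complexP; rewrite ?Re_sum ?Im_sum.
Qed.

Lemma heat_op_le b x t : 0 < t ->
  cvec_norm (heat_op b f (x, t)) <=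
  t `^ (- b) * (heat_size (Ref f) x t + heat_size (Imf f) x t).
Proof.
move=> t0; apply: le_trans (cvec_norm_le _) _.
have e1 : t `^ (2^-1 - b) = t `^ (- b) * Num.sqrt t.
  by rewrite -powR12_sqrt ?(ltW t0)// -powRD ?(gt_eqF t0) ?implybT// addrC.
have e2 : t `^ (1 - b) = t `^ (- b) * t.
  by rewrite -{3}(powRr1 (ltW t0)) -powRD ?(gt_eqF t0) ?implybT// addrC.
rewrite big_split_ord /= big_ord1 /heat_size -big_split/= mulr_sumr.
under eq_bigr do rewrite row_mxEl mxE dx_heat_ext// Re_Cmul Im_Cmul !normrM e1 /=.
rewrite row_mxEr mxE dt_heat_ext// Re_Cmul Im_Cmul !normrM e2 /=.
rewrite !normrM (ger0_norm (powR_ge0 t (- b))) (ger0_norm (sqrtr_ge0 t)) (gtr0_norm t0).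
apply: (@le_trans _ _ (\sum_(j < d) (t `^ (- b) * Num.sqrt t * `|conv (hk_dx j t) (Ref f) x| +
   t `^ (- b) * Num.sqrt t * `|conv (hk_dx j t) (Imf f) x|) +
   (t `^ (- b) * t * (\sum_(j < d) `|conv (hk_dxx j t) (Ref f) x|) +
   t `^ (- b) * t * (\sum_(j < d) `|conv (hk_dxx j t) (Imf f) x|)))).
  apply: lerD => //.
  by apply: lerD; rewrite ler_wpM2l ?mulr_ge0 ?powR_ge0 ?(ltW t0)//; exact: ler_norm_sum.
rewrite le_eqVlt; apply/orP; left; apply/eqP.
by rewrite !mulr_sumr -!big_split/=; apply: eq_bigr => j _; ring.
Qed.

Lemma gauss_integrable_measurable_conv_time (k : R -> E -> R) g :
  measurable_fun setT (fun z : E * R => k z.2 z.1) -> gauss_integrable g ->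
  measurable_fun setT (fun z : E * R => conv (k z.2) g z.1).
Proof. by move=> mk [mg _]; exact: measurable_conv_time. Qed.

Lemma measurable_upper_half : measurable (@upper_half R d).
Proof.
rewrite -[X in measurable X]setTI; apply: measurable_fun_ltr => //; exact: measurable_snd.
Qed.

Lemma cmeasurable_dx j : cmeasurable (@upper_half R d) (fun z => dx j (heat_ext f) z.1 z.2).
Proof.
have mk := @measurable_hk_dx_time R d j.
split.
- apply: (eq_measurable_fun (fun z => conv (hk_dx j z.2) (Ref f) z.1)).
    by move=> z; rewrite inE => z0; rewrite dx_heat_ext.
  by apply: measurable_funTS; exact: gauss_integrable_measurable_conv_time.
- apply: (eq_measurable_fun (fun z => conv (hk_dx j z.2) (Imf f) z.1)).
    by move=> z; rewrite inE => z0; rewrite dx_heat_ext.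
  by apply: measurable_funTS; exact: gauss_integrable_measurable_conv_time.
Qed.

Lemma cmeasurable_dt : cmeasurable (@upper_half R d) (fun z => dt (heat_ext f) z.1 z.2).
Proof.
split.
- apply: (eq_measurable_fun (fun z => \sum_j conv (hk_dxx j z.2) (Ref f) z.1)).
    by move=> z; rewrite inE => z0; rewrite dt_heat_ext.
  apply: measurable_funTS; apply: measurable_sum => j.
  by apply: gauss_integrable_measurable_conv_time => //; exact: measurable_hk_dxx_time.
- apply: (eq_measurable_fun (fun z => \sum_j conv (hk_dxx j z.2) (Imf f) z.1)).
    by move=> z; rewrite inE => z0; rewrite dt_heat_ext.
  apply: measurable_funTS; apply: measurable_sum => j.
  by apply: gauss_integrable_measurable_conv_time => //; exact: measurable_hk_dxx_time.
Qed.

Lemma cmeasurable_powR_mul (a : R) (g : E * R -> R[i]) : cmeasurable (@upper_half R d) g ->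
  cmeasurable (@upper_half R d) (fun z => ((z.2 `^ a)%:C)%C * g z).
Proof.
move=> [mr mi].
have mp : measurable_fun (@upper_half R d) (fun z : E * R => z.2 `^ a).
  by apply: measurable_funTS; apply: measurable_powRl; exact: measurable_snd.
split.
  by under eq_fun do rewrite Re_Cmul; exact: measurable_funM.
by under eq_fun do rewrite Im_Cmul; exact: measurable_funM.
Qed.

Lemma cmeasurable_heat_op b j : cmeasurable (@upper_half R d) (fun z => heat_op b f z ord0 j).
Proof.
rewrite -(splitK j); case: (fintype.split j) => k /=.
  under eq_fun do rewrite row_mxEl mxE.
  exact/cmeasurable_powR_mul/cmeasurable_dx.
under eq_fun do rewrite row_mxEr mxE.
exact/cmeasurable_powR_mul/cmeasurable_dt.
Qed.

End heat_extension_formulas.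

Lemma measurable_cvec_norm d (T : measurableType d) (R : realType) (D : set T) n
    (g : T -> 'rV[R[i]]_n) : (forall j, cmeasurable D (fun z => g z ord0 j)) ->
  measurable_fun D (fun z => cvec_norm (g z)).
Proof.
move=> mg.
rewrite (_ : (fun _ => _) = fun z => (\sum_j (complex.Re (g z ord0 j) ^+ 2 + complex.Im (g z ord0 j) ^+ 2)) `^ 2^-1).
  apply: (measurableT_comp (measurable_powR _)); apply: measurable_sum => j.
  by have [mr mi] := mg j; apply: measurable_funD; exact: measurable_funX.
apply/funext => z; rewrite powR12_sqrt; last first.
  by apply: sumr_ge0 => j _; rewrite addr_ge0 ?sqr_ge0.
by congr Num.sqrt; apply: eq_bigr => j _; rewrite normcE2 sqr_sqrtr// addr_ge0 ?sqr_ge0.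
Qed.

(** * The weak-type estimate *)

Section K_functional_bounds.
Context {R : realType} {d : nat}.
Local Notation E := 'rV[R]_d.
Local Notation mu := (lebesgue_rV R d).
Local Notation e_ j := (delta_mx ord0 j : E).
Local Notation Ref f := (fun y => complex.Re (f y)).
Local Notation Imf f := (fun y => complex.Im (f y)).
Local Notation K t f := (K_functional (@Vinfty R d) Vinfty_norm BV BV_norm t f).
Implicit Types f : E -> R[i].

Lemma Vinfty_norm_ge0 f : (0 <= Vinfty_norm f)%E.
Proof. by apply: le_ereal_inf_tmp => _ [c _ <-]; exact: Lnorm_ge0. Qed.

Lemma BV_norm_ge0 f : (0 <= BV_norm f)%E.
Proof. by apply: le_ereal_inf_tmp => _ [nu _ <-]; exact: vmeasure_variation_ge0. Qed.

Lemma K_ge0 t f : 0 <= t -> (0 <= K t f)%E.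
Proof.
move=> t0; apply: le_ereal_inf_tmp => _ [f0 [f1 [_ _ _ ->]]].
by rewrite adde_ge0 ?Vinfty_norm_ge0// mule_ge0 ?BV_norm_ge0.
Qed.

Lemma K_le s t f : s <= t -> (K s f <= K t f)%E.
Proof.
move=> st; apply: le_ereal_inf_tmp => _ [f0 [f1 [V0 V1 ff ->]]].
apply: (@le_trans _ _ (Vinfty_norm f0 + s%:E * BV_norm f1)%E).
  by apply: ereal_inf_lbound; exists f0, f1.
by apply: leeD => //; apply: lee_wpmul2r; rewrite ?lee_fin ?BV_norm_ge0.
Qed.

Lemma K_lt s f (r : \bar R) : 0 < s -> (K s f < r)%E -> exists f0 f1,
  [/\ Vinfty f0, BV f1, eq_mod_const f (fun x => f0 x + f1 x),
      (Vinfty_norm f0 < r)%E & (s%:E * BV_norm f1 < r)%E].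
Proof.
move=> s0 /ereal_inf_lt[_ [f0 [f1 [V0 V1 ff ->]]] h]; exists f0, f1; split => //.
  by apply: le_lt_trans h; rewrite leeDl// mule_ge0 ?BV_norm_ge0// lee_fin ltW.
by apply: le_lt_trans h; rewrite leeDr// Vinfty_norm_ge0.
Qed.

(** A decomposition of finite cost at one parameter has finite cost at every parameter. *)
Lemma K_lty s t f : 0 < s -> (K s f < +oo)%E -> (K t f < +oo)%E.
Proof.
move=> s0 /(K_lt s0)[f0 [f1 [V0 V1 ff h0 h1]]].
apply: (@le_lt_trans _ _ (Vinfty_norm f0 + t%:E * BV_norm f1)%E).
  by apply: ereal_inf_lbound; exists f0, f1.
have fin1 : BV_norm f1 \is a fin_num.
  rewrite ge0_fin_numE ?BV_norm_ge0// ltey; apply/eqP => e.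
  by move: h1; rewrite e gt0_muley ?lte_fin// ltxx.
by rewrite lte_add_pinfty// -(fineK fin1) -EFinM ltry.
Qed.

(* What an almost optimal decomposition for the K-functional leaves for the real
   and imaginary parts: an essentially bounded part, modulo constants, and a part
   of bounded variation [V]. *)
Definition K_split (g : E -> R) (r V : R) := exists (g0 g1 : E -> R) (c : R),
  [/\ measurable_fun setT g0, {ae mu, forall x, `|g0 x - c| <= r}, gauss_integrable g1,
   forall j h, 0 <= h -> (\int[mu]_x `|g1 (x + h *: e_ j)%R - g1 x|%:E <= (h * V)%:E)%E &
   {ae mu, forall x, g x = g0 x + g1 x}].

(** A decomposition of total cost below [r] has a bounded part of quotient norm below [r] and a part
    of variation below [r / s]. The constant of [eq_mod_const] is put into the bounded part, whose
    centre moves along with it. *)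
Lemma K_components f (s r : R) : 0 < s -> (K s f < r%:E)%E ->
  K_split (Ref f) r (r / s) /\ K_split (Imf f) r (r / s).
Proof.
move=> s0 /(K_lt s0)[f0 [f1 [[mf0 _] [lf1 _] [c fc] /ereal_inf_lt[_ [c0 _ <-] h0] h1]]].
have {}h1 : (BV_norm f1 < (r / s)%:E)%E.
  by rewrite EFinM lte_pdivlMr// muleC.
have /ereal_inf_lt[_ [nu hnu <-] hW] := h1.
have comp := BV_components lf1 hnu (ltW hW).
have [bR bI] := Linfty_components (ltW h0).
have [mR mI] := mf0.
split.
- have [g1 T1] := comp _ (or_introl erefl).
  exists (fun x => complex.Re (f0 x) + complex.Re c), (Ref f1), (complex.Re c0 + complex.Re c).
  split => //; first exact: measurable_funD.
  + apply: filterS bR => x; rewrite ReD ReN => h.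
    by rewrite (_ : _ - _ = complex.Re (f0 x) - complex.Re c0)//; ring.
  + by apply: filterS fc => x ->; rewrite !ReD addrAC.
- have [g1 T1] := comp _ (or_intror erefl).
  exists (fun x => complex.Im (f0 x) + complex.Im c), (Imf f1), (complex.Im c0 + complex.Im c).
  split => //; first exact: measurable_funD.
  + apply: filterS bI => x; rewrite ImD ImN => h.
    by rewrite (_ : _ - _ = complex.Im (f0 x) - complex.Im c0)//; ring.
  + by apply: filterS fc => x ->; rewrite !ImD addrAC.
Qed.

Lemma K_split_gauss_integrable (g : E -> R) r V : measurable_fun setT g -> K_split g r V -> gauss_integrable g.
Proof.
move=> mg [g0 [g1 [c [m0 b0 gi1 _ gg]]]].
have gi0 := gauss_integrable_near_cst m0 b0.
exact: gauss_integrable_ae mg (gauss_integrableD gi0 gi1) gg.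
Qed.

Definition heat_size_sup : R := d%:R * (4 * @heat_doubling R d).
Definition heat_size_l1 : R := d%:R * (1 + @heat_doubling R d).

Lemma K_split_heat_size (g : E -> R) r V t : 0 < t -> 0 <= r ->
  measurable_fun setT g -> K_split g r V -> exists h : E -> R,
  [/\ measurable_fun setT h, forall x, 0 <= h x,
      forall x, heat_size g x t <= heat_size_sup * r + h x &
      (\int[mu]_x (h x)%:E <= (Num.sqrt t * heat_size_l1 * V)%:E)%E].
Proof.
move=> t0 r0 mg [g0 [g1 [c [m0 b0 gi1 T1 gg]]]].
have m1 : measurable_fun setT g1 by case: gi1.
have gi0 := gauss_integrable_near_cst m0 b0.
exists (fun x => heat_size g1 x t); split.
- apply: measurable_sum => j; apply: measurable_funD; apply: measurable_funM => //;
    apply: measurableT_comp => //; apply: measurable_conv => //.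
    exact: measurable_hk_dx.
  exact: measurable_hk_dxx.
- by move=> x; exact: heat_size_ge0.
- move=> x; rewrite (@heat_size_ae _ _ g (fun y => g0 y + g1 y))//; last exact: measurable_funD.
  apply: le_trans (heat_sizeD x t0 gi0 gi1) _; rewrite lerD2r.
  exact: heat_size_bounded b0.
- exact: heat_size_L1.
Qed.

Hypothesis d0 : (0 < d)%N.

Lemma heat_size_sup_gt0 : 0 < heat_size_sup.
Proof. by rewrite !mulr_gt0 ?ltr0n// heat_doubling_gt0. Qed.

Lemma heat_size_l1_ge0 : 0 <= heat_size_l1.
Proof. by rewrite mulr_ge0// addr_ge0// ltW// heat_doubling_gt0. Qed.

Definition heat_level f b l : set (E * R) :=
  [set z | 0 < z.2 /\ l < cvec_norm (heat_op b f z)].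

Lemma measurable_heat_level f b l : gauss_integrable (Ref f) -> gauss_integrable (Imf f) ->
  measurable (heat_level f b l).
Proof.
move=> gR gI.
have mU := @measurable_upper_half R d.
have mc : measurable_fun (@upper_half R d) (fun z => cvec_norm (heat_op b f z)).
  by apply: measurable_cvec_norm => j; exact: cmeasurable_heat_op.
have := measurable_fun_ltr (measurable_cst l) mc => /(_ mU [set true]).
rewrite (_ : upper_half `&` _ = heat_level f b l); last by apply/seteqP; split.
by apply.
Qed.

(** Let [S] be [heat_size_sup] and [r = l t^b / (4 S)]. The bounded parts of the real and imaginary
    components contribute at most [a = 2 S r], half of [l t^b], so on the level set the parts of
    bounded variation exceed [a]. Their integral is at most twice [sqrt t * heat_size_l1 * r / s],
    and division by [a] cancels [r]. *)
Lemma heat_op_level f b l t s : cmeasurable setT f -> 0 < t -> 0 < s -> 0 < l ->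
  (K s f < (l / (4 * heat_size_sup) * t `^ b)%:E)%E ->
  (mu [set x | (l < cvec_norm (heat_op b f (x, t)))%R] <= (heat_size_l1 / heat_size_sup * t `^ 2^-1 / s)%:E)%E.
Proof.
move=> [mR mI] t0 s0 l0 hK; have S0 := heat_size_sup_gt0.
set r := _ * _ in hK.
have r0 : 0 < r by rewrite mulr_gt0 ?powR_gt0// divr_gt0// mulr_gt0.
have [sR sI] := K_components s0 hK.
have gR := K_split_gauss_integrable mR sR; have gI := K_split_gauss_integrable mI sI.
have [hR [mhR hR0 bR iR]] := K_split_heat_size t0 (ltW r0) mR sR.
have [hI [mhI hI0 bI iI]] := K_split_heat_size t0 (ltW r0) mI sI.
pose h x := hR x + hI x; pose a := 2 * heat_size_sup * r.
have a0 : 0 < a by rewrite /a mulr_gt0// mulr_gt0.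
have mh : measurable_fun setT h by exact: measurable_funD.
have h0 x : 0 <= h x by exact: addr_ge0.
have mhE : measurable_fun setT (EFin \o h) by exact/measurable_EFinP.
have sub : [set x | (l < cvec_norm (heat_op b f (x, t)))%R] `<=` setT `&` [set x | (a%:E <= `|(EFin \o h) x|)%E].
  move=> x /= hl; split => //; rewrite lee_fin ger0_norm//.
  have {}hl := lt_le_trans hl (heat_op_le gR gI b x t0).
  have lE : l = t `^ (- b) * (2 * a).
    rewrite /a /r powRN; field; rewrite ?gt_eqF// ?powR_gt0//.
  move: hl; rewrite [X in X < _]lE ltr_pM2l ?powR_gt0// => hl.
  have := bR x; have := bI x; rewrite -/a /h; move: hl; rewrite /a; lra.
have mset : measurable (setT `&` [set x | (a%:E <= `|(EFin \o h) x|)%E]).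
  by apply: emeasurable_fun_c_infty => //; exact: measurableT_comp.
have mle : (mu [set x | (l < cvec_norm (heat_op b f (x, t)))%R] <=
    mu (setT `&` [set x | (a%:E <= `|(EFin \o h) x|)%E]))%E.
  apply: le_measure => //; rewrite ?inE//.
  rewrite (_ : [set x | _] = ysection (heat_level f b l) t).
    by apply: measurable_ysection; exact: measurable_heat_level.
  by rewrite ysectionE; apply/seteqP; split => x /=; [split|case].
apply: le_trans mle _.
rewrite -(lee_pmul2l (x := a%:E))//.
apply: le_trans (le_integral_abse mu measurableT mhE a0) _.
have -> : (\int[mu]_x `|(EFin \o h) x| = \int[mu]_x (hR x)%:E + \int[mu]_x (hI x)%:E)%E.
  rewrite -ge0_integralD//; try by [move=> x _; rewrite lee_fin|exact/measurable_EFinP].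
  by apply: eq_integral => x _ /=; rewrite ger0_norm// EFinD.
apply: le_trans (leeD iR iI) _.
rewrite -EFinD -EFinM lee_fin powR12_sqrt ?(ltW t0)// le_eqVlt; apply/orP; left; apply/eqP.
rewrite /a; field; rewrite !gt_eqF//.
Qed.

End K_functional_bounds.

Section weak_type_bound.
Context {R : realType} {d : nat}.
Local Notation E := 'rV[R]_d.
Local Notation mu := (lebesgue_rV R d).
Local Notation leb := (@lebesgue_measure R).
Local Notation Ref f := (fun y => complex.Re (f y)).
Local Notation Imf f := (fun y => complex.Im (f y)).
Local Notation K t f := (K_functional (@Vinfty R d) Vinfty_norm BV BV_norm t f).
Implicit Types f : E -> R[i].

Lemma VBV_normE theta f : VBV_norm theta 1 f =
  (\int[leb]_(t in `]0%R, +oo[) ((t `^ (- theta))%:E * K t f * (t^-1)%:E))%E.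
Proof.
have h t : `]0%R, +oo[%classic t -> (0 <= (t `^ (- theta))%:E * K t f)%E.
  rewrite /= in_itv/= andbT => t0.
  by rewrite mule_ge0 ?lee_fin ?powR_ge0// K_ge0// ltW.
rewrite /VBV_norm /interp_norm invr1 poweRe1.
  by apply: eq_integral => t; rewrite inE => /h t0; rewrite poweRe1.
apply: integral_ge0 => t t0; rewrite mule_ge0 ?poweR_ge0// lee_fin invr_ge0.
by move: t0; rewrite /= in_itv/= andbT; exact: ltW.
Qed.

(** An infinite value at one parameter would be infinite at all of them, and the norm integral would
    diverge. *)
Lemma VBV_K_lty theta t f : VBV theta 1 f -> 0 < t -> (K t f < +oo)%E.
Proof.
move=> [_ _ +] t0; rewrite -/(VBV_norm theta 1 f) VBV_normE => h.
have [//|Koo] := ltP (K t f) +oo%E; move: h.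
rewrite (eq_integral (cst +oo%E)).
  rewrite integral_cst; last exact: measurable_itv.
  have := @lebesgue_measure_itv R `]0, +oo[; rewrite /= => ->.
  by rewrite ltry mulyy ltxx.
move=> s; rewrite inE/= in_itv/= andbT => s0.
have -> : K s f = +oo%E.
  apply/eqP; rewrite -leye_eq leNgt; apply/negP => /(K_lty t s0).
  by rewrite ltNge Koo.
by rewrite gt0_muley ?lte_fin ?powR_gt0// gt0_mulye// lte_fin invr_gt0.
Qed.

Lemma VBV_gauss_integrable theta f : VBV theta 1 f -> gauss_integrable (Ref f) /\ gauss_integrable (Imf f).
Proof.
move=> Vf; have := VBV_K_lty Vf ltr01; have K0 := K_ge0 f (@ler01 R).
have [[[mR mI] _] _ _] := Vf.
move=> Ky; have Kf : K 1 f \is a fin_num by rewrite ge0_fin_numE.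
have /(K_components ltr01)[sR sI] : (K 1 f < (fine (K 1 f) + 1)%:E)%E.
  by rewrite EFinD fineK// lteDl// lte_fin.
by split; [exact: K_split_gauss_integrable mR sR|exact: K_split_gauss_integrable mI sI].
Qed.

(* Zero for [t <= 0], where the K-functional may be negative, to keep it monotone
   on the whole line. *)
Definition fine_K f (t : R) : R := if 0 < t then fine (K t f) else 0.

Lemma fine_K_ge0 f t : 0 <= fine_K f t.
Proof. by rewrite /fine_K; case: ifP => // t0; rewrite fine_ge0// K_ge0// ltW. Qed.

Lemma fine_KE theta f t : VBV theta 1 f -> 0 < t -> ((fine_K f t)%:E = K t f)%E.
Proof.
move=> Vf t0; rewrite /fine_K t0 fineK// ge0_fin_numE ?K_ge0 ?ltW//.
exact: VBV_K_lty Vf t0.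
Qed.

Lemma fine_K_homo theta f : VBV theta 1 f -> {homo fine_K f : x y / x <= y}.
Proof.
move=> Vf s t st; have [s0|s0] := ltP 0 s; last first.
  by rewrite {1}/fine_K ltNge s0 fine_K_ge0.
have t0 := lt_le_trans s0 st.
by rewrite -lee_fin !(fine_KE Vf)// K_le.
Qed.

Lemma integral_fine_K theta f : VBV theta 1 f ->
  (\int[leb]_(t in `]0%R, +oo[) (t `^ (- theta - 1) * fine_K f t)%:E =
   VBV_norm theta 1 f)%E.
Proof.
move=> Vf; rewrite VBV_normE; apply: eq_integral => t.
rewrite inE/= in_itv/= andbT => t0; rewrite -(fine_KE Vf)// -!EFinM; congr (_%:E).
by rewrite powRD ?(gt_eqF t0) ?implybT// powR_inv1 ?(ltW t0)// mulrAC.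
Qed.

(** The weight depends on time alone, so time is taken as the outer variable; sections at
    nonpositive times are empty. *)
Lemma integral_time_sections (a : R) (S : set (E * R)) : measurable S ->
  S `<=` upper_half ->
  (\int[mu \x leb]_(z in S) ((z.2 `^ a)^-1)%:E =
   \int[leb]_(t in `]0%R, +oo[) ((t `^ (- a))%:E * mu (ysection S t)))%E.
Proof.
move=> mS SU.
pose g (z : E * R) : \bar R := ((z.2 `^ a)^-1)%:E.
have mg : measurable_fun setT g.
  by apply/measurable_EFinP; apply: measurable_invR; apply: measurable_powRl; exact: measurable_snd.
have mF : measurable_fun setT (g \_ S).
  by apply: (measurable_restrictT g mS).1; exact: measurable_funTS mg.
have F0 z : (0 <= (g \_ S) z)%E.
  by rewrite /patch; case: ifP => // _; rewrite lee_fin invr_ge0 powR_ge0.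
transitivity (\int[leb]_t fubini_G mu (g \_ S) t)%E.
  rewrite integral_mkcond; exact: (fubini_tonelli2 (m1 := mu) (m2 := leb) _ mF F0).
rewrite [RHS]integral_mkcond.
apply: eq_integral => t _; rewrite /fubini_G [in RHS]/patch.
have mSt : measurable (ysection S t) by exact: measurable_ysection.
case: ifPn => [|]; last first.
  rewrite notin_setE/= in_itv/= andbT => /negP t0.
  rewrite (eq_integral (cst 0%E)) ?integral0// => x _; rewrite /patch memNset//.
  by move=> /SU /=; exact/negP.
rewrite inE/= in_itv/= andbT => t0.
rewrite powRN -integral_cst// [RHS]integral_mkcond; apply: eq_integral => x _.
by rewrite /patch mem_ysection.
Qed.

Hypothesis d0 : (0 < d)%N.
Variables (p b beta : R).
Hypotheses (p1 : 1 < p) (b0 : b != 0) (bp : beta + 2^-1 = b * p).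

(** The constant of [level_sets_bound] for [kappa = l / (4 heat_size_sup)] and
    [C = heat_size_l1 / heat_size_sup], once the factor [(N / l)^p] has been taken out. *)
Let M : R := 8 * (@heat_size_l1 R d / @heat_size_sup R d) * (4 * @heat_size_sup R d) `^ p / `|b * p| *
  (2 `^ (p^-1 + 1)) `^ (p - 1).

Let powR_invl (x a : R) : 0 <= x -> x^-1 `^ a = (x `^ a)^-1.
Proof. by move=> x0; rewrite -powR_inv1// -powRrM mulN1r powRN. Qed.

Lemma lambda_heat_level f l : VBV p^-1 1 f -> 0 < l ->
  (lambda beta [set z | (l < cvec_norm (heat_op b f z))%R] <=
   (M * (fine (VBV_norm p^-1 1 f) / l) `^ p)%:E)%E.
Proof.
move=> Vf l0; have [gR gI] := VBV_gauss_integrable Vf; have [[cmf _] _ Noo] := Vf.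
have S0 := @heat_size_sup_gt0 R d d0; have L0 := @heat_size_l1_ge0 R d.
have mS := @measurable_heat_level R d f b l gR gI.
rewrite /lambda (_ : _ `&` _ = heat_level f b l); last first.
  by apply/seteqP; split => z /= [].
rewrite integral_time_sections//; last by move=> z [].
rewrite opprB.
have N0 : (0 <= VBV_norm p^-1 1 f)%E by exact: poweR_ge0.
have Nf : VBV_norm p^-1 1 f \is a fin_num by rewrite ge0_fin_numE.
set N := fine _.
have N00 : 0 <= N by exact: fine_ge0.
have p0 : 0 < p by exact: lt_trans p1.
apply: le_trans (level_sets_bound p1 b0 bp (kappa := l / (4 * @heat_size_sup R d))
  (C := @heat_size_l1 R d / @heat_size_sup R d) (N := N) (k := fine_K f) _ _ N00
  (fine_K_ge0 f) (fine_K_homo Vf) _ _ _ _) _.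
- by rewrite divr_gt0// mulr_gt0.
- by rewrite divr_ge0// ltW.
- by [].
- exact: measurable_fun_ysection.
- move=> t tau t0 tau0; rewrite -lte_fin (fine_KE Vf)// => h.
  apply: le_trans (heat_op_level d0 cmf t0 tau0 l0 h).
  apply: le_measure; rewrite ?inE.
  + exact: measurable_ysection.
  + rewrite (_ : [set x | _] = ysection (heat_level f b l) t).
      exact: measurable_ysection.
    by rewrite ysectionE; apply/seteqP; split => x /=; [split|case].
  + by rewrite ysectionE => x /= [].
- by rewrite (integral_fine_K Vf) /N fineK.
rewrite lee_fin le_eqVlt; apply/orP; left; apply/eqP; rewrite /M.
have k0 : 0 < 4 * @heat_size_sup R d by rewrite mulr_gt0.
move: (4 * _) k0 => k k0.
rewrite powRN (@powRM _ l k^-1 p) ?invr_ge0 ?(ltW l0) ?(ltW k0)// (powR_invl p (ltW k0)).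
rewrite (powRM p N00) ?invr_ge0 ?(ltW l0)// (powR_invl p (ltW l0)).
by rewrite (powRM (p - 1)) ?powR_ge0// -(mulr_powRB1 N00 p0) invf_div; ring.
Qed.

Lemma heat_op_weak_bound f : VBV p^-1 1 f ->
  (weak_norm (lambda beta) p (heat_op b f) <= (M `^ p^-1)%:E * VBV_norm p^-1 1 f)%E.
Proof.
move=> Vf; have [_ _ Noo] := Vf.
have S0 := @heat_size_sup_gt0 R d d0; have L0 := @heat_size_l1_ge0 R d.
have p0 : 0 < p by exact: lt_trans p1.
have M0 : 0 <= M.
  by rewrite /M mulr_ge0 ?powR_ge0// divr_ge0// mulr_ge0 ?powR_ge0// mulr_ge0// divr_ge0// ltW.
have N0 : (0 <= VBV_norm p^-1 1 f)%E by exact: poweR_ge0.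
have Nf : VBV_norm p^-1 1 f \is a fin_num by rewrite ge0_fin_numE.
apply: ub_ereal_sup => _ [l l0 <-]; rewrite /= in l0.
have N00 : 0 <= fine (VBV_norm p^-1 1 f) by exact: fine_ge0.
apply: (@le_trans _ _ (l%:E * (M * (fine (VBV_norm p^-1 1 f) / l) `^ p)%:E `^ p^-1)%E).
  apply: lee_wpmul2l; first by rewrite lee_fin ltW.
  apply: gt0_ler_poweR.
  - by rewrite invr_ge0 ltW.
  - by rewrite in_itv/= leey andbT; apply: integral_ge0 => z _; rewrite lee_fin invr_ge0 powR_ge0.
  - by rewrite in_itv/= leey andbT lee_fin mulr_ge0// powR_ge0.
  - exact: lambda_heat_level.
rewrite poweR_EFin -[in leRHS](fineK Nf) -!EFinM lee_fin.
rewrite powRM ?powR_ge0// -powRrM mulfV ?gt_eqF// powRr1 ?divr_ge0// ?(ltW l0)//.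
by rewrite mulrCA (mulrC l) divfK ?gt_eqF.
Qed.

End weak_type_bound.

Section weak_spaces.
Context {R : realType} {d : nat}.
Local Notation E := 'rV[R]_d.
Local Notation U := (@upper_half R d).

Lemma dxdtE (A : set (E * R)) : measurable (A `&` U) -> dxdt A = lambda 1 A.
Proof.
move=> mA; rewrite /lambda.
rewrite (eq_integral (cst 1%E)); last by move=> z _; rewrite subrr powRr0 invr1.
by rewrite integral_cst// mul1e.
Qed.

Lemma measurable_cvec_level n (g : E * R -> 'rV[R[i]]_n) l :
  (forall j, cmeasurable U (fun z => g z ord0 j)) ->
  measurable ([set z | (l < cvec_norm (g z))%R] `&` U).
Proof.
move=> mg; have mU := @measurable_upper_half R d.
have := measurable_fun_ltr (measurable_cst l) (measurable_cvec_norm mg).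
by move=> /(_ mU [set true]); rewrite setIC; apply.
Qed.

(** For [beta = 1] the weight is [t^0], so [lambda 1] agrees with [dxdt]; the time derivative and
    the space gradient are blocks of the vector-valued operator and inherit its weak bound. *)
Lemma weak_norm_dxdt_le n m p (g : E * R -> 'rV[R[i]]_n) (h : E * R -> 'rV[R[i]]_m) :
  0 < p ->
  (forall j, cmeasurable U (fun z => g z ord0 j)) ->
  (forall j, cmeasurable U (fun z => h z ord0 j)) ->
  (forall z, 0 < z.2 -> cvec_norm (g z) <= cvec_norm (h z)) ->
  (weak_norm dxdt p g <= weak_norm (lambda 1) p h)%E.
Proof.
move=> p0 mg mh gh; apply: ub_ereal_sup => _ [l /= l0 <-].
apply: ereal_sup_ge; exists (l%:E * lambda 1 [set z | (l < cvec_norm (h z))%R] `^ p^-1)%E.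
  by exists l.
have mgl := measurable_cvec_level l mg; have mhl := measurable_cvec_level l mh.
rewrite -dxdtE//; apply: lee_wpmul2l; first by rewrite lee_fin ltW.
apply: gt0_ler_poweR.
- by rewrite invr_ge0 ltW.
- by rewrite in_itv/= leey andbT; exact: measure_ge0.
- by rewrite in_itv/= leey andbT; exact: measure_ge0.
- apply: le_measure; rewrite ?inE// => z [/= h1 h2]; split => //=.
  exact: lt_le_trans h1 (gh _ h2).
Qed.

Lemma cvec_norm_lsubmx n m (v : 'rV[R[i]]_n) (w : 'rV[R[i]]_m) :
  cvec_norm v <= cvec_norm (row_mx v w).
Proof.
rewrite /cvec_norm ler_sqrt ?sumr_ge0//; try by move=> i _; exact: sqr_ge0.
rewrite big_split_ord/= [X in _ <= X + _](eq_bigr (fun j => Normc.normc (v ord0 j) ^+ 2)).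
  by rewrite lerDl; apply: sumr_ge0 => i _; exact: sqr_ge0.
by move=> j _; rewrite row_mxEl.
Qed.

Lemma cvec_norm_rsubmx n m (v : 'rV[R[i]]_n) (w : 'rV[R[i]]_m) :
  cvec_norm w <= cvec_norm (row_mx v w).
Proof.
rewrite /cvec_norm ler_sqrt ?sumr_ge0//; try by move=> i _; exact: sqr_ge0.
rewrite big_split_ord/= [X in _ <= _ + X](eq_bigr (fun j => Normc.normc (w ord0 j) ^+ 2)).
  by rewrite lerDr; apply: sumr_ge0 => i _; exact: sqr_ge0.
by move=> j _; rewrite row_mxEr.
Qed.

Variable hd : (0 < d)%N.
Variables (p b beta : R).
Hypotheses (p1 : 1 < p) (b0 : b != 0) (bp : beta + 2^-1 = b * p).

Lemma heat_op_bounded :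
  bounded_into_weakL (@VBV R d p^-1 1) (@VBV_norm R d p^-1 1) (lambda beta) p (heat_op b).
Proof.
eexists => f Vf; have [gR gI] := VBV_gauss_integrable Vf.
have h := heat_op_weak_bound hd p1 b0 bp Vf.
split; last exact: h.
split; first by move=> j; exact: cmeasurable_heat_op.
have [_ _ Noo] := Vf; apply: le_lt_trans h _.
have Nf : VBV_norm p^-1 1 f \is a fin_num by rewrite ge0_fin_numE// poweR_ge0.
by rewrite -(fineK Nf) -EFinM ltry.
Qed.

End weak_spaces.

Theorem corollary1p11 (R : realType) (d : nat) (hd : (0 < d)%N) (beta p : R)
    (hbeta : ~~ (- 2^-1 <= beta <= 0)) (hp : 1 < p) :
  bounded_into_weakL (@VBV R d p^-1 1) (@VBV_norm R d p^-1 1) (lambda beta) p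
    (heat_op ((2 * beta + 1) / (2 * p)))
  /\
  (forall f : 'rV[R]_d -> R[i],
    let u := heat_ext f in
    (VBV (2 / 3) 1 f ->
       heat_equation u /\
       weakL dxdt (3 / 2)
         (fun z => const_mx (dt u z.1 z.2) : 'rV[R[i]]_1)) /\
    (VBV (1 / 3) 1 f ->
       weakL dxdt 3 (fun z => gradx u z.1 z.2))).
Proof.
have p0 : 0 < p by exact: lt_trans hp.
(* Both parts of (ii) are the case [beta = 1], where [b = 3 / (2 q)]. For [q = 3 / 2] this is
   [b = 1], and the time component carries the weight [t^0]; for [q = 3] it is [b = 1 / 2], and the
   space components do. *)
have weak (q b : R) : 1 < q -> b != 0 -> 1 + 2^-1 = b * q -> forall f : 'rV[R]_d -> R[i], VBV q^-1 1 f ->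
    weakL (lambda 1) q (heat_op b f).
  move=> q1 b0 bq f Vf.
  by have [C /(_ f Vf)[]] := heat_op_bounded hd q1 b0 bq.
split.
  apply: heat_op_bounded => //.
    (* [b = 0] would mean [beta = - 1 / 2], an endpoint of the excluded closed interval. *)
    apply: contraNneq hbeta => /eqP; rewrite mulf_eq0 invr_eq0 mulf_eq0 pnatr_eq0/=.
    by rewrite (gt_eqF p0) orbF => /eqP h; apply/andP; split; lra.
  by field; rewrite gt_eqF.
move=> f u; split => Vf.
- have [gR gI] := VBV_gauss_integrable Vf; split; first exact: heat_equation_heat_ext.
  have e : 2 / 3 = (3 / 2)^-1 :> R by rewrite invf_div.
  rewrite e in Vf.
  have [|||mh hh] := weak _ 1 _ _ _ f Vf; [lra|exact: oner_neq0|lra|].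
  have mg j : cmeasurable (@upper_half R d) (fun z => (const_mx (dt u z.1 z.2) : 'rV[R[i]]_1) ord0 j).
    by under eq_fun do rewrite mxE; exact: cmeasurable_dt.
  split => //; apply: le_lt_trans hh; apply: weak_norm_dxdt_le => //.
  move=> z z0; rewrite /heat_op subrr powRr0 mul1r; exact: cvec_norm_rsubmx.
- have [gR gI] := VBV_gauss_integrable Vf.
  rewrite div1r in Vf.
  have [|||mh hh] := weak _ 2^-1 _ _ _ f Vf; [lra|by rewrite invr_eq0 pnatr_eq0|lra|].
  have mg j : cmeasurable (@upper_half R d) (fun z => gradx u z.1 z.2 ord0 j).
    by under eq_fun do rewrite mxE; exact: cmeasurable_dx.
  split => //; apply: le_lt_trans hh; apply: weak_norm_dxdt_le => //.
  move=> z z0; rewrite /heat_op subrr powRr0.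
  rewrite (_ : \row_j _ = gradx u z.1 z.2); first exact: cvec_norm_lsubmx.
  by apply/rowP => j; rewrite !mxE mul1r.
Qed.
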